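(* Let $(M,\sigma)$, $\nu$, $f$, $L$, $\Pi_t$, $G$, $(P_t)$, $(A,\mathrm{Dom}(A))$ be as in the context. Assume: (i) $M_t$ and $(M_t,\sigma_t)$ are Feller processes with strongly continuous semigroups $T_t$ on $C_0(\mathbb{R}^d)$ and $P_t$ on $C_0(\mathbb{R}^d\times[0,\infty))$, $C_c^\infty(\mathbb{R}^d)\subset \mathrm{Dom}(G)$ and $C_c^\infty(\mathbb{R}^d\times[0,\infty))\subset\mathrm{Dom}(A)$; (ii) the symbol $q(x,\xi)$ of $G$ satisfies $q(x,0)=0$ and has bounded coefficients; (iii) $x\mapsto f(\lambda,x)$ is continuous and $\sup_{x\in\mathbb{R}^d}\int_0^\infty (s\wedge 1)\,\nu(ds,x)<\infty$; (iv) $\bar u(s):=\inf_{x\in\mathbb{R}^d}\bar\nu(s,x)$ is the tail of the Lévy measure of some subordinator of infinite activity; (v) with $\overline{M}_t:=\sup_{0\le s\le t}|M_s-M_0|$, for every $\delta>0$, $\lim_{t\to0}\sup_x P^x(\overline{M}_t>\delta)=0$; (vi) for every $\lambda>0$ there are constants $0<c\le C$ such that $c\le f(\lambda,x)\le C$ for all $x\in\mathbb{R}^d$. Then for every $u\in C_0(\mathbb{R}^d)$ the mapping $[0,\infty)\ni t\mapsto q(t):=\Pi_t u$ is a mild solution of $$\frac{d}{dt}\int_0^t\big(q(s,\cdot)-q(0,\cdot)\big)\bar\nu(t-s,\cdot)\,ds=Gq(t),\qquad q(0)=u,$$ that is, $q\in C([0,\infty);C_0(\mathbb{R}^d))$,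 $\int_0^t q(s)\,ds\in\mathrm{Dom}(G)$ for all $t\ge0$, and $$\int_0^t\big(q(s,\cdot)-u(\cdot)\big)\,\bar\nu(t-s,\cdot)\,ds=G\int_0^t q(s)\,ds\qquad\text{for all } t\ge 0 .$$
   Context: $C_0(E)$: continuous functions on $E$ vanishing at infinity, with sup-norm $\|\cdot\|$. Setting. $M=(\Omega,\mathcal F,\mathcal F_t,M_t,\theta_t,P^x)$ is a non-explosive Hunt process on $\mathbb{R}^d$ (right-continuous, normal, strong Markov, quasi-left-continuous), Feller, with semigroup $T_tu(x)=\mathbb{E}^xu(M_t)$ and generator $(G,\mathrm{Dom}(G))$ on $C_0(\mathbb{R}^d)$. $(M,\sigma)$ is a Markov additive process: $\sigma$ is real-valued, adapted, right-continuous with left limits, strictly increasing, $\sigma_0=0$, $\sigma_{t+s}=\sigma_t+\sigma_s\circ\theta_t$ a.s., and $P^x(M_s\circ\theta_t\in B,\sigma_s\circ\theta_t\in B'\mid\mathcal F_t)=P^{M_t}(M_s\in B,\sigma_s\in B')$. For each $x$, $\nu(\cdot,x)$ is a measure on $(0,\infty)$ with $\int_0^\infty(s\wedge1)\nu(ds,x)<\infty$, $f(\lambda,x)=\int_0^\infty(1-e^{-\lambda s})\nu(ds,x)$, $\bar\nu(s,x)=\nu((s,\infty),x)$, and conditionally on the path of $M$ the process $\sigma$ has independent increments with $$\mathbb{E}^x\big[e^{-\lambda\sigma(y)}\mid M(w),w\le y\big]=e^{-\int_0^yf(\lambda,M_w)dw}.$$ $L(t)=\inf\{s\ge0:\sigma(s)>t\}$,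 $X(t)=M(L(t))$, $\Pi_tu(x)=\mathbb{E}^xu(M(L(t)))$. $P_th(x,z)=\mathbb{E}^xh(M_t,z+\sigma_t)$ on $C_0(\mathbb{R}^d\times[0,\infty))$, with generator $(A,\mathrm{Dom}(A))$. Symbol. On $C_c^\infty(\mathbb{R}^d)$, $Gu(x)=-\int_{\mathbb{R}^d}e^{ix\cdot\xi}q(x,\xi)\widehat u(\xi)d\xi$, $\widehat u(\xi)=(2\pi)^{-d}\int e^{-ix\cdot\xi}u(x)dx$, where $$q(x,\xi)=q(x,0)-il(x)\cdot\xi+\tfrac12\xi\cdot Q(x)\xi+\int_{\mathbb{R}^d\setminus\{0\}}\big(1-e^{iy\cdot\xi}+i\xi\cdot y\,\chi(|y|)\big)N(x,dy),$$ $Q(x)$ symmetric positive semidefinite, $\int(|y|^2\wedge1)N(x,dy)<\infty$, and $\chi$ is a truncation function with $0\le\chi(s)\le1-\kappa(s\wedge1)$ for some $\kappa>0$ and $s\chi(s)$ bounded. Bounded coefficients means $\sup_x|q(x,0)|+\sup_x|l(x)|+\sup_x|Q(x)|+\sup_x\int(|y|^2\wedge1)N(x,dy)<\infty$. Infinite activity means the Lévy measure has infinite total mass (its tail tends to $\infty$ at $0+$). *)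

(* Defs.v *)
From HB Require Import structures.
From mathcomp Require Import all_boot all_order all_algebra.
From mathcomp Require Import all_classical all_reals all_analysis.
From mathcomp Require Import measurable_realfun complex.
Set Implicit Arguments.
Unset Strict Implicit.
Unset Printing Implicit Defensive.
Import Order.TTheory GRing.Theory Num.Theory.
Import numFieldNormedType.Exports.
Local Open Scope classical_set_scope.
Local Open Scope ring_scope.

Section borel_rV.
Context (R : realType) (d : nat).
Let G : set (set 'rV[R]_d) := <<s open >>.
Let G0 : G set0. Proof. exact: sigma_algebra0. Qed.
Let GC A : G A -> G (~` A). Proof. exact: sigma_algebraC. Qed.
Let GU (F : (set 'rV[R]_d)^nat) : (forall i, G (F i)) -> G (\bigcup_i F i).
Proof. exact: sigma_algebra_bigcup. Qed.
HB.instance Definition _ :=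
  @isMeasurable.Build (sigma_display (@open 'rV[R]_d)) 'rV[R]_d G G0 GC GU.
End borel_rV.

Lemma measurable_fun_rV dT (T : measurableType dT) (R : realType) (d : nat)
    (f : T -> 'rV[R]_d) :
  (forall i, measurable_fun setT (fun x => f x 0 i)) -> measurable_fun setT f.
Proof.
move=> mf; apply: (measurability (@open 'rV[R]_d)) => // _ [U oU <-].
rewrite setTI.
pose box (p : 'rV[rat]_d) (n : nat) (v : 'rV[R]_d) :=
  forall i, ball (ratr (p 0 i) : R) n.+1%:R^-1 (v 0 i).
have -> : f @^-1` U = \bigcup_(pn : 'rV[rat]_d * nat)
    [set x | box pn.1 pn.2 `<=` U /\ box pn.1 pn.2 (f x)].
  apply/seteqP; split => [x Ux|x [[p n] _ /= [pU /pU]]//].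
  have /nbhs_ballP[e /= e0 eU] := open_nbhs_nbhs (conj oU Ux).
  pose n := Num.truncn (2 / e).
  have n2 : (n.+1%:R^-1 : R) < e / 2.
    by rewrite -[e / 2]invrK ltf_pV2 ?posrE ?invr_gt0 ?divr_gt0// invf_div truncnS_gt.
  have n0 : 0 < (n.+1%:R^-1 : R) by rewrite invr_gt0.
  have /choice[p hp] i : exists q : rat, ball (f x 0 i) n.+1%:R^-1 (ratr q : R).
    suff [_ [/[swap] -[q _ <-] hq]] :
        ball (f x 0 i) (n.+1%:R^-1 : R) `&` range ratr !=set0 by exists q.
    apply: dense_rat; last exact: ball_open.
    by exists (f x 0 i); exact: ballxx.
  exists (\row_i p i, n) => //=; split; last first.
    by move=> i; rewrite mxE; exact/ball_sym/hp.
  move=> v bv; apply: eU; split => // i j; rewrite ord1.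
  have := bv j; rewrite mxE => bj.
  apply: (@le_ball _ _ _ (n.+1%:R^-1 + n.+1%:R^-1)); last exact: ball_triangle (hp j) bj.
  by rewrite ltW// (splitr e) ltrD.
apply: countable_bigcupT_measurable => // -[p n] /=.
have [pU|npU] := pselect (box p n `<=` U); last first.
  by rewrite (_ : mkset _ = set0)//; apply/seteqP; split => // x [].
rewrite (_ : mkset _ = \bigcap_(i in [set: 'I_d])
    ((fun x => f x 0 i) @^-1` ball (ratr (p 0 i) : R) n.+1%:R^-1)); last first.
  by apply/seteqP; split => [x [_ bx] i _|x bx]; [exact: bx|split => // i; exact: bx].
apply: fin_bigcap_measurable => // i _.
rewrite -[X in measurable X]setTI; apply: mf => //.
exact: (open_measurable (ball_open _ _)).
Qed.

Lemma measurable_coord (R : realType) (d : nat) (i : 'I_d) :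
  measurable_fun setT (fun v : 'rV[R]_d => v 0 i).
Proof.
apply: (measurability _ (RGenOpens.measurableE R)) => _ [_ [a [b ->]] <-].
rewrite setTI; apply: sub_sigma_algebra.
move/continuousP : (@coord_continuous R 1 d 0 i); apply.
exact: interval_open.
Qed.

Definition consrV (R : realType) (d : nat) (p : R * 'rV[R]_d) : 'rV[R]_d.+1 :=
  \row_i (if unlift ord0 i is Some j then p.2 0 j else p.1).

Lemma measurable_consrV (R : realType) (d : nat) :
  measurable_fun setT (@consrV R d).
Proof.
apply: measurable_fun_rV => i; case: (unliftP ord0 i) => [j ->|->].
- rewrite (_ : (fun _ => _) = (fun v : 'rV[R]_d => v 0 j) \o snd).
    by apply: measurableT_comp; [exact: measurable_coord|exact: measurable_snd].
  by apply/funext => -[a v]; rewrite mxE liftK.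
- rewrite (_ : (fun _ => _) = fst) //.
  by apply/funext => -[a v]; rewrite mxE unlift_none.
Qed.

Section lebesgue_step.
Local Open Scope ereal_scope.
Context (R : realType) (d : nat) (m : {measure set 'rV[R]_d -> \bar R}).

Definition lebesgue_step : set 'rV[R]_d.+1 -> \bar R :=
  pushforward (@lebesgue_measure R \x^ m) (@consrV R d).

Let measurable_preimage_consrV A :
  measurable A -> measurable (@consrV R d @^-1` A).
Proof.
by move=> mA; rewrite -[X in measurable X]setTI; exact: measurable_consrV.
Qed.

Let step0 : lebesgue_step set0 = 0.
Proof. by rewrite /lebesgue_step /pushforward preimage_set0 measure0. Qed.

Let step_ge0 A : 0 <= lebesgue_step A.
Proof. by rewrite /lebesgue_step /pushforward measure_ge0. Qed.

Let step_sigma_additive : semi_sigma_additive lebesgue_step.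
Proof.
move=> F mF tF mUF; rewrite /lebesgue_step /pushforward preimage_bigcup.
apply: measure_semi_sigma_additive.
- by move=> n; exact: measurable_preimage_consrV.
- apply/trivIsetP => /= i j _ _ ij; rewrite -preimage_setI.
  by move/trivIsetP : tF => /(_ _ _ _ _ ij) ->//; rewrite preimage_set0.
- by rewrite -preimage_bigcup; exact: measurable_preimage_consrV.
Qed.

HB.instance Definition _ := isMeasure.Build _ _ _ lebesgue_step
  step0 step_ge0 step_sigma_additive.

End lebesgue_step.

Fixpoint lebesgue_rV (R : realType) (d : nat) :
    {measure set 'rV[R]_d -> \bar R} :=
  match d with
  | 0 => \d_(0 : 'rV[R]_0)
  | d'.+1 => lebesgue_step (lebesgue_rV R d')
  end.

Section function_spaces.
Context {R : realType}.

(* C_0(D) for a closed subset D of V; only the values on D are relevant *)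
Definition C0 {V : topologicalType} (D : set V) (f : V -> R) : Prop :=
  {within D, continuous f} /\
  forall e : R, 0 < e -> exists K, [/\ compact K, K `<=` D &
    forall x, D x -> ~ K x -> `|f x| < e].

Fixpoint Ck {V : normedModType R} (k : nat) (f : V -> R) : Prop :=
  continuous f /\
  if k is k'.+1 then
    (forall x, differentiable f x) /\ forall v, Ck k' (fun x => 'D_v f x)
  else True.

Definition smooth {V : normedModType R} (f : V -> R) : Prop :=
  forall k, Ck k f.

(* On a set D with boundary: restrictions to D of functions in C_c^oo(V) *)
Definition Cc_infty {V : normedModType R} (D : set V) (f : V -> R) : Prop :=
  exists g : V -> R, [/\ smooth g, compact (closure [set x | g x != 0]) &
    forall x, D x -> f x = g x].

Record feller_semigroup {V : topologicalType} (D : set V)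
    (T : R -> (V -> R) -> V -> R) : Prop := {
  feller_C0 : forall (t : R) u, 0 <= t -> C0 D u -> C0 D (T t u) ;
  feller_id : forall u x, C0 D u -> D x -> T 0 u x = u x ;
  feller_add : forall (s t : R) u x, 0 <= s -> 0 <= t -> C0 D u -> D x ->
    T (s + t) u x = T s (T t u) x ;
  feller_submarkov : forall (t : R) u, 0 <= t -> C0 D u ->
    (forall x, D x -> 0 <= u x <= 1) -> forall x, D x -> 0 <= T t u x <= 1 ;
  feller_strong_continuity : forall u, C0 D u ->
    {uniform D, (fun t => T t u) @ 0^'+ --> u} }.

Definition generator {V : topologicalType} (D : set V)
    (T : R -> (V -> R) -> V -> R) (u v : V -> R) : Prop :=
  [/\ C0 D u, C0 D v &
    {uniform D, (fun h x => (T h u x - u x) / h) @ 0^'+ --> v}].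

Definition generator_dom {V : topologicalType} (D : set V)
    (T : R -> (V -> R) -> V -> R) (u : V -> R) : Prop :=
  exists v, generator D T u v.

Definition half_space (V : Type) : set (V * R) := [set p | 0 <= p.2].

End function_spaces.

Section probability.
Context {R : realType} {dO : measure_display} {Omega : measurableType dO}.
Implicit Type F : R -> set (set Omega).

(* Y is a version of the conditional expectation E[X | G] *)
Definition is_cond_exp (P : probability Omega R) (G : set (set Omega))
    (X Y : Omega -> R) : Prop :=
  [/\ forall B, measurable B -> G (Y @^-1` B),
      P.-integrable setT (EFin \o Y) &
      forall A, G A -> (\int[P]_(w in A) (Y w)%:E = \int[P]_(w in A) (X w)%:E)%E].

Definition filtration F : Prop :=
  [/\ forall t : R, 0 <= t -> sigma_algebra setT (F t),
      forall t : R, 0 <= t -> F t `<=` measurable &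
      forall s t : R, 0 <= s -> s <= t -> F s `<=` F t].

Definition adapted F d (T : measurableType d) (X : R -> Omega -> T) : Prop :=
  forall (t : R) B, 0 <= t -> measurable B -> F t (X t @^-1` B).

Definition stopping_time F (S : Omega -> \bar R) : Prop :=
  (forall w, (0 <= S w)%E) /\
  forall t : R, 0 <= t -> F t [set w | (S w <= t%:E)%E].

Definition stopped_sigma_algebra F (S : Omega -> \bar R) : set (set Omega) :=
  [set A | measurable A /\
    forall t : R, 0 <= t -> F t (A `&` [set w | (S w <= t%:E)%E])].

Definition path_sigma_algebra d (T : measurableType d) (X : R -> Omega -> T)
    (I : set R) : set (set Omega) :=
  <<s [set X s @^-1` B | s in I & B in measurable] >>.

Definition right_continuous {V : topologicalType} (f : R -> V) : Prop :=
  forall t : R, 0 <= t -> f s @[s --> t^'+] --> f t.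

Definition has_left_limits {V : topologicalType} (f : R -> V) : Prop :=
  forall t : R, 0 < t -> exists l : V, f s @[s --> t^'-] --> l.

Record subordinator (P : probability Omega R) (S : R -> Omega -> R) : Prop := {
  subordinator_measurable : forall t : R, 0 <= t -> measurable_fun setT (S t) ;
  subordinator_0 : forall w, S 0 w = 0 ;
  subordinator_right_continuous : forall w, right_continuous (S ^~ w) ;
  subordinator_nondecreasing : forall w (s t : R), 0 <= s -> s <= t ->
    S s w <= S t w ;
  subordinator_stationary : forall (s t : R) B, 0 <= s -> 0 <= t -> measurable B ->
    P [set w | B (S (s + t) w - S s w)] = P (S t @^-1` B) ;
  subordinator_independent : forall n (t : nat -> R) (B : nat -> set R),
    0 <= t 0%N -> (forall i, t i <= t i.+1) -> (forall i, measurable (B i)) ->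
    P [set w | forall i, (i < n)%N -> B i (S (t i.+1) w - S (t i) w)] =
    (\prod_(i < n) P [set w | B i (S (t i.+1) w - S (t i) w)%R])%E }.

(* f(lambda) for a Levy measure mu of a subordinator *)
Definition laplace_exponent (mu : {measure set R -> \bar R}) (lambda : R) : R :=
  \int[mu]_(s in `]0, +oo[) (1 - expR (- lambda * s)).

Definition levy_measure_of (P : probability Omega R) (S : R -> Omega -> R)
    (mu : {measure set R -> \bar R}) : Prop :=
  (\int[mu]_(s in `]0%R, +oo[) (Num.min s 1)%:E < +oo)%E /\
  exists2 b : R, 0 <= b & forall t lambda : R, 0 <= t -> 0 <= lambda ->
    \int[P]_w expR (- lambda * S t w) =
    expR (- t * (b * lambda + laplace_exponent mu lambda)).

End probability.

Section euclidean.
Context {R : realType} {d : nat}.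
Implicit Types x y xi : 'rV[R]_d.

Definition dot x y : R := \sum_(i < d) x 0 i * y 0 i.

(* `|x| is the sup norm of 'rV[R]_d *)
Definition enorm x : R := Num.sqrt (dot x x).

End euclidean.

Section symbol.
Context {R : realType}.
Local Open Scope complex_scope.

Definition cis (t : R) : R[i] := cos t +i* sin t.

Definition cintegrable dT (T : measurableType dT)
    (mu : {measure set T -> \bar R}) (D : set T) (f : T -> R[i]) : Prop :=
  mu.-integrable D (fun x => (complex.Re (f x))%:E) /\
  mu.-integrable D (fun x => (complex.Im (f x))%:E).

Definition cintegral dT (T : measurableType dT)
    (mu : {measure set T -> \bar R}) (D : set T) (f : T -> R[i]) : R[i] :=
  (\int[mu]_(x in D) complex.Re (f x)) +i* (\int[mu]_(x in D) complex.Im (f x)).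

Context {d : nat}.
Local Notation E := 'rV[R]_d.

Definition fourier (u : E -> R) (xi : E) : R[i] :=
  ((2 * pi) ^- d)%:C *
  cintegral (lebesgue_rV R d) setT (fun x => cis (- dot x xi) * (u x)%:C).

Definition symbol_operator (q : E -> E -> R[i]) (u : E -> R) (x : E) : R[i] :=
  - cintegral (lebesgue_rV R d) setT
      (fun xi => cis (dot x xi) * q x xi * fourier u xi).

Definition has_symbol (G : (E -> R) -> (E -> R) -> Prop) (q : E -> E -> R[i]) :
    Prop :=
  forall u v, Cc_infty setT u -> G u v ->
    forall x, (v x)%:C = symbol_operator q u x.

Definition truncation (chi : R -> R) : Prop :=
  [/\ measurable_fun (`[0, +oo[ : set R) chi,
      exists2 kappa : R, 0 < kappa & forall s : R, 0 <= s ->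
        0 <= chi s <= 1 - kappa * Num.min s 1 &
      exists K : R, forall s : R, 0 <= s -> `|s * chi s| <= K].

Definition levy_khintchine_integrand (chi : R -> R) (xi y : E) : R[i] :=
  1 - cis (dot y xi) + 'i * (dot xi y * chi (enorm y))%:C.

(* The integrability clause makes the displayed integral meaningful: the
   inequality required of chi by itself only bounds chi from above *)
Record levy_khintchine (q : E -> E -> R[i]) (l : E -> E) (Q : E -> 'M[R]_d)
    (N : E -> {measure set E -> \bar R}) (chi : R -> R) : Prop := {
  lk_sym : forall x, (Q x)^T = Q x ;
  lk_psd : forall x xi, 0 <= dot xi (xi *m Q x) ;
  lk_levy : forall x,
    (\int[N x]_(y in ~` [set 0%R]) (Num.min (enorm y ^+ 2) 1)%:E < +oo)%E ;
  lk_truncation : truncation chi ;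
  lk_integrable : forall x xi,
    cintegrable (N x) (~` [set 0]) (levy_khintchine_integrand chi xi) ;
  lk_formula : forall x xi,
    q x xi = q x 0 - 'i * (dot (l x) xi)%:C
      + (2^-1 * dot xi (xi *m Q x))%:C
      + cintegral (N x) (~` [set 0]) (levy_khintchine_integrand chi xi) }.

Definition bounded_coefficients (q : E -> E -> R[i]) (l : E -> E)
    (Q : E -> 'M[R]_d) (N : E -> {measure set E -> \bar R}) : Prop :=
  (ereal_sup [set (complex.Re `|q x 0|)%:E | x in setT]
   + ereal_sup [set (enorm (l x))%:E | x in setT]
   + ereal_sup [set `|Q x|%:E | x in setT]
   + ereal_sup [set (\int[N x]_(y in ~` [set 0%R])
                      (Num.min (enorm y ^+ 2) 1)%:E) | x in setT] < +oo)%E.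

End symbol.

Section markov_additive.
Context {R : realType} {d : nat} {dO : measure_display}
  {Omega : measurableType dO}.
Local Notation E := 'rV[R]_d.
Variables (F : R -> set (set Omega)) (M : R -> Omega -> E)
  (theta : R -> Omega -> Omega) (P : E -> probability Omega R)
  (sigma : R -> Omega -> R).

(* Non-explosion: M takes its values in R^d at all times and every P x has
   total mass one, so that there is no cemetery state. *)
Record hunt_process : Prop := {
  hunt_filtration : filtration F ;
  hunt_adapted : adapted F M ;
  hunt_shift_measurable : forall t : R, 0 <= t -> measurable_fun setT (theta t) ;
  hunt_shift : forall (s t : R) w, 0 <= s -> 0 <= t ->
    M s (theta t w) = M (t + s) w ;
  hunt_kernel : forall (t : R) B, 0 <= t -> measurable B ->
    measurable_fun setT (fun x => P x (M t @^-1` B)) ;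
  hunt_right_continuous : forall w, right_continuous (M ^~ w) ;
  hunt_normal : forall x, P x (M 0 @^-1` [set x]) = 1%E ;
  hunt_strong_markov : forall x S (t : R) B,
    stopping_time F S -> 0 <= t -> measurable B ->
    is_cond_exp (P x) (stopped_sigma_algebra F S)
      (\1_[set w | (S w < +oo)%E /\ B (M (fine (S w) + t) w)])
      (fun w => if (S w < +oo)%E then
                  fine (P (M (fine (S w)) w) (M t @^-1` B)) else 0) ;
  hunt_quasi_left_continuous : forall x (S_ : nat -> Omega -> \bar R) S,
    (forall n, stopping_time F (S_ n)) ->
    (forall w n, (S_ n w <= S_ n.+1 w)%E) ->
    (forall w, S_ n w @[n --> \oo] --> S w) ->
    {ae P x, forall w, (S w < +oo)%E ->
      M (fine (S_ n w)) w @[n --> \oo] --> M (fine (S w)) w} }.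

Record markov_additive_process : Prop := {
  map_adapted : adapted F sigma ;
  map_right_continuous : forall w, right_continuous (sigma ^~ w) ;
  map_left_limits : forall w, has_left_limits (sigma ^~ w) ;
  map_increasing : forall w (s t : R), 0 <= s -> s < t -> sigma s w < sigma t w ;
  map_0 : forall w, sigma 0 w = 0 ;
  map_additive : forall x (s t : R), 0 <= s -> 0 <= t ->
    {ae P x, forall w, sigma (t + s) w = sigma t w + sigma s (theta t w)} ;
  map_kernel : forall (s : R) B B', 0 <= s -> measurable B -> measurable B' ->
    measurable_fun setT
      (fun x => P x ((M s @^-1` B) `&` (sigma s @^-1` B'))) ;
  map_markov : forall x (t s : R) B B', 0 <= t -> 0 <= s ->
    measurable B -> measurable B' ->
    is_cond_exp (P x) (F t)
      (\1_(theta t @^-1` ((M s @^-1` B) `&` (sigma s @^-1` B'))))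
      (fun w => fine (P (M t w) ((M s @^-1` B) `&` (sigma s @^-1` B')))) }.

Definition tail (nu : E -> {measure set R -> \bar R}) (s : R) (x : E) : \bar R :=
  nu x `]s, +oo[%classic.

Record conditional_levy_structure (nu : E -> {measure set R -> \bar R}) :
    Prop := {
  cls_levy : forall x,
    (\int[nu x]_(s in `]0%R, +oo[) (Num.min s 1)%:E < +oo)%E ;
  (* conditional independence of increments given the whole path of M *)
  cls_independent : forall x n (t : nat -> R) (B : nat -> set R)
      (Y : nat -> Omega -> R),
    0 <= t 0%N -> (forall i, t i <= t i.+1) -> (forall i, measurable (B i)) ->
    (forall i, (i < n)%N ->
      is_cond_exp (P x) (path_sigma_algebra M `[0, +oo[)
        (\1_[set w | B i (sigma (t i.+1) w - sigma (t i) w)]) (Y i)) ->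
    is_cond_exp (P x) (path_sigma_algebra M `[0, +oo[)
      (\1_[set w | forall i, (i < n)%N ->
                   B i (sigma (t i.+1) w - sigma (t i) w)])
      (fun w => \prod_(i < n) Y i w) ;
  cls_laplace : forall x (y lambda : R), 0 <= y -> 0 <= lambda ->
    is_cond_exp (P x) (path_sigma_algebra M `[0, y])
      (fun w => expR (- lambda * sigma y w))
      (fun w => expR (- \int[@lebesgue_measure R]_(s in `[0, y])
                          laplace_exponent (nu (M s w)) lambda)) }.

Definition semigroup (t : R) (u : E -> R) (x : E) : R :=
  \int[P x]_w u (M t w).

Definition joint_semigroup (t : R) (h : E * R -> R) (p : E * R) : R :=
  \int[P p.1]_w h (M t w, p.2 + sigma t w).

(* inf set0 = 0 here; under the hypotheses of the theorem the set is nonempty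
   outside a P x-null set *)
Definition inverse (t : R) (w : Omega) : R :=
  inf [set s | 0 <= s /\ t < sigma s w].

Definition time_changed (t : R) (w : Omega) : E := M (inverse t w) w.

Definition time_changed_semigroup (t : R) (u : E -> R) (x : E) : R :=
  \int[P x]_w u (time_changed t w).

Definition running_sup (t : R) (w : Omega) : \bar R :=
  ereal_sup [set (enorm (M s w - M 0 w))%:E | s in `[0, t]].

End markov_additive.

(* The C_0-valued integral of q is computed pointwise, which is legitimate as q
   is continuous. The integrand on the left is junk at s = t, a null set, where
   the tail is infinite. *)
Record mild_solution {R : realType} {d : nat}
    (G : ('rV[R]_d -> R) -> ('rV[R]_d -> R) -> Prop)
    (nu : 'rV[R]_d -> {measure set R -> \bar R})
    (u : 'rV[R]_d -> R) (q : R -> 'rV[R]_d -> R) : Prop := {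
  mild_initial : q 0 = u ;
  mild_C0 : forall t : R, 0 <= t -> C0 setT (q t) ;
  mild_continuous : forall t : R, 0 <= t ->
    {uniform setT, q @ within [set s : R | 0 <= s] (nbhs t) --> q t} ;
  mild_dom : forall t : R, 0 <= t ->
    exists v, G (fun x => \int[@lebesgue_measure R]_(s in `[0, t]) q s x) v ;
  mild_equation : forall t : R, 0 <= t ->
    G (fun x => \int[@lebesgue_measure R]_(s in `[0, t]) q s x)
      (fun x => \int[@lebesgue_measure R]_(s in `[0, t])
                  ((q s x - u x) * fine (tail nu (t - s) x))) }.

(* Main.v *)
Require Import Defs.
From HB Require Import structures.
From mathcomp Require Import all_boot all_order all_algebra.
From mathcomp Require Import all_classical all_reals all_analysis.
From mathcomp Require Import measurable_realfun complex.
From mathcomp Require Import ring lra.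
Set Implicit Arguments.
Unset Strict Implicit.
Unset Printing Implicit Defensive.
Import Order.TTheory GRing.Theory Num.Theory.
Import numFieldNormedType.Exports.
Local Open Scope classical_set_scope.
Local Open Scope ring_scope.

(** Put q t = Pi_t u and f l x = laplace_exponent (nu x) l. Discretising the inverse of sigma on a
    grid of mesh h and using the Markov property gives
    E u(M(L(t))) - u = lim_h sum_k E[1(sigma(kh) <= t) (T_h u - u)(M(kh))].
    Taking the Laplace transform in t, the sum becomes a Riemann sum for the resolvent of the semigroup
    E[u(M_t) exp(- l sigma_t)], whose generator is G - f l; so r = l int exp(- l t) q(t) dt
    satisfies G r = f l r - f l u. The same discretisation and a renewal estimate bound
    q t' - q t by the number of visits of sigma to ]t, t'], uniformly in x; this gives uniform continuity
    in time because f l tends to infinity with l, uniformly in x, by infinite activity.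
    Since f l x is the Laplace transform of the tail of nu x, the resolvent identity is the Laplace
    transform of the equation. It is inverted by approximating the Dirac mass at t by finite
    combinations of exponentials and using that G is closed. *)

(** Closedness of G asks for convergence in sup-norm, so every estimate below carries constants that
    do not depend on the starting point. The kernel [tail nu (t - s) x] varies with x; for each
    fixed x, however, the left-hand side is a scalar convolution, whose Laplace transform is
    multiplication by f l x, and the resolvent identity has exactly this form. The operators Pi_t
    form no semigroup in general, so neither [C0 (Pi_t u)] nor continuity in t comes from semigroup
    theory. The discretised identity uses the Markov property at deterministic times only, and T_h u
    - u instead of G u, hence it applies to every u in C_0. Mesh 1/(n+1) with (n+1)^2 steps lets the
    mesh vanish and the horizon grow in a single limit. The inversion uses the rates k+2 only:
    combinations of exp(- (k+2) r) are exp(- 2 r) p(exp(- r)) with p a polynomial, so a quantitative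
    Weierstrass theorem suffices. Its polynomial is chosen before the function it is applied to,
    hence before x. *)

(** * Bernstein polynomials and a quantitative Weierstrass theorem *)

Section bernstein.
Context {R : realType}.

(* The mean of [phi] of the number of successes in [n] trials of success probability [z],
   by conditioning on the first trial. *)
Fixpoint bernstein (n : nat) (phi : nat -> R) (z : R) : R :=
  if n is n'.+1 then
    (1 - z) * bernstein n' phi z + z * bernstein n' (phi \o succn) z
  else phi 0%N.

Lemma bernstein_poly n phi :
  exists p : {poly R}, forall z, p.[z] = bernstein n phi z.
Proof.
elim: n phi => [|n IH] phi; first by exists (phi 0%N)%:P => z; rewrite hornerC.
have [p hp] := IH phi; have [q hq] := IH (phi \o succn).
by exists ((1 - 'X) * p + 'X * q) => z; rewrite !hornerE hp hq.
Qed.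

Lemma le_bernstein n phi psi z : 0 <= z <= 1 ->
  (forall k, (k <= n)%N -> phi k <= psi k) ->
  bernstein n phi z <= bernstein n psi z.
Proof.
move=> /andP[z0 z1]; elim: n phi psi => [|n IH] phi psi h /=; first exact: h.
apply: lerD; apply: ler_wpM2l; rewrite ?subr_ge0//; apply: IH => k kn.
  by apply: h; exact: leqW.
exact: h.
Qed.

(** The mean of a square is the squared mean plus the binomial variance [n z (1 - z)]. The offset
    [a] is left free because conditioning on the first trial raises it by one. *)
Lemma bernstein_quadratic n (b c a : R) z :
  bernstein n (fun k => b + c * (k%:R + a) ^+ 2) z =
  b + c * ((n%:R * z + a) ^+ 2 + n%:R * z * (1 - z)).
Proof.
elim: n a => [|n IH] a /=; first by ring.
have -> : (fun k => b + c * (k%:R + a) ^+ 2) \o succn =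
          (fun k => b + c * (k%:R + (1 + a)) ^+ 2).
  by apply/funext => k /=; rewrite -[in LHS]natr1; ring.
by rewrite !IH -[in RHS]natr1; ring.
Qed.

(** Chebyshev's argument: [L a <= L d + (L / d) a^2] turns the Lipschitz bound into a quadratic one,
    whose binomial mean is explicit. Since [d ^- 2 < n], the variance contributes at most [L d], and
    [2 L d <= e]. *)
Lemma lipschitz_poly_approx (f : R -> R) (L e : R) : 0 <= L -> 0 < e ->
  (forall x y, `|f x - f y| <= L * `|x - y|) ->
  exists p : {poly R}, forall z, 0 <= z <= 1 -> `|p.[z] - f z| <= e.
Proof.
move=> L0 e0 fL.
(* [L + 1] instead of [L] keeps the quotient meaningful when [L = 0]. *)
pose d := e / (2 * (L + 1)).
have d0 : 0 < d by rewrite divr_gt0// mulr_gt0// ltr_wpDl.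
pose n := (Num.truncn (d ^- 2)).+1.
have nn0 : (0 : R) < n%:R by rewrite ltr0n.
have nd : d ^- 2 < n%:R by rewrite truncnS_gt.
have [p hp] := bernstein_poly n (fun k => f (k%:R / n%:R)).
exists p => z z01; rewrite hp.
pose c := L / (d * n%:R ^+ 2).
have c0 : 0 <= c by rewrite divr_ge0// mulr_ge0// ?ltW.
have key k : `|f (k%:R / n%:R) - f z| <= L * d + c * (k%:R - n%:R * z) ^+ 2.
  apply: (le_trans (fL _ _)).
  set a := `| _ |.
  have -> : c * (k%:R - n%:R * z) ^+ 2 = L * (a ^+ 2 / d).
    rewrite /a real_normK ?num_real// /c; field.
    by rewrite lt0r_neq0// lt0r_neq0.
  rewrite -mulrDr ler_wpM2l//.
  have [ad|da] := leP a d; first by rewrite (le_trans ad)// lerDl divr_ge0// ?sqr_ge0// ltW.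
  have a0 : 0 < a by exact: lt_trans da.
  by rewrite ler_wpDl ?(ltW d0)// ler_pdivlMr// expr2 ler_wpM2l// ltW.
have bnd s : bernstein n (fun k => s + c * (k%:R + (- (n%:R * z))) ^+ 2) z =
    s + c * (n%:R * z * (1 - z)).
  by rewrite bernstein_quadratic subrr expr0n/= add0r.
have ce : L * d + c * (n%:R * z * (1 - z)) <= e.
  have zz : z * (1 - z) <= 1.
    by case/andP: z01 => z0 z1; nra.
  have : c * (n%:R * z * (1 - z)) <= L * d.
    apply: (@le_trans _ _ (c * n%:R)).
      by rewrite ler_wpM2l// -mulrA ler_piMr// ltW.
    rewrite (_ : c * n%:R = L * (d * (d ^- 2 / n%:R))); last first.
      by rewrite /c; field; rewrite lt0r_neq0// lt0r_neq0.
    rewrite ler_wpM2l// ler_piMr ?(ltW d0)//.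
    by rewrite ler_pdivrMr// mul1r ltW.
  have : 2 * (L * d) <= e.
    rewrite (_ : 2 * _ = e * (L / (L + 1))); last first.
      by rewrite /d; field; rewrite gt_eqF// ltr_wpDl.
    have L1 : 0 < L + 1 by rewrite ltr_wpDl.
    by rewrite ler_piMr ?(ltW e0)// ler_pdivrMr// mul1r lerDl.
  by lra.
rewrite ler_distl; apply/andP; split.
- apply: (@le_trans _ _ (bernstein n (fun k => f z - L * d + (- c) * (k%:R + (- (n%:R * z))) ^+ 2) z)).
    rewrite bernstein_quadratic subrr expr0n/= add0r.
    by move: ce; lra.
  apply: le_bernstein => // k _.
  by have := key k; rewrite ler_distl => /andP[+ _]; lra.
- apply: (@le_trans _ _ (bernstein n (fun k => f z + L * d + c * (k%:R + (- (n%:R * z))) ^+ 2) z)).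
    apply: le_bernstein => // k _.
    by have := key k; rewrite ler_distl => /andP[_ +]; lra.
  by rewrite bnd; move: ce; lra.
Qed.

End bernstein.

(** * Translation, reflection and exponential densities on the line *)

Section lebesgue.
Context {R : realType}.
Notation mu := (@lebesgue_measure R).

Lemma lebesgue_measureD (h : R) (A : set R) : measurable A ->
  pushforward mu ((fun x => x + h) : _ -> measurableTypeR R) A = mu A.
Proof.
have mh : measurable_fun setT ((fun x => x + h) : measurableTypeR R -> measurableTypeR R).
  by apply: measurable_funD => //; exact: measurable_cst.
move=> mA; apply/esym/lebesgue_measure_unique => //= _ [[a b]] _ <-.
rewrite /pushforward.
rewrite (_ : _ @^-1` _ = `]a - h, b - h]%classic); last first.
  by apply/seteqP; split => x /=; rewrite !in_itv/= ltrBlDr lerBrDr.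
rewrite !lebesgue_measure_itv/= !lte_fin ltrD2r.
by case: ifP => // _; congr (_%:E); ring.
Qed.

(** Positive and negative parts are moved separately, so measurability of [f] is enough. *)
Lemma integral_shift (h : R) (D : set R) (f : R -> \bar R) :
  measurable D -> measurable_fun D f ->
  (\int[mu]_(x in D) f x = \int[mu]_(x in (fun x => (x + h)%R) @^-1` D) f (x + h)%R)%E.
Proof.
move=> mD mf.
have mh : measurable_fun setT ((fun x => x + h) : measurableTypeR R -> measurableTypeR R).
  by apply: measurable_funD => //; exact: measurable_cst.
have key g : measurable_fun D g -> (forall x, 0 <= g x)%E ->
    (\int[mu]_(x in D) g x = \int[mu]_(x in (fun x => (x + h)%R) @^-1` D) g (x + h)%R)%E.
  move=> mg g0.
  have gD : {in D, forall y, 0 <= g y}%E by move=> y _; exact: g0.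
  rewrite -[RHS](ge0_integral_pushforward mh (@lebesgue_measure R) mD mg gD).
  by apply: eq_measure_integral => A mA _; exact/esym/(lebesgue_measureD h).
rewrite [LHS]integralE [RHS]integralE.
congr (_ - _)%E.
- apply: etrans (key f^\+%E _ _) _ => //; first exact: measurable_funepos.
  by apply: eq_integral => x _; rewrite !funeposE.
- apply: etrans (key f^\-%E _ _) _ => //; first exact: measurable_funeneg.
  by apply: eq_integral => x _; rewrite !funenegE.
Qed.

Lemma integral_reflect (D : set R) (f : R -> \bar R) :
  measurable D -> measurable_fun D f ->
  (\int[mu]_(x in D) f x = \int[mu]_(x in (fun x => (- x)%R) @^-1` D) f (- x)%R)%E.
Proof.
move=> mD mf.
have mh : measurable_fun setT ((fun x => - x) : measurableTypeR R -> measurableTypeR R).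
  by apply: measurable_funN => //; exact: measurable_id.
have key g : measurable_fun D g -> (forall x, 0 <= g x)%E ->
    (\int[mu]_(x in D) g x = \int[mu]_(x in (fun x => (- x)%R) @^-1` D) g (- x)%R)%E.
  move=> mg g0.
  have gD : {in D, forall y, 0 <= g y}%E by move=> y _; exact: g0.
  rewrite -[RHS](ge0_integral_pushforward mh (@lebesgue_measure R) mD mg gD).
  by apply: eq_measure_integral => A mA _; exact/esym/lebesgue_measureN.
rewrite [LHS]integralE [RHS]integralE.
congr (_ - _)%E.
- apply: etrans (key f^\+%E _ _) _ => //; first exact: measurable_funepos.
  by apply: eq_integral => x _; rewrite !funeposE.
- apply: etrans (key f^\-%E _ _) _ => //; first exact: measurable_funeneg.
  by apply: eq_integral => x _; rewrite !funenegE.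
Qed.

Lemma integral_expR_itvy (l a : R) : 0 < l ->
  (\int[mu]_(x in `[a, +oo[) (l * expR (- l * x))%:E = (expR (- l * a))%:E)%E.
Proof.
move=> l0.
have cexp : continuous (fun x : R => expR (- l * x)).
  by move=> x; apply: continuous_comp; [exact: mulrl_continuous|exact: continuous_expR].
rewrite (@ge0_continuous_FTC2y _ _ (fun x => - (expR (- l * x))) _ 0)//.
- by rewrite EFinN oppeK add0e.
- by move=> x _; rewrite mulr_ge0 ?expR_ge0// ltW.
- apply: continuous_subspaceT => x.
  by apply: cvgM; [exact: cvg_cst|exact: cexp].
- rewrite -oppr0; apply: cvgN.
  rewrite (_ : (fun x => expR (- l * x)) =
               (fun z => expR (- z)) \o (fun z => l * z)); last first.
    by apply: eq_fun => x; rewrite mulNr.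
  apply: (@cvg_comp _ _ _ _ _ _ (pinfty_nbhs R)); last exact: cvgr_expR.
  exact: gt0_cvgMry.
- by apply: cvgN; apply/cvg_at_right_filter; exact: cexp.
- move=> x _.
  rewrite derive1_comp// derive1N// derive1_id mulN1r derive1_comp// derive1E.
  have /funeqP -> := @derive_expR R.
  by rewrite derive1Ml// derive1_id mulr1 mulrN opprK mulrC.
Qed.

End lebesgue.

(** * Real-valued integrals, expectations and dominated convergence *)

Section rintegral.
Context {d} {T : measurableType d} {R : realType}.
Variable m : {measure set T -> \bar R}.

Lemma Rintegral_dist_le (D : set T) (f g h : T -> R) : measurable D ->
  m.-integrable D (EFin \o f) -> m.-integrable D (EFin \o g) ->
  m.-integrable D (EFin \o h) -> (forall x, D x -> `|f x - g x| <= h x) ->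
  `|\int[m]_(x in D) f x - \int[m]_(x in D) g x| <= \int[m]_(x in D) h x.
Proof.
move=> mD If Ig Ih fgh; rewrite -RintegralB//.
have Ifg : m.-integrable D (EFin \o (fun x => f x - g x)).
  by rewrite (_ : _ \o _ = ((EFin \o f) \- (EFin \o g))%E)//; exact: integrableB.
apply: (le_trans (le_normr_Rintegral mD Ifg)); apply: le_Rintegral => //.
exact: integrable_norm.
Qed.

Lemma Rintegral_sum (D : set T) n (f : nat -> T -> R) : measurable D ->
  (forall k, m.-integrable D (EFin \o f k)) ->
  \int[m]_(x in D) (\sum_(k < n) f k x) = \sum_(k < n) \int[m]_(x in D) f k x.
Proof.
move=> mD If; elim: n => [|n IH].
  by under eq_Rintegral do rewrite big_ord0; rewrite big_ord0 Rintegral_cst// mul0r.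
rewrite big_ord_recr/= -IH -RintegralD//; last first.
  rewrite (_ : _ \o _ = (fun x => \sum_(k < n) (f k x)%:E)%E); last first.
    by apply/funext => x /=; rewrite sumEFin.
  by apply: integrable_sum => // k _; exact: If.
by under eq_Rintegral do rewrite big_ord_recr/=.
Qed.

Lemma bounded_integrable (D : set T) (f : T -> R) (B : R) : measurable D ->
  (m D < +oo)%E -> measurable_fun D f -> (forall x, D x -> `|f x| <= B) ->
  m.-integrable D (EFin \o f).
Proof.
move=> mD mDoo mf fB; apply: measurable_bounded_integrable => //.
exists B; split; first exact: num_real.
by move=> M BM x Dx; rewrite /= (le_trans (fB x Dx))// ltW.
Qed.

End rintegral.

Section prob_integral.
Context {d} {T : measurableType d} {R : realType}.
Variable P : probability T R.

Lemma prob_integrable (f : T -> R) (B : R) : measurable_fun setT f ->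
  (forall x, `|f x| <= B) -> P.-integrable setT (EFin \o f).
Proof.
move=> mf fB; apply: (@bounded_integrable _ _ _ _ _ _ B) => //.
by apply: (le_lt_trans (probability_le1 P measurableT)); rewrite ltry.
Qed.

Lemma prob_cst (c : R) : \int[P]_x c = c.
Proof.
rewrite Rintegral_cst//.
by have := probability_setT P => /= ->; rewrite mulr1.
Qed.

Lemma prob_dist_le (f g : T -> R) (B e : R) :
  measurable_fun setT f -> measurable_fun setT g ->
  (forall x, `|f x| <= B) -> (forall x, `|g x| <= B) ->
  (forall x, `|f x - g x| <= e) ->
  `|\int[P]_x f x - \int[P]_x g x| <= e.
Proof.
move=> mf mg fB gB fg; rewrite -[e in leRHS]prob_cst; apply: Rintegral_dist_le => //.
- exact: prob_integrable fB.
- exact: prob_integrable gB.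
- by apply: (@prob_integrable _ `|e|) => //; exact: measurable_cst.
Qed.

Lemma prob_norm_le (f : T -> R) (B : R) : measurable_fun setT f ->
  (forall x, `|f x| <= B) -> `|\int[P]_x f x| <= B.
Proof.
move=> mf fB.
have B0 : 0 <= B by exact: le_trans (fB point).
have := @prob_dist_le f (cst 0) B B mf (measurable_cst _) fB.
rewrite /cst Rintegral_cst// mul0r subr0; apply; first by move=> x; rewrite normr0.
by move=> x; rewrite subr0.
Qed.

Lemma bounded_cvg_eintegral (D : set T) (m : {measure set T -> \bar R})
   (f_ : nat -> T -> R) (f g : T -> R) : measurable D ->
  (forall n, measurable_fun D (f_ n)) -> measurable_fun D f ->
  (forall x, D x -> f_ n x @[n --> \oo] --> f x) ->
  m.-integrable D (EFin \o g) ->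
  (forall n x, D x -> `|f_ n x| <= g x) ->
  (\int[m]_(x in D) (f_ n x)%:E)%E @[n --> \oo] --> (\int[m]_(x in D) (f x)%:E)%E.
Proof.
move=> mD mf_ mf f_f ig f_g.
have h1 n : measurable_fun D (EFin \o f_ n) by exact/measurable_EFinP.
have h2 : measurable_fun D (EFin \o f) by exact/measurable_EFinP.
have h3 : {ae m, forall x, D x -> (EFin \o f_ n) x @[n --> \oo] --> (EFin \o f) x}.
  by apply: aeW => x Dx; apply: cvg_EFin; [exact: nearW|exact: f_f].
have h4 : {ae m, forall x n, D x -> (`|(EFin \o f_ n) x| <= (EFin \o g) x)%E}.
  by apply: aeW => x n Dx; rewrite /= lee_fin f_g.
by have [] := dominated_convergence mD h1 h2 h3 ig h4.
Qed.

Lemma bounded_cvg_Rintegral (D : set T) (m : {measure set T -> \bar R})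
   (f_ : nat -> T -> R) (f g : T -> R) : measurable D ->
  (forall n, measurable_fun D (f_ n)) -> measurable_fun D f ->
  (forall x, D x -> f_ n x @[n --> \oo] --> f x) ->
  m.-integrable D (EFin \o g) ->
  (forall n x, D x -> `|f_ n x| <= g x) ->
  \int[m]_(x in D) f_ n x @[n --> \oo] --> \int[m]_(x in D) f x.
Proof.
move=> mD mf_ mf f_f ig f_g.
have cv := bounded_cvg_eintegral mD mf_ mf f_f ig f_g.
apply: fine_cvg; rewrite fineK//.
apply: integrable_fin_num => //.
apply: le_integrable ig => //; first exact/measurable_EFinP.
move=> x Dx /=; rewrite lee_fin; apply: (le_trans _ (ler_norm _)).
have c1 : `|f_ n x| @[n --> \oo] --> `|f x| by apply: cvg_norm; exact: f_f.
by apply: (cvgr_to_le c1); apply: nearW => n; exact: f_g.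
Qed.

End prob_integral.

(** * Exponentially dominated functions and an approximate identity made of exponentials *)

Section exp_dominated.
Context {R : realType}.
Notation mu := (@lebesgue_measure R).

Let mD : measurable (`[0, +oo[%classic : set (measurableTypeR R)).
Proof. exact: measurable_itv. Qed.

Lemma lebesgue_measure_cc_lty (a b : R) : (lebesgue_measure `[a, b]%classic < +oo)%E.
Proof. by rewrite lebesgue_measure_itv/=; case: ifP => _; rewrite -?EFinB ltry. Qed.

Lemma Rintegral_cst_itv (c a b : R) : a <= b ->
  \int[mu]_(x in `[a, b]) c = c * (b - a).
Proof.
move=> ab; rewrite Rintegral_cst//; congr (_ * _).
transitivity (fine (lebesgue_measure (`[a, b]%classic : set R))) => //.
rewrite lebesgue_measure_itv/= lte_fin.
by case: ltgtP ab => //= -> _; rewrite subrr.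
Qed.

Lemma integrable_expR_itvy (l : R) : 0 < l ->
  mu.-integrable `[0, +oo[ (fun x => (l * expR (- l * x))%:E).
Proof.
move=> l0; apply/integrableP; split.
  apply/measurable_EFinP; apply: measurable_funM => //.
  apply: measurableT_comp => //; apply: measurable_funM => //.
under eq_integral do rewrite /= ger0_norm ?mulr_ge0 ?expR_ge0 ?(ltW l0)//.
by rewrite integral_expR_itvy// ltry.
Qed.

Lemma exp_dominated_integrable (F : R -> R) (B : R) :
  measurable_fun (`[0, +oo[ : set R) F -> (forall t, 0 <= t -> `|F t| <= B * expR (- t)) ->
  mu.-integrable `[0, +oo[ (EFin \o F).
Proof.
move=> mF FB.
have I1 := integrableZl mD B (integrable_expR_itvy ltr01).
apply: le_integrable I1 => //; first exact/measurable_EFinP.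
move=> t /=; rewrite in_itv/= andbT => t0.
by rewrite mulN1r mul1r lee_fin (le_trans (FB t t0))// ler_norm.
Qed.

Lemma exp_dominated_le (F : R -> R) (B : R) :
  measurable_fun (`[0, +oo[ : set R) F -> (forall t, 0 <= t -> `|F t| <= B * expR (- t)) ->
  `|\int[mu]_(t in `[0, +oo[) F t| <= B.
Proof.
move=> mF FB.
have IF := exp_dominated_integrable mF FB.
apply: (le_trans (le_normr_Rintegral mD IF)).
have I1 : mu.-integrable `[0, +oo[ (fun x => (1 * expR (- 1 * x))%:E).
  exact: integrable_expR_itvy.
apply: (@le_trans _ _ (\int[mu]_(t in `[0, +oo[) (B * (1 * expR (- 1 * t))))).
  apply: le_Rintegral => //; first exact: integrable_norm.
    by have := integrableZl mD B I1.
  by move=> t /=; rewrite in_itv/= andbT => t0; rewrite mulN1r mul1r FB.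
rewrite RintegralZl// /Rintegral integral_expR_itvy//= mulr0 expR0 mulr1//.
Qed.

(* In the variable [z = expR (- r)], [p] approximates a normalised tent function around
   [expR (- tau)]; one factor of [expR (- 2 * r)] is the Jacobian, the other one absorbs
   the growth of [F]. *)
Lemma approx_identity (tau eta : R) : 0 < tau -> 0 < eta ->
  exists p : {poly R}, forall (F : R -> R) (B B' : R),
    measurable_fun (`[0, +oo[ : set R) F ->
    (forall r, 0 <= r -> `|F r| <= B * expR r) ->
    (forall r, 0 <= r -> `|r - tau| <= eta -> `|F r - F tau| <= B') ->
    `|\int[mu]_(r in `[0, +oo[) (expR (- 2 * r) * p.[expR (- r)] * F r) - F tau|
      <= B' + eta * B.
Proof.
move=> tau0 eta0.
pose z0 := expR (- tau).
(* As [expR (- r)] is decreasing, lying within [dl] of [z0] forces [r] to lie within [eta] of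
   [tau]. *)
pose dl := Num.min (z0 - expR (- (tau + eta))) (expR (- (tau - eta)) - z0).
have dl0 : 0 < dl.
  by rewrite /dl lt_min !subr_gt0 !ltr_expR !ltrN2 ltrDl eta0 gtrBl eta0.
pose tent (z : R) := Num.max 0 (1 - `|z - z0| / dl).
have tent01 z : 0 <= tent z <= 1.
  rewrite /tent le_max lexx/= ge_max ler01/= gerBl.
  by rewrite divr_ge0// ltW.
have tentL x y : `|tent x - tent y| <= dl^-1 * `|x - y|.
  have max_lip (u v : R) : `|Num.max 0 u - Num.max 0 v| <= `|u - v|.
    rewrite /Num.max; case: ifPn => hu; case: ifPn => hv; rewrite -?leNgt in hu hv *.
    - by [].
    - by rewrite subr0 !ger0_norm; lra.
    - by rewrite sub0r normrN [X in X <= _]ger0_norm; [rewrite ler0_norm; lra|lra].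
    - by rewrite subrr normr0.
  apply: (le_trans (max_lip _ _)).
  have -> : 1 - `|x - z0| / dl - (1 - `|y - z0| / dl) = dl^-1 * (`|y - z0| - `|x - z0|).
    by ring.
  rewrite normrM gtr0_norm ?invr_gt0// ler_wpM2l ?invr_ge0 ?(ltW dl0)//.
  apply: (le_trans (ler_dist_dist _ _)); rewrite distrC.
  by rewrite (_ : x - z0 - (y - z0) = x - y)//; ring.
have ctent : continuous tent.
  move=> x; apply/cvgrPdist_le => e e0; near=> y.
  apply: (le_trans (tentL _ _)); rewrite mulrC ler_pdivrMr//.
  near: y; apply: cvgr_dist_le; first exact: cvg_id.
  by rewrite mulr_gt0.
have mexp (c : R) : measurable_fun setT (fun r : R => expR (c * r)).
  by apply: measurableT_comp => //; exact: measurable_funM.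
have mexpN : measurable_fun setT (fun r : R => expR (- r)).
  by apply: measurableT_comp => //; exact: measurable_funN.
have mtent : measurable_fun setT (fun r : R => tent (expR (- r))).
  apply: measurableT_comp mexpN; exact: continuous_measurable_fun.
have mpoly (p : {poly R}) : measurable_fun setT (fun r : R => p.[expR (- r)]).
  apply: (@measurableT_comp _ _ _ _ _ _ (fun z => p.[z])) mexpN.
  by apply: continuous_measurable_fun => x; exact: continuous_horner.
pose kap := \int[mu]_(r in `[0, +oo[) (expR (- 2 * r) * tent (expR (- r))).
have e2 (r : R) : expR (- 2 * r) = expR (- r) * expR (- r).
  by rewrite -expRD; congr expR; ring.
have eN1 (r : R) : 0 <= r -> expR (- r) <= 1.
  by move=> r0; rewrite -expR0 ler_expR oppr_le0.
have Itent : mu.-integrable `[0, +oo[ (EFin \o (fun r => expR (- 2 * r) * tent (expR (- r)))).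
  apply: (@exp_dominated_integrable _ 1).
    apply: measurable_funM; exact: measurable_funTS.
  move=> t t0; rewrite mul1r e2 -mulrA normrM ger0_norm ?expR_ge0//.
  rewrite ler_piMr ?expR_ge0// normrM ger0_norm ?expR_ge0//.
  have /andP[? ?] := tent01 (expR (- t)).
  by rewrite mulr_ile1 ?expR_ge0 ?normr_ge0 ?eN1// ger0_norm.
(* On [[tau, tau + dl / 2]] the tent is at least 1/2, because [expR (- r)] is 1-Lipschitz on
   nonnegative [r]. *)
have kap0 : 0 < kap.
  pose s := dl / 2.
  have s0 : 0 < s by rewrite divr_gt0.
  pose w := expR (- 2 * (tau + s)) / 2.
  have w0 : 0 < w by rewrite divr_gt0 ?expR_gt0.
  have Iw : mu.-integrable `[tau, tau + s] (EFin \o cst w).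
    apply: (@bounded_integrable _ _ _ _ _ _ w) => //.
      exact: lebesgue_measure_cc_lty.
    by move=> x _; rewrite /= gtr0_norm.
  have sub : `[tau, tau + s]%classic `<=` `[0, +oo[%classic.
    by move=> x /=; rewrite !in_itv/= andbT => /andP[+ _]; exact/le_trans/ltW.
  have Itent' := integrableS mD (measurable_itv _ : measurable (_ : set (measurableTypeR R))) sub Itent.
  apply: (@lt_le_trans _ _ (\int[mu]_(r in `[tau, tau + s]) w)).
    by rewrite Rintegral_cst_itv ?lerDl ?(ltW s0)// mulr_gt0// addrAC subrr add0r.
  apply: (@le_trans _ _ (\int[mu]_(r in `[tau, tau + s]) (expR (- 2 * r) * tent (expR (- r))))).
    apply: le_Rintegral => // r /=; rewrite in_itv/= => /andP[r1 r2].
    apply: ler_pM; rewrite ?expR_ge0 ?invr_ge0 ?ler0n//.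
      by rewrite ler_expR; lra.
    rewrite /tent le_max; apply/orP; right.
    have : `|expR (- r) - z0| <= s.
      rewrite distrC ger0_norm ?subr_ge0 ?ler_expR ?lerN2//.
      have : expR (- r) >= z0 * (1 + (tau - r)).
        have -> : expR (- r) = z0 * expR (tau - r).
          by rewrite /z0 -expRD; congr expR; ring.
        by rewrite ler_wpM2l ?expR_ge0// expR_ge1Dx.
      have : z0 <= 1 by rewrite eN1// ltW.
      have : 0 <= z0 by exact: expR_ge0.
      by nra.
    move=> h; rewrite lerBrDl -lerBrDr ler_pdivrMr//.
    by apply: (le_trans h); rewrite /s; lra.
  rewrite /kap /Rintegral fine_le//; try exact: integrable_fin_num.
  apply: ge0_subset_integral => //; first by case/integrableP : Itent.
  move=> x _; rewrite /= lee_fin mulr_ge0 ?expR_ge0//.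
  by have /andP[] := tent01 (expR (- x)).
(* The tolerance [eta * kap] becomes [eta] after the normalisation by [kap]. The polynomial is fixed
   before [F], so it serves all [F] at once. *)
have [p0 hp0] := @lipschitz_poly_approx R tent dl^-1 (eta * kap)
  ltac:(by rewrite invr_ge0 ltW) ltac:(by rewrite mulr_gt0) tentL.
exists (kap^-1 *: p0) => F B B' mF FB Ftau.
have B0 : 0 <= B.
  by have := FB 0 (lexx _); rewrite expR0 mulr1; exact: le_trans.
have F2 (r : R) : 0 <= r -> `|expR (- r) * F r| <= B.
  move=> r0; rewrite normrM ger0_norm ?expR_ge0// mulrC.
  by rewrite expRN ler_pdivrMr ?expR_gt0// FB.
(* [g1] carries the polynomial, [g2] the tent, [g3] the tent with [F] frozen at [tau]. Passing from
   [g1] to [g2] costs [eta * B], from [g2] to [g3] costs [B']. *)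
pose g1 r := expR (- 2 * r) * (kap^-1 *: p0).[expR (- r)] * F r.
pose g2 r := kap^-1 * (expR (- 2 * r) * tent (expR (- r))) * F r.
pose g3 r := kap^-1 * (expR (- 2 * r) * tent (expR (- r))) * F tau.
have mg1 : measurable_fun (`[0, +oo[ : set R) g1.
  apply: measurable_funM => //; apply: measurable_funTS.
  by apply: measurable_funM.
have mg2 : measurable_fun (`[0, +oo[ : set R) g2.
  apply: measurable_funM => //; apply: measurable_funTS.
  by apply: measurable_funM => //; exact: measurable_funM.
have Ig2 : mu.-integrable `[0, +oo[ (EFin \o g2).
  apply: (@exp_dominated_integrable _ (kap^-1 * B)) => // t t0.
  rewrite /g2 e2 (_ : _ * F t = kap^-1 * (tent (expR (- t)) * (expR (- t) * F t) * expR (- t))); last by ring.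
  rewrite normrM gtr0_norm ?invr_gt0// -[leRHS]mulrA ler_wpM2l ?invr_ge0 ?(ltW kap0)//.
  rewrite normrM [X in _ * X]ger0_norm ?expR_ge0// ler_wpM2r ?expR_ge0//.
  have /andP[? ?] := tent01 (expR (- t)).
  by rewrite normrM ger0_norm// (le_trans _ (F2 _ t0))// ler_piMl.
have d12 t : 0 <= t -> `|g1 t - g2 t| <= eta * B * expR (- t).
  move=> t0; rewrite /g1 /g2 hornerZ e2.
  set z := expR (- t).
  rewrite (_ : _ - _ = kap^-1 * (p0.[z] - tent z) * (z * F t) * z); last by ring.
  rewrite normrM [X in _ * X]ger0_norm ?expR_ge0// ler_wpM2r ?expR_ge0//.
  rewrite normrM ler_pM// ?F2// normrM gtr0_norm ?invr_gt0//.
  by rewrite ler_pdivrMl// mulrC hp0// expR_ge0/= eN1.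
have Id : mu.-integrable `[0, +oo[ (EFin \o (fun t => g1 t - g2 t)).
  by apply: (exp_dominated_integrable _ d12); exact: measurable_funB.
have Ig1 : mu.-integrable `[0, +oo[ (EFin \o g1).
  have := integrableD mD Id Ig2; apply: eq_integrable => //.
  by move=> x _; rewrite /= -EFinD subrK.
have Ig3 : mu.-integrable `[0, +oo[ (EFin \o g3).
  have := integrableZr mD (F tau)
    (integrableZl mD kap^-1 Itent).
  by apply: eq_integrable.
have g3E : \int[mu]_(r in `[0, +oo[) g3 r = F tau.
  rewrite /g3 RintegralZr//; last by have := integrableZl mD kap^-1 Itent.
  by rewrite RintegralZl// -/kap mulVf ?mul1r// gt_eqF.
have h12 : `|\int[mu]_(r in `[0, +oo[) g1 r - \int[mu]_(r in `[0, +oo[) g2 r| <= eta * B.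
  rewrite -RintegralB//; apply: exp_dominated_le => //.
  exact: measurable_funB.
have h23 : `|\int[mu]_(r in `[0, +oo[) g2 r - \int[mu]_(r in `[0, +oo[) g3 r| <= B'.
  have Ik : mu.-integrable `[0, +oo[ (EFin \o (fun r => B' * (kap^-1 * (expR (- 2 * r) * tent (expR (- r)))))).
    by have := integrableZl mD B' (integrableZl mD kap^-1 Itent).
  have -> : B' = \int[mu]_(r in `[0, +oo[) (B' * (kap^-1 * (expR (- 2 * r) * tent (expR (- r))))).
    rewrite RintegralZl//; last by have := integrableZl mD kap^-1 Itent.
    by rewrite RintegralZl// -/kap mulVf ?mulr1// gt_eqF.
  apply: Rintegral_dist_le => // r /=; rewrite in_itv/= andbT => r0.
  rewrite /g2 /g3 -mulrBr.
  have /andP[t0 t1] := tent01 (expR (- r)).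
  rewrite normrM ger0_norm ?mulr_ge0 ?invr_ge0 ?expR_ge0 ?(ltW kap0)//.
  rewrite [leRHS]mulrC.
  have [->|tn0] := eqVneq (tent (expR (- r))) 0; first by rewrite !mulr0 !mul0r.
  rewrite ler_wpM2l ?mulr_ge0 ?invr_ge0 ?expR_ge0 ?(ltW kap0)//.
  apply: Ftau => //.
  have tpos : 0 < tent (expR (- r)) by rewrite lt_def tn0.
  have : `|expR (- r) - z0| < dl.
    by move: tpos; rewrite /tent lt_max ltxx/= subr_gt0 ltr_pdivrMr// mul1r.
  rewrite /dl lt_min => /andP[h1 h2].
  rewrite ler_distl; apply/andP; split.
  - rewrite leNgt; apply/negP => rt.
    have : expR (- (tau - eta)) < expR (- r) by rewrite ltr_expR ltrN2.
    by move: h2; have := ler_norm (expR (- r) - z0); lra.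
  - rewrite leNgt; apply/negP => rt.
    have : expR (- r) < expR (- (tau + eta)) by rewrite ltr_expR ltrN2.
    by move: h1; have := lerNnormlW (lexx `|expR (- r) - z0|); lra.
rewrite -[in X in _ - X]g3E.
apply: (le_trans (ler_distD (\int[mu]_(r in `[0, +oo[) g2 r) _ _)).
by rewrite addrC lerD.
Unshelve. all: end_near. Qed.

End exp_dominated.

(** * Riemann sums with errors that vary from cell to cell *)

Section riemann.
Context {R : realType}.
Notation mu := (@lebesgue_measure R).

(** The error [a k] may depend on the cell: along a decaying semigroup it decreases geometrically,
    which gives bounds independent of the horizon [K * h]. *)
Lemma piecewise_integral_le (phi : R -> R) (h : R) (K : nat) (y a : nat -> R) :
  0 <= h -> mu.-integrable `[0, K%:R * h] (EFin \o phi) ->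
  (forall k s, (k < K)%N -> k%:R * h <= s <= k.+1%:R * h ->
    `|phi s - y k| <= a k) ->
  `|\int[mu]_(s in `[0, K%:R * h]) phi s - h * \sum_(k < K) y k|
    <= h * \sum_(k < K) a k.
Proof.
move=> h0; elim: K => [|K IH] Iphi H.
  by rewrite !big_ord0 mulr0 subr0 mul0r set_itv1 Rintegral_set1 normr0.
have sub1 : `[0, K%:R * h]%classic `<=` `[0, K.+1%:R * h]%classic.
  apply: subset_itvl; rewrite bnd_simp ler_wpM2r// ler_nat//.
have I1 : mu.-integrable `[0, K%:R * h] (EFin \o phi).
  by apply: integrableS Iphi.
have ab : K%:R * h <= K.+1%:R * h by rewrite ler_wpM2r// ler_nat.
have sub2 : `]K%:R * h, K.+1%:R * h]%classic `<=` `[0, K.+1%:R * h]%classic.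
  by apply: subset_itvr; rewrite bnd_simp mulr_ge0.
have I2 : mu.-integrable `]K%:R * h, K.+1%:R * h] (EFin \o phi).
  by apply: integrableS Iphi.
have Ic (c : R) : mu.-integrable `]K%:R * h, K.+1%:R * h] (EFin \o cst c).
  apply: (@bounded_integrable _ _ _ _ _ _ `|c|) => //.
  apply: le_lt_trans (lebesgue_measure_cc_lty (K%:R * h) (K.+1%:R * h)).
  by apply: le_measure; rewrite ?inE//; apply: subset_itv; rewrite bnd_simp.
have Vc (c : R) : \int[mu]_(s in `]K%:R * h, K.+1%:R * h]) c = h * c.
  rewrite Rintegral_itv_obnd_cbnd; last exact: Ic.
  by rewrite Rintegral_cst_itv// mulrC -[in K.+1%:R]natr1; ring.
have := @Rintegral_itvB R phi (BLeft 0) (BRight (K.+1%:R * h)) (K%:R * h) Iphi.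
rewrite !bnd_simp mulr_ge0// => /(_ isT ab) E.
have -> : \int[mu]_(s in `[0, K.+1%:R * h]) phi s =
  \int[mu]_(s in `[0, K%:R * h]) phi s + \int[mu]_(s in `]K%:R * h, K.+1%:R * h]) phi s.
  by rewrite -E; ring.
rewrite !big_ord_recr/= !mulrDr.
have -> (A B C D : R) : A + B - (C + D) = (A - C) + (B - D) by ring.
apply: (le_trans (ler_normD _ _)); apply: lerD.
  by apply: IH => // k s kK; apply: H; exact: ltnW.
rewrite -!Vc; apply: Rintegral_dist_le => //; try exact: Ic.
move=> s /=; rewrite in_itv/= => /andP[s1 s2].
by apply: H => //; rewrite s2 ltW.
Qed.

(** A Riemann sum of the decreasing function [expR (- c s)] exceeds its integral [c^-1] by at most
    one cell. Summing the series reduces this to [x (1 + c h) <= 1] for [x = expR (- c h)]. *)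
Lemma geometric_expR_le (c h : R) K : 0 < c -> 0 < h ->
  h * \sum_(k < K) expR (- c * (k%:R * h)) <= h + c^-1.
Proof.
move=> c0 h0; pose x := expR (- c * h).
have x1 : x < 1 by rewrite expR_lt1 mulNr oppr_lt0 mulr_gt0.
have sumE : (1 - x) * \sum_(k < K) expR (- c * (k%:R * h)) = 1 - x ^+ K.
  rewrite -opprB mulNr -[in RHS]opprB subrX1; congr (- (_ * _)).
  by apply: eq_bigr => k _; rewrite /x -expRM_natl; congr expR; ring.
have S1 : \sum_(k < K) expR (- c * (k%:R * h)) <= (1 - x)^-1.
  rewrite -[leRHS]mul1r ler_pdivlMr ?subr_gt0// mulrC sumE gerBl exprn_ge0//.
  exact: expR_ge0.
apply: (@le_trans _ _ (h / (1 - x))); first by rewrite ler_wpM2l// ltW.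
rewrite ler_pdivrMr ?subr_gt0//.
have xle : x * (1 + c * h) <= 1.
  apply: (@le_trans _ _ (x * expR (c * h))).
    by rewrite ler_wpM2l ?expR_ge0// expR_ge1Dx.
  by rewrite /x -expRD mulNr addNr expR0.
rewrite (_ : h = c^-1 * (c * h)); last by rewrite mulKf// gt_eqF.
rewrite (_ : c^-1 * (c * h) + c^-1 = c^-1 * (1 + c * h)); last by ring.
rewrite -mulrA ler_wpM2l ?invr_ge0 ?(ltW c0)//.
by move: xle; nra.
Qed.

End riemann.

(** * Laplace transforms of distribution functions and of Lévy tails *)

Section laplace_fubini.
Context {R : realType}.
Notation mu := (@lebesgue_measure R).
Context {d} {X : measurableType d}.
Variable m : {sigma_finite_measure set X -> \bar R}.

(** For each x, integrating [l expR (- l t)] over [t >= a x] gives [expR (- l a x)]; Fubini does the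
    rest. It is applied with [m] a truncated Lévy measure, a law [P x], and Lebesgue measure. Only
    the damped function has to be integrable: on [a x <= t] the damping is undone by the factor
    [expR (l t)]. *)
Lemma laplace_fubini (a b : X -> R) (l : R) : 0 < l ->
  measurable_fun setT a -> measurable_fun setT b -> (forall x, 0 <= a x) ->
  m.-integrable setT (fun x => (expR (- l * a x) * b x)%:E) ->
  mu.-integrable `[0, +oo[ (EFin \o (fun t => l * expR (- l * t) *
     \int[m]_x (if a x <= t then b x else 0))) /\
  \int[mu]_(t in `[0, +oo[) (l * expR (- l * t) *
     \int[m]_x (if a x <= t then b x else 0)) =
  \int[m]_x (expR (- l * a x) * b x).
Proof.
move=> l0 ma mb a0 Ib.
pose f (p : measurableTypeR R * X) : \bar R :=
  (l * expR (- l * p.1) * (if a p.2 <= p.1 then b p.2 else 0))%:E.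
have mf : measurable_fun setT f.
  apply/measurable_EFinP; apply: measurable_funM.
    apply: measurable_funM => //; apply: measurableT_comp => //.
    by apply: measurable_funM => //; exact: measurable_fst.
  apply: measurable_fun_ifT => //.
    apply: measurable_fun_ler; last exact: measurable_fst.
    exact: measurableT_comp ma measurable_snd.
  exact: measurableT_comp mb measurable_snd.
have Ie x : mu.-integrable `[a x, +oo[ (fun t => (l * expR (- l * t))%:E).
  apply: integrableS (integrable_expR_itvy l0) => //.
  by apply: subset_itvr; rewrite bnd_simp.
have fE (x : X) : (fun t => f (t, x)) =
    (fun t => (b x)%:E * (l * expR (- l * t))%:E)%E \_ `[a x, +oo[.
  apply/funext => t; rewrite patchE mem_setE in_itv/= andbT /f/=.
  by case: ifP => _; rewrite ?mulr0// mulrC EFinM.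
have Gx x : (\int[mu]_t f (t, x) = (expR (- l * a x) * b x)%:E)%E.
  rewrite fE -integral_mkcond integralZl//.
  by rewrite integral_expR_itvy// -EFinM mulrC.
have Gax x : (\int[mu]_t `|f (t, x)| = `|expR (- l * a x) * b x|%:E)%E.
  rewrite (_ : (fun t => _) =
    (fun t => `|b x|%:E * (l * expR (- l * t))%:E)%E \_ `[a x, +oo[).
    rewrite -integral_mkcond integralZl//.
    by rewrite integral_expR_itvy// -EFinM mulrC normrM [`|expR _|]ger0_norm ?expR_ge0.
  apply/funext => t; rewrite patchE mem_setE in_itv/= andbT /f/=.
  case: ifP => _; rewrite ?mulr0 ?normr0// normrM mulrC EFinM; congr (_ * _%:E)%E.
  by rewrite ger0_norm// mulr_ge0 ?expR_ge0 ?(ltW l0).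
have If : (mu \x m)%E.-integrable setT f.
  apply/(integrable21ltyP mu m mf).
  under eq_integral do rewrite Gax.
  by case/integrableP : Ib.
have Igt t : 0 <= t -> m.-integrable setT (EFin \o (fun x => if a x <= t then b x else 0)).
  move=> t0; have I1 := integrableZl measurableT (expR (l * t)) Ib.
  apply: le_integrable I1 => //.
    apply/measurable_EFinP; apply: measurable_fun_ifT => //.
    exact: measurable_fun_ler.
  move=> x _ /=; rewrite lee_fin.
  case: ifP => at_; last by rewrite normr0.
  rewrite mulrA normrM ler_peMl// -expRD ger0_norm ?expR_ge0// -expR0 ler_expR.
  by rewrite mulNr subr_ge0 ler_wpM2l// ltW.
have Fx t : 0 <= t -> (\int[m]_x f (t, x) = (l * expR (- l * t) *
     \int[m]_x (if a x <= t then b x else 0))%:E)%E.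
  move=> t0; rewrite -RintegralZl//; last exact: Igt.
  rewrite /Rintegral fineK//; apply: integrable_fin_num => //.
  have := integrableZl measurableT (l * expR (- l * t)) (Igt t t0).
  by apply: eq_integrable.
have IF := integrable_fubini_F If.
have IF' : mu.-integrable `[0, +oo[ (fubini_F m f).
  exact: integrableS IF.
split.
  apply: eq_integrable IF' => // t; rewrite inE/= in_itv/= andbT => t0.
  by rewrite /fubini_F Fx.
rewrite /Rintegral; congr fine.
transitivity (\int[mu]_(t in `[0%R, +oo[) fubini_F m f t)%E.
  by apply: eq_integral => t; rewrite inE/= in_itv/= andbT => t0; rewrite /fubini_F Fx.
transitivity (\int[mu]_t fubini_F m f t)%E.
  rewrite integral_mkcond; apply: eq_integral => t _.
  rewrite patchE mem_setE in_itv/= andbT; case: ifPn => // t0.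
  rewrite /fubini_F (eq_integral (cst 0%E)) ?integral0// => x _ /=.
  rewrite /f/= ifF ?mulr0//; apply/negbTE; apply: contra t0; exact: le_trans.
rewrite /fubini_F (Fubini If).
by apply: eq_integral => x _; rewrite Gx.
Qed.

End laplace_fubini.

Section levy_tail.
Context {R : realType}.
Notation mu := (@lebesgue_measure R).
Variable nu : {measure set R -> \bar R}.
Hypothesis nu_levy : (\int[nu]_(s in `]0%R, +oo[) (Num.min s 1)%:E < +oo)%E.

Lemma levy_tail_lty (s : R) : 0 < s -> (nu `]s, +oo[%classic < +oo)%E.
Proof.
move=> s0; pose c := Num.min s 1.
have c0 : 0 < c by rewrite lt_min s0 ltr01.
have : (c%:E * nu `]s, +oo[%classic <= \int[nu]_(s in `]0%R, +oo[) (Num.min s 1)%:E)%E.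
  rewrite -integral_cst//=.
  apply: (@le_trans _ _ (\int[nu]_(s in `]s%R, +oo[) (Num.min s 1)%:E)%E).
    apply: ge0_le_integral => //.
    - by move=> x _; rewrite lee_fin ltW.
    - by apply/measurable_EFinP; exact: measurable_minr.
    - move=> x /=; rewrite in_itv/= andbT => sx.
      by rewrite lee_fin le_min !ge_min lexx (ltW sx) orbT.
  apply: ge0_subset_integral => //.
  - by apply/measurable_EFinP; exact: measurable_minr.
  - by move=> x /=; rewrite in_itv/= andbT => x0; rewrite lee_fin le_min (ltW x0) ler01.
  - by apply: subset_itvr; rewrite bnd_simp ltW.
move=> /le_lt_trans /(_ nu_levy).
by case: (nu _) => [r|//|//]; rewrite ?ltry// gt0_muley// lte_fin.
Qed.

(** Domination by [(l + 1) * min s 1]. *)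
Lemma integrable_levy_exponent (l : R) : 0 < l ->
  nu.-integrable `]0, +oo[ (EFin \o (fun s => 1 - expR (- l * s))).
Proof.
move=> l0.
have I1 : nu.-integrable `]0, +oo[ (fun s : R => (Num.min s 1)%:E).
  apply/integrableP; split; first by apply/measurable_EFinP; exact: measurable_minr.
  under eq_integral => s.
    rewrite inE/= in_itv/= andbT => s0.
    rewrite ger0_norm ?le_min ?(ltW s0) ?ler01//. over.
  exact: nu_levy.
have I2 := integrableZl (measurable_itv _) (l + 1) I1.
apply: le_integrable I2 => //.
  apply/measurable_EFinP; apply: measurable_funB => //.
  by apply: measurableT_comp => //; exact: measurable_funM.
move=> s /=; rewrite in_itv/= andbT => s0; rewrite lee_fin.
have e1 : expR (- l * s) <= 1 by rewrite -expR0 ler_expR mulNr oppr_le0 mulr_ge0// ltW.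
have e2 := expR_ge1Dx (- l * s); have e3 := expR_ge0 (- l * s).
have m0 : 0 <= Num.min s 1 by rewrite le_min (ltW s0) ler01.
rewrite !ger0_norm; [|by rewrite mulr_ge0// addr_ge0// ltW|by rewrite subr_ge0].
rewrite /Num.min; case: ifP => _; nra.
Qed.

(** Integration by parts, obtained from Fubini. The measure may be infinite near 0, so it is first
    restricted to []1/(n+1), +oo[], where it is finite; monotone convergence on the tail side and
    dominated convergence on the exponent side remove the restriction. *)
Lemma levy_exponent_tail (l : R) : 0 < l ->
  mu.-integrable `[0, +oo[ (EFin \o (fun t =>
    l * expR (- l * t) * fine (nu `]t, +oo[%classic))) /\
  \int[nu]_(s in `]0, +oo[) (1 - expR (- l * s)) =
  \int[mu]_(t in `[0, +oo[) (l * expR (- l * t) * fine (nu `]t, +oo[%classic)).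
Proof.
move=> l0.
pose D n : set R := `]n.+1%:R^-1, +oo[%classic.
have mD n : measurable (D n) by exact: measurable_itv.
have D0 n : (0 : R) < n.+1%:R^-1 by rewrite invr_gt0.
have Doo n : (nu (D n) < +oo)%E by exact: levy_tail_lty.
pose nun n : {finite_measure set R -> \bar R} := mfrestr (mD n) (Doo n).
have nunE n A : nun n A = nu (A `&` D n) by [].
have nunT n : nun n setT = nu (D n) by rewrite nunE setTI.
have nunoo n : (nun n setT < +oo)%E by have := Doo n; rewrite -nunT.
pose tl (s : R) : \bar R := nu `]s, +oo[%classic.
(* For [t >= 0] the tail of the restricted measure at [t] is the original tail at
   [max t (1/(n+1))]. *)
pose g n t : \bar R := ((l * expR (- l * t))%:E * tl (Num.max t n.+1%:R^-1)%R)%E.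
have step n : measurable_fun (`[0, +oo[%classic : set R) (g n) /\
   (\int[mu]_(t in `[0%R, +oo[) g n t = \int[nu]_(s in D n) (1 - expR (- l * s))%:E)%E.
  (* [laplace_fubini] wants a level function that is nonnegative on all of R; [Num.max s 0] agrees
     with [s] wherever [nun n] has mass. *)
  have m1 : measurable_fun setT (fun s : R => expR (- l * Num.max s 0)).
    apply: measurableT_comp => //; apply: measurable_funM => //.
    exact: measurable_maxr.
  have e1 (s : R) : `|expR (- l * Num.max s 0) * 1| <= 1.
    rewrite mulr1 ger0_norm ?expR_ge0// -expR0 ler_expR mulNr oppr_le0.
    by rewrite mulr_ge0 ?(ltW l0)// le_max lexx orbT.
  have Ie : (nun n).-integrable setT (fun s => (expR (- l * Num.max s 0) * 1)%:E).
    apply: (@bounded_integrable _ _ _ _ _ _ 1) => //; first exact: nunoo.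
    exact: measurable_funM.
  have mmax : measurable_fun setT (fun s : R => Num.max s 0) by exact: measurable_maxr.
  have [I1 E1] := @laplace_fubini R _ _ (nun n) (fun s => Num.max s 0) (cst 1) l l0
     mmax (measurable_cst _)
     ltac:(by move=> x; rewrite le_max lexx orbT) Ie.
  have Ec (t : R) : 0 <= t ->
     (tl (Num.max t n.+1%:R^-1)%R =
      (fine (nu (D n)) - \int[nun n]_x (if Num.max x 0 <= t then 1 else 0))%:E)%E.
    move=> t0.
    have mle : measurable [set s : R | s <= t].
      rewrite (_ : mkset _ = `]-oo, t]%classic); first exact: measurable_itv.
      by apply/seteqP; split => s /=; rewrite in_itv.
    have -> : \int[nun n]_x (if Num.max x 0 <= t then 1 else 0) =
        fine (nun n [set s | s <= t]).
      rewrite -[RHS]mul1r -(Rintegral_cst (nun n))//.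
      rewrite [RHS]Rintegral_mkcond; apply: eq_Rintegral => x _.
      by rewrite patchE mem_setE ge_max t0 andbT.
    rewrite nunE.
    have := measureU nu (A := [set s : R | s <= t] `&` D n)
       (B := `](Num.max t n.+1%:R^-1), +oo[%classic).
    rewrite (_ : _ `|` _ = D n); last first.
      apply/seteqP; split => s; rewrite /D/= !in_itv/= !andbT gt_max.
        by move=> [[]//|/andP[]].
      by move=> h; case: (leP s t) => _; [left|right].
    move=> -> //; last 2 first.
    - exact: measurableI.
    - apply/seteqP; split => s //=; rewrite !in_itv/= !andbT gt_max => -[[st _] /andP[ts _]].
      by move: st; rewrite leNgt ts.
    have fin1 : (nu ([set s : R | s <= t] `&` D n) \is a fin_num).
      rewrite ge0_fin_numE//; apply: le_lt_trans (Doo n).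
      by apply: le_measure; rewrite ?inE//; exact: measurableI.
    have fin2 : (tl (Num.max t n.+1%:R^-1)%R \is a fin_num).
      rewrite ge0_fin_numE//; apply: levy_tail_lty.
      by rewrite lt_max D0 orbT.
    by rewrite fineD// addrC addKr fineK.
  have gE (t : R) : 0 <= t -> g n t =
    (l * expR (- l * t) * fine (nu (D n)) -
     l * expR (- l * t) * \int[nun n]_x (if Num.max x 0 <= t then 1 else 0))%:E.
    by move=> t0; rewrite /g Ec// -EFinM mulrBr.
  have Ia : mu.-integrable `[0, +oo[ (fun t => (l * expR (- l * t) * fine (nu (D n)))%:E).
    have := integrableZr (measurable_itv _ : measurable (_ : set (measurableTypeR R)))
      (fine (nu (D n))) (integrable_expR_itvy l0).
    by apply: eq_integrable.
  have Ig : mu.-integrable `[0, +oo[ (g n).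
    have := integrableB (measurable_itv _ : measurable (_ : set (measurableTypeR R))) Ia I1.
    apply: eq_integrable => // t; rewrite inE/= in_itv/= andbT => t0.
    by rewrite gE.
  split; first by case/integrableP : Ig.
  transitivity (\int[mu]_(t in `[0%R, +oo[) (l * expR (- l * t) * fine (nu (D n)) -
     l * expR (- l * t) * \int[nun n]_x (if Num.max x 0 <= t then 1 else 0))%:E)%E.
    by apply: eq_integral => t; rewrite inE/= in_itv/= andbT => t0; rewrite gE.
  rewrite -[LHS]fineK; last first.
    apply: integrable_fin_num => //.
    apply: eq_integrable Ig => // t; rewrite inE/= in_itv/= andbT => t0.
    by rewrite gE.
  have := RintegralB (measurable_itv _ : measurable (_ : set (measurableTypeR R))) Ia I1.
  rewrite /Rintegral /= => ->; rewrite -!/(Rintegral _ _ _) E1.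
  rewrite RintegralZr//; last exact: integrable_expR_itvy.
  rewrite [X in X * _]/Rintegral integral_expR_itvy// mulr0 expR0/= mul1r.
  rewrite -(nunT n) -[fine (nun n setT)]mul1r -(Rintegral_cst (nun n))// -RintegralB//; last first.
    apply: (@bounded_integrable _ _ _ _ _ _ 1) => //; first exact: nunoo.
    by move=> x _; rewrite normr1.
  have Il : nu.-integrable (D n) (EFin \o (fun s => 1 - expR (- l * s))).
    apply: integrableS (integrable_levy_exponent l0) => //.
    by apply: subset_itvr; rewrite bnd_simp ltW.
  rewrite -[RHS]fineK ?integrable_fin_num//; congr _%:E; rewrite -!/(Rintegral _ _ _).
  have Inun : (nun n).-integrable setT (EFin \o (fun s => 1 - expR (- l * Num.max s 0) * 1)).
    have I11 : (nun n).-integrable setT (EFin \o cst (1 : R)).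
      apply: (@bounded_integrable _ _ _ _ _ _ 1) => //; first exact: nunoo.
    by move=> x _; rewrite normr1.
    have := integrableB measurableT I11 Ie.
    by apply: eq_integrable.
  rewrite /Rintegral; congr fine.
  under eq_integral do rewrite mulr1.
  have mh : measurable_fun setT (fun s : R => (1 - expR (- l * Num.max s 0))%:E).
    by apply/measurable_EFinP; exact: measurable_funB.
  rewrite -(setUv (D n)) ge0_integral_setU//=; last 4 first.
  - exact: measurableC.
  - by rewrite setUv.
  - move=> x _; rewrite lee_fin subr_ge0.
    by have := e1 x; rewrite mulr1 ger0_norm ?expR_ge0.
  - exact/disj_setPCl.
  rewrite [X in (_ + X)%E](_ : _ = 0%E) ?adde0; last first.
    apply: null_set_integral; rewrite ?setTI//.
    - exact: measurableC.
    - exact: measurable_funTS.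
    - by apply: etrans (nunE n _) _; rewrite setICl measure0.
  transitivity (\int[nu]_(x in D n) (1 - expR (- l * Num.max x 0))%:E)%E.
    apply: eq_measure_integral => A mA AD.
    by apply: etrans (nunE n _) _; rewrite setIidl.
  apply: eq_integral => s; rewrite inE /D/= in_itv/= andbT => sn.
  by rewrite max_l// ltW// (lt_trans _ sn).
pose G t : \bar R := ((l * expR (- l * t))%:E * tl t)%E.
have lim_g (t : R) : 0 < t -> g n t @[n --> \oo] --> G t.
  move=> t0; apply: cvg_near_cst; near=> n.
  rewrite /g max_l//; near: n.
  exists (Num.truncn (t^-1)) => // n /= tn.
  rewrite invf_ple ?posrE// ltW//.
  by apply: (lt_le_trans (truncnS_gt _)); rewrite ler_nat.
have g0 n t : (0 <= g n t)%E.
  by apply: mule_ge0 => //; rewrite lee_fin mulr_ge0 ?expR_ge0 ?(ltW l0).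
have mg n : measurable_fun (`]0, +oo[%classic : set R) (g n).
  by apply: measurable_funS (step n).1 => //; apply: subset_itvr; rewrite bnd_simp.
have mG : measurable_fun (`]0, +oo[%classic : set R) G.
  by apply: (emeasurable_fun_cvg g G mg) => t /=; rewrite in_itv/= andbT; exact: lim_g.
have int_g n : (\int[mu]_(t in `]0%R, +oo[) g n t = \int[nu]_(s in D n) (1 - expR (- l * s))%:E)%E.
  by rewrite integral_itv_obnd_cbnd// (step n).2.
have limI1 : (\int[mu]_(t in `]0%R, +oo[) g n t)%E @[n --> \oo] --> (\int[mu]_(t in `]0%R, +oo[) G t)%E.
  have nd_g t : (`]0%R, +oo[%classic : set R) t -> nondecreasing_seq (g ^~ t).
    move=> _ i j ij; rewrite /g lee_wpmul2l//.
      by rewrite lee_fin mulr_ge0 ?expR_ge0 ?(ltW l0).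
    apply: le_measure; rewrite ?inE//; apply: subset_itvr; rewrite bnd_simp.
    rewrite ge_max !le_max lexx/= lef_pV2 ?posrE// ler_nat ltnS ij orbT//.
  have := @cvg_monotone_convergence _ _ _ mu _ (measurable_itv _ : measurable (`]0%R, +oo[%classic : set (measurableTypeR R))) g mg (fun n x _ => g0 n x) nd_g.
  rewrite (_ : (\int[mu]_(x in _) limn _)%E = (\int[mu]_(t in `]0%R, +oo[) G t)%E)//.
  apply: eq_integral => t; rewrite inE/= in_itv/= andbT => t0.
  by apply/cvg_lim => //; exact: lim_g.
have limI2 : (\int[nu]_(s in D n) (1 - expR (- l * s))%:E)%E @[n --> \oo] -->
    (\int[nu]_(s in `]0%R, +oo[) (1 - expR (- l * s))%:E)%E.
  have Il := integrable_levy_exponent l0.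
  pose h n (s : R) : R := if n.+1%:R^-1 < s then 1 - expR (- l * s) else 0.
  have hE n : (\int[nu]_(s in D n) (1 - expR (- l * s))%:E = \int[nu]_(s in `]0%R, +oo[) (h n s)%:E)%E.
    rewrite integral_mkcond [RHS]integral_mkcond; apply: eq_integral => s _.
    rewrite !patchE !mem_setE !in_itv/= !andbT /h.
    by case: ifP => ns; [rewrite (lt_trans _ ns)|case: ifP].
  under eq_cvg do rewrite hE.
  have mm : measurable_fun setT (fun s : R => 1 - expR (- l * s)).
    apply: measurable_funB => //.
    by apply: measurableT_comp => //; exact: measurable_funM.
  have mh n : measurable_fun (`]0, +oo[%classic : set R) (h n).
    apply: measurable_funTS; apply: measurable_fun_ifT => //.
    exact: measurable_fun_ltr.
  apply: (bounded_cvg_eintegral (f := fun s => 1 - expR (- l * s)) _ mh _ _ Il) => //.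
  - exact: measurable_funTS.
  - move=> s /=; rewrite in_itv/= andbT => s0.
    apply: cvg_near_cst; near=> n; rewrite /= /h ifT//; near: n.
    exists (Num.truncn (s^-1)) => // n /= tn.
    rewrite invf_plt ?posrE//.
    by apply: (lt_le_trans (truncnS_gt _)); rewrite ler_nat.
  - move=> n s /=; rewrite in_itv/= andbT => s0; rewrite /h.
    have e1 : 0 <= 1 - expR (- l * s).
      by rewrite subr_ge0 -expR0 ler_expR mulNr oppr_le0 mulr_ge0// ltW.
    by case: ifP => _; rewrite ?normr0// ger0_norm.
have EG : (\int[mu]_(t in `]0%R, +oo[) G t = \int[nu]_(s in `]0%R, +oo[) (1 - expR (- l * s))%:E)%E.
  move: limI1; rewrite (_ : (fun n => (\int[mu]_(t in `]0%R, +oo[) g n t)%E) =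
    (fun n => (\int[nu]_(s in D n) (1 - expR (- l * s))%:E)%E)); last exact/funext.
  by move=> h; apply: (cvg_unique _ h limI2); exact: ereal_hausdorff.
have GE (t : R) : 0 < t -> G t = (l * expR (- l * t) * fine (nu `]t, +oo[%classic))%:E.
  move=> t0; have tfin : tl t \is a fin_num by rewrite ge0_fin_numE// levy_tail_lty.
  by rewrite /G -(fineK tfin) -EFinM.
have IG : mu.-integrable `]0, +oo[ (EFin \o (fun t => l * expR (- l * t) * fine (nu `]t, +oo[%classic))).
  have : mu.-integrable `]0, +oo[ G.
    apply/integrableP; split => //.
    under eq_integral do rewrite gee0_abs ?mule_ge0 ?lee_fin ?mulr_ge0 ?expR_ge0 ?(ltW l0)//.
    rewrite EG ltey_eq integrable_fin_num//.
    exact: integrable_levy_exponent.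
  apply: eq_integrable => // t; rewrite inE/= in_itv/= andbT => t0.
  by rewrite GE.
split.
  (* Adding the endpoint 0, where [fine] may turn an infinite tail into 0, changes only a null
     set. *)
  case/integrableP : IG => mIG fIG; apply/integrableP; split.
    exact/emeasurable_fun_itv_obnd_cbndP.
  rewrite -integral_itv_obnd_cbnd//.
  exact: measurableT_comp.
rewrite -Rintegral_itv_obnd_cbnd//.
rewrite /Rintegral -EG; congr fine.
by apply: eq_integral => t; rewrite inE/= in_itv/= andbT => t0; rewrite GE.
Unshelve. all: end_near. Qed.

End levy_tail.

(** * Joint measurability of right-continuous processes, and step functions *)

Section measurability.
Context {R : realType} {d} {T : measurableType d}.

(** The process is the pointwise limit of processes that are constant in time on the cells of a
    grid. Clipping the time at 0 gives a function on the whole product although paths are controlled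
    on [[0, +oo[] only. *)
Lemma right_continuous_measurable (X : R -> T -> R) :
  (forall s, 0 <= s -> measurable_fun setT (X s)) ->
  (forall w s, 0 <= s -> X r w @[r --> s^'+] --> X s w) ->
  measurable_fun setT (fun p : R * T => X (Num.max p.1 0) p.2).
Proof.
move=> mX cX.
pose g m (p : R * T) : R := m.+1%:R * Num.max p.1 0.
have mg m : measurable_fun setT (g m).
  apply: measurable_funM; first exact: measurable_cst.
  by apply: measurable_maxr; [exact: measurable_fst|exact: measurable_cst].
have g0 m p : 0 <= g m p by rewrite mulr_ge0// le_max lexx orbT.
(* [k.+1], not [k]: the right end of the cell lies strictly beyond the given time, as a limit along
   [s'^'+] demands. *)
pose gr (m k : nat) : R := k.+1%:R / m.+1%:R.
apply: (@measurable_fun_cvg _ _ _ _ (fun m p => X (gr m (Num.truncn (g m p))) p.2)).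
- move=> m _ B mB; rewrite setTI.
  rewrite (_ : _ @^-1` _ = \bigcup_k ((g m @^-1` `[k%:R, k.+1%:R[%classic) `&`
      ((fun p => X (gr m k) p.2) @^-1` B))); last first.
    apply/seteqP; split => [p Bp|p [k _ []]].
      exists (Num.truncn (g m p)) => //; split => //=.
      by rewrite in_itv/= truncn_itv.
    by rewrite /= in_itv/= => /truncn_def ->.
  apply: bigcup_measurable => k _; apply: measurableI.
    by rewrite -[X in measurable X]setTI; apply: mg.
  rewrite -[X in measurable X]setTI.
  have := measurableT_comp (mX (gr m k) _) (@measurable_snd _ _ R T).
  by apply => //; rewrite divr_ge0.
- move=> [s w] _ /=.
  have s0 : 0 <= Num.max s 0 by rewrite le_max lexx orbT.
  set s' := Num.max s 0 in s0 *.
  apply: (@cvg_comp _ _ _ (fun m => gr m (Num.truncn (m.+1%:R * s'))) (X ^~ w) _ (s'^'+)); last exact: cX.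
  have s_lt m : s' < gr m (Num.truncn (m.+1%:R * s')).
    by rewrite /gr ltr_pdivlMr// mulrC truncnS_gt.
  have s_le m : gr m (Num.truncn (m.+1%:R * s')) <= s' + m.+1%:R^-1.
    rewrite /gr -natr1 mulrDl mul1r lerD2r ler_pdivrMr// mulrC.
    by rewrite truncn_le mulr_ge0.
  have lim : gr m (Num.truncn (m.+1%:R * s')) @[m --> \oo] --> s'.
    apply: (@squeeze_cvgr _ _ _ _ (cst s') (fun m => s' + m.+1%:R^-1)).
    - by apply: nearW => m /=; rewrite ltW/= ?s_le.
    - exact: cvg_cst.
    - rewrite -[X in _ --> X]addr0; apply: cvgD; first exact: cvg_cst.
      exact: cvg_harmonic.
  by move=> A /lim /= [N _ hN]; exists N => // m Nm /=; apply: hN.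
Qed.

(** The range [[- B, B]] is sliced into cells of width [e]. The level sets appear as preimages under
    [u], the form in which the Markov property for events can be applied to them. *)
Lemma step_approximation (u : T -> R) (B e : R) : measurable_fun setT u ->
  (forall y, `|u y| <= B) -> 0 < e ->
  exists n (c : nat -> R) (A : nat -> set R),
   (forall k, measurable (A k)) /\
   forall y, `|u y - \sum_(k < n) c k * \1_(u @^-1` A k) y| <= e.
Proof.
move=> mu uB e0.
pose n := (Num.truncn (2 * B / e)).+1.
exists n, (fun k => k%:R * e - B), (fun k : nat => `[k%:R * e - B, k.+1%:R * e - B[%classic).
split=> [k|y]; first exact: measurable_itv.
have := uB y; rewrite ler_norml => /andP[uB1 uB2].
have v0 : 0 <= (u y + B) / e by rewrite divr_ge0 ?(ltW e0)//; lra.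
pose k0 := Num.truncn ((u y + B) / e).
have /andP[k1 k2] := truncn_itv v0; rewrite -/k0 in k1 k2.
rewrite ler_pdivlMr// in k1; rewrite ltr_pdivrMr// in k2.
have k0n : (k0 < n)%N.
  rewrite ltnS /k0; apply: le_truncn; rewrite ler_pM2r ?invr_gt0//; lra.
rewrite (bigD1 (Ordinal k0n))//= big1 ?addr0; last first.
  move=> [k kn] /= kk0; rewrite indicE memNset ?mulr0//= in_itv/= => /andP[h1 h2].
  move/negP: kk0; apply; apply/eqP/val_inj => /=.
  rewrite /k0; apply/esym/truncn_def.
  by rewrite ler_pdivlMr// ltr_pdivrMr//; apply/andP; split; lra.
rewrite indicE mem_set/= ?mulr1; last first.
  by rewrite in_itv/=; apply/andP; split; lra.
move: k2; rewrite -natr1 mulrDl mul1r => k2.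
by rewrite ler_norml; apply/andP; split; lra.
Qed.

End measurability.

(** * The space C_0: algebra and uniform limits *)

Section C0_functions.
Context {R : realType} {V : topologicalType}.
Implicit Types u v : V -> R.
Local Notation C0 := (C0 [set: V]).

Lemma C0_continuous u : C0 u -> continuous u.
Proof. by case=> cu _; apply/continuous_subspace_setT. Qed.

Lemma C0_bounded u : C0 u -> exists2 B, 0 <= B & forall x, `|u x| <= B.
Proof.
move=> C; have cu := C0_continuous C; case: C => _ /(_ 1 ltr01)[K [cK _ hK]].
have [B [_ hB]] : bounded_set (u @` K).
  by apply: compact_bounded; apply: continuous_compact => //; exact: continuous_subspaceT.
exists (Num.max 1 (B + 1)); first by rewrite le_max ler01.
move=> x; have [Kx|nKx] := pselect (K x).
  rewrite le_max; apply/orP; right; apply: hB; first by rewrite ltrDl.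
  by exists x.
by rewrite le_max (ltW (hK x I nKx)).
Qed.

Lemma C0_intro u : continuous u ->
  (forall e, 0 < e -> exists2 K, compact K & forall x, ~ K x -> `|u x| < e) -> C0 u.
Proof.
move=> cu h; split; first exact: continuous_subspaceT.
by move=> e /h[K cK hK]; exists K; split => // x _; exact: hK.
Qed.

Lemma C0_outside u e : C0 u -> 0 < e ->
  exists2 K, compact K & forall x, ~ K x -> `|u x| < e.
Proof. by case=> _ h /h[K [cK _ hK]]; exists K => // x; exact: hK. Qed.

Lemma C0_lin (a : R) u v : C0 u -> C0 v -> C0 (fun x => a * u x + v x).
Proof.
move=> Cu Cv; apply: C0_intro.
  move=> x; apply: cvgD; last exact: C0_continuous.
  by apply: cvgM; [exact: cvg_cst|exact: C0_continuous].
move=> e e0.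
have a1 : 0 < `|a| + 1 by rewrite ltr_wpDl.
have [K1 c1 h1] := C0_outside Cu (divr_gt0 (divr_gt0 e0 (ltr0n R 2)) a1).
have [K2 c2 h2] := C0_outside Cv (divr_gt0 e0 (ltr0n R 2)).
exists (K1 `|` K2); first exact: compactU.
move=> x K12; have n1 : ~ K1 x by move=> ?; apply: K12; left.
have n2 : ~ K2 x by move=> ?; apply: K12; right.
apply: (le_lt_trans (ler_normD _ _)); rewrite (splitr e); apply: ler_ltD; last exact: h2.
rewrite normrM; apply: (@le_trans _ _ ((`|a| + 1) * `|u x|)).
  by rewrite ler_wpM2r// lerDl.
by rewrite mulrC -ler_pdivlMr// ltW// h1.
Qed.

Lemma C0_zero : C0 (fun=> 0 : R).
Proof.
apply: C0_intro; first exact: cst_continuous.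
by move=> e e0; exists set0; [exact: compact0|move=> x _; rewrite normr0].
Qed.

Lemma C0_scale (a : R) u : C0 u -> C0 (fun x => a * u x).
Proof.
move=> Cu; have := C0_lin a Cu C0_zero.
by under eq_fun do rewrite addr0.
Qed.

Lemma C0_sub u v : C0 u -> C0 v -> C0 (fun x => u x - v x).
Proof.
move=> Cu Cv; have := C0_lin (- 1) Cv Cu.
by rewrite (_ : (fun x => _) = (fun x => u x - v x))//; apply/funext => x; ring.
Qed.

Lemma C0_add u v : C0 u -> C0 v -> C0 (fun x => u x + v x).
Proof.
move=> Cu Cv; have := C0_lin 1 Cu Cv.
by rewrite (_ : (fun x => _) = (fun x => u x + v x))//; apply/funext => x; ring.
Qed.

Lemma C0_sum n (c : nat -> R) (u : nat -> V -> R) : (forall k, C0 (u k)) ->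
  C0 (fun x => \sum_(k < n) c k * u k x).
Proof.
move=> Cu; elim: n => [|n IH].
  by under eq_fun do rewrite big_ord0; exact: C0_zero.
under eq_fun do rewrite big_ord_recr/= addrC.
exact: C0_lin.
Qed.

Lemma C0_mul (f : V -> R) (B : R) u : continuous f -> (forall x, `|f x| <= B) ->
  C0 u -> C0 (fun x => f x * u x).
Proof.
move=> cf fB Cu; apply: C0_intro.
  by move=> x; apply: cvgM; [exact: cf|exact: C0_continuous].
move=> e e0.
have B1 : 0 < `|B| + 1 by rewrite ltr_wpDl.
have [K cK h] := C0_outside Cu (divr_gt0 e0 B1).
exists K => // x /h; rewrite ltr_pdivlMr// mulrC => /(le_lt_trans _); apply.
rewrite normrM ler_wpM2r// (le_trans (fB x))// (le_trans (ler_norm _))//.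
by rewrite lerDl.
Qed.

Lemma C0_uniform_limit u :
  (forall e, 0 < e -> exists2 v, C0 v & forall x, `|u x - v x| <= e) -> C0 u.
Proof.
move=> h; apply: C0_intro.
  move=> x; apply/cvgrPdist_lt => e e0.
  have e4 : 0 < e / 4 by rewrite divr_gt0.
  have [v Cv hv] := h _ e4.
  have /cvgrPdist_lt /(_ _ e4) := C0_continuous Cv (x := x).
  apply: filterS => y hy.
  rewrite (_ : u x - u y = (u x - v x) + (v x - v y) - (u y - v y)); last by ring.
  apply: (le_lt_trans (ler_normB _ _)).
  have := ler_normD (u x - v x) (v x - v y).
  have := hv x; have := hv y; lra.
move=> e e0; have e2 : 0 < e / 2 by rewrite divr_gt0.
have [v Cv hv] := h _ e2.
have [K cK hK] := C0_outside Cv e2.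
exists K => // x /hK; have := hv x.
have := ler_normD (u x - v x) (v x); rewrite subrK; lra.
Qed.

End C0_functions.

(** * Strongly continuous contraction semigroups on C_0 and their generators *)

(** Common interface for the semigroup of M and its damped versions. Strong continuity is stated
    with a [dl] chosen before the point x, and includes [h = 0]. *)
Record contraction_semigroup {R : realType} {V : topologicalType}
    (S : R -> (V -> R) -> V -> R) : Prop := {
  cs_C0 : forall t u, 0 <= t -> C0 setT u -> C0 setT (S t u) ;
  cs_lin : forall t a u v x, 0 <= t -> C0 setT u -> C0 setT v ->
    S t (fun y => a * u y + v y) x = a * S t u x + S t v x ;
  cs_le : forall t u B x, 0 <= t -> C0 setT u -> (forall y, `|u y| <= B) ->
    `|S t u x| <= B ;
  cs_0 : forall u x, C0 setT u -> S 0 u x = u x ;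
  cs_add : forall s t u x, 0 <= s -> 0 <= t -> C0 setT u ->
    S (s + t) u x = S s (S t u) x ;
  cs_cont : forall u, C0 setT u -> forall e, 0 < e -> exists2 dl, 0 < dl &
    forall h x, 0 <= h <= dl -> `|S h u x - u x| <= e }.

Definition time_integral {R : realType} {V : topologicalType}
    (S : R -> (V -> R) -> V -> R) (b : R) (u : V -> R) (x : V) : R :=
  \int[@lebesgue_measure R]_(s in `[0, b]) S s u x.

(** The generator relation with the difference quotient multiplied out: the remainder is o(h),
    uniformly in x. *)
Definition is_gen {R : realType} {V : topologicalType}
    (S : R -> (V -> R) -> V -> R) (u v : V -> R) : Prop :=
  [/\ C0 setT u, C0 setT v & forall e, 0 < e -> exists2 dl, 0 < dl &
    forall h x, 0 < h <= dl -> `|S h u x - u x - h * v x| <= e * h].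

Section semigroup_theory.
Context {R : realType} {V : topologicalType} {S : R -> (V -> R) -> V -> R}.
Hypothesis hS : contraction_semigroup S.
Implicit Types u v : V -> R.
Local Notation C0 := (C0 [set: V]).
Local Notation I := (time_integral S).
Notation mu := (@lebesgue_measure R).

Lemma cs_sub t u v x : 0 <= t -> C0 u -> C0 v ->
  S t (fun y => u y - v y) x = S t u x - S t v x.
Proof.
move=> t0 Cu Cv.
rewrite (_ : (fun y => u y - v y) = (fun y => (- 1) * v y + u y)); last first.
  by apply/funext => y; ring.
by rewrite (cs_lin hS)//; ring.
Qed.

Lemma cs_zero t x : 0 <= t -> S t (fun=> 0) x = 0.
Proof.
move=> t0; have := cs_sub x t0 C0_zero C0_zero.
by under [fun y => _]funext do rewrite subr0; rewrite subrr.
Qed.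

Lemma cs_scale t a u x : 0 <= t -> C0 u ->
  S t (fun y => a * u y) x = a * S t u x.
Proof.
move=> t0 Cu; have := cs_lin hS a x t0 Cu C0_zero.
by under [fun y => _]funext do rewrite addr0; rewrite cs_zero// addr0.
Qed.

Lemma cs_sum t n (c : nat -> R) (u : nat -> V -> R) x : 0 <= t ->
  (forall k, C0 (u k)) ->
  S t (fun y => \sum_(k < n) c k * u k y) x = \sum_(k < n) c k * S t (u k) x.
Proof.
move=> t0 Cu; elim: n => [|n IH].
  under [fun y => _]funext do rewrite big_ord0.
  by rewrite big_ord0 cs_zero.
under [fun y => _]funext do rewrite big_ord_recr/= addrC.
rewrite (cs_lin hS)//; last exact: C0_sum.
by rewrite IH big_ord_recr/= addrC.
Qed.

Lemma cs_dist t u v e x : 0 <= t -> C0 u -> C0 v ->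
  (forall y, `|u y - v y| <= e) -> `|S t u x - S t v x| <= e.
Proof. by move=> t0 Cu Cv h; rewrite -cs_sub//; apply: (cs_le hS) => //; exact: C0_sub. Qed.

(** Contractivity transports the modulus of continuity at time 0 to all times. *)
Lemma cs_modulus u e : C0 u -> 0 < e -> exists2 dl, 0 < dl &
  forall s t x, 0 <= s -> 0 <= t -> `|s - t| <= dl -> `|S s u x - S t u x| <= e.
Proof.
move=> Cu e0; have [dl dl0 h] := cs_cont hS Cu e0; exists dl => // s t x.
wlog st : s t / t <= s => [W s0 t0|].
  have [ts|/ltW st] := leP t s; first exact: W.
  by rewrite distrC => ?; rewrite distrC; exact: W.
move=> s0 t0; rewrite ger0_norm ?subr_ge0// => std.
have st0 : 0 <= s - t by rewrite subr_ge0.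
rewrite (_ : s = t + (s - t)); last by ring.
rewrite (cs_add hS)//; apply: cs_dist => //; first exact: cs_C0.
by move=> y; apply: h; rewrite st0.
Qed.

(** Continuing the orbit constantly to negative times makes it continuous on the whole line, which
    settles its measurability. *)
Lemma continuous_cs u x : C0 u -> continuous (fun s : R => S (Num.max s 0) u x).
Proof.
move=> Cu s; apply/cvgrPdist_le => e e0; have [dl dl0 h] := cs_modulus Cu e0.
near=> r; apply: h; rewrite ?le_max ?lexx ?orbT//.
apply: (@le_trans _ _ `|s - r|).
  have := ler_norm (s - r); have := ler_norm (r - s); rewrite distrC => h1 h2.
  by rewrite /Num.max; case: ifP => a1; case: ifP => a2; rewrite ler_norml; lra.
by near: r; apply: cvgr_dist_le; first exact: cvg_id.
Unshelve. all: end_near. Qed.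

Lemma measurable_cs u x : C0 u -> measurable_fun setT (fun s : R => S (Num.max s 0) u x).
Proof. by move=> Cu; apply: continuous_measurable_fun; exact: continuous_cs. Qed.

Lemma integrable_cs a b u x : 0 <= a -> C0 u ->
  mu.-integrable `[a, b] (EFin \o (fun s => S s u x)).
Proof.
move=> a0 Cu; have [B B0 uB] := C0_bounded Cu.
have Im : mu.-integrable `[a, b] (EFin \o (fun s : R => S (Num.max s 0) u x)).
  apply: (@bounded_integrable _ _ _ _ _ _ B) => //.
  - exact: lebesgue_measure_cc_lty.
  - by apply: measurable_funTS; exact: measurable_cs.
  - by move=> s _; apply: (cs_le hS) => //; rewrite le_max lexx orbT.
apply: eq_integrable Im => // s; rewrite inE/= in_itv/= => /andP[as_ _].
by rewrite max_l// (le_trans a0).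
Qed.

Lemma time_integral_riemann h K u x e : 0 <= h -> C0 u ->
  (forall r y, 0 <= r <= h -> `|S r u y - u y| <= e) ->
  `|I (K%:R * h) u x - h * \sum_(k < K) S (k%:R * h) u x| <= h * (K%:R * e).
Proof.
move=> h0 Cu H.
have -> : K%:R * e = \sum_(k < K) e by rewrite sumr_const card_ord mulr_natl.
apply: (@piecewise_integral_le R (fun s => S s u x) h K (fun k => S (k%:R * h) u x) (fun=> e)) => //.
  exact: integrable_cs.
move=> k s kK /andP[s1 s2].
have kh0 : 0 <= k%:R * h by rewrite mulr_ge0.
rewrite (_ : s = k%:R * h + (s - k%:R * h)); last by ring.
rewrite (cs_add hS) ?subr_ge0//; apply: cs_dist => //.
  by apply: (cs_C0 hS) => //; rewrite subr_ge0.
move=> y; apply: H; rewrite subr_ge0 s1/= lerBlDl (le_trans s2)//.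
by rewrite -natr1 mulrDl mul1r.
Qed.

Lemma riemann_approx b u e : 0 <= b -> C0 u -> 0 < e ->
  exists2 n0, (0 < n0)%N & forall n x, (n0 <= n)%N ->
  `|I b u x - b / n%:R * \sum_(k < n) S (k%:R * (b / n%:R)) u x| <= e.
Proof.
move=> b0 Cu e0.
have b1 : 0 < b + 1 by rewrite ltr_wpDl.
have [dl dl0 H] := cs_cont hS Cu (divr_gt0 e0 b1).
exists (Num.truncn (b / dl)).+1 => // n x n0n.
have n0 : (0 < n)%N by exact: leq_trans n0n.
have nn0 : (0 : R) < n%:R by rewrite ltr0n.
have bn : b = n%:R * (b / n%:R) by rewrite mulrC divfK// gt_eqF.
rewrite {1}bn; apply: le_trans (time_integral_riemann _ _ _ Cu _) _.
- by rewrite divr_ge0.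
- move=> r y /andP[r0 rb]; apply: H; rewrite r0/= (le_trans rb)//.
  rewrite ler_pdivrMr// mulrC -ler_pdivrMr// ltW//.
  by apply: (lt_le_trans (truncnS_gt _)); rewrite ler_nat.
- rewrite mulrCA mulrA -bn mulrA ler_pdivrMr//.
  by rewrite mulrC ler_wpM2l ?(ltW e0)// lerDl.
Qed.

Lemma time_integral_C0 b u : 0 <= b -> C0 u -> C0 (I b u).
Proof.
move=> b0 Cu; apply: C0_uniform_limit => e e0.
have [n n0 H] := riemann_approx b0 Cu e0.
exists (fun x => b / n%:R * \sum_(k < n) S (k%:R * (b / n%:R)) u x).
  apply: C0_scale; have := @C0_sum _ V n (fun=> 1) (fun k => S (k%:R * (b / n%:R)) u).
  rewrite (_ : (fun x => \sum_(k < n) 1 * _) =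
               (fun x => \sum_(k < n) S (k%:R * (b / n%:R)) u x)); last first.
    by apply/funext => x; apply: eq_bigr => k _; rewrite mul1r.
  apply=> k; apply: (cs_C0 hS) => //; rewrite mulr_ge0// divr_ge0//.
by move=> x; exact: H.
Qed.

(** [S h] is an abstract linear contraction, so it is moved under the integral through Riemann sums
    that converge uniformly in x. *)
Lemma cs_time_integral h b u x : 0 <= h -> 0 <= b -> C0 u ->
  S h (I b u) x = I b (S h u) x.
Proof.
move=> h0 b0 Cu; apply/eqP; rewrite -subr_eq0 -normr_le0; apply/ler_addgt0Pr => e e0.
rewrite add0r.
have e2 : 0 < e / 2 by rewrite divr_gt0.
have Ch := cs_C0 hS h0 Cu.
have [n1 n10 H1] := riemann_approx b0 Cu e2.
have [n2 n20 H2] := riemann_approx b0 Ch e2.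
pose n := maxn n1 n2.
have kb (k : nat) : 0 <= k%:R * (b / n%:R) by rewrite mulr_ge0// divr_ge0.
pose s k := S (k%:R * (b / n%:R)) u.
have Cs k : C0 (s k) by exact: cs_C0.
have Csum : C0 (fun y => b / n%:R * \sum_(k < n) s k y).
  apply: C0_scale; have := @C0_sum _ V n (fun=> 1) s Cs.
  rewrite (_ : (fun x => \sum_(k < n) 1 * _) = (fun x => \sum_(k < n) s k x))//.
  by apply/funext => y; apply: eq_bigr => k _; rewrite mul1r.
have E : S h (fun y => b / n%:R * \sum_(k < n) s k y) x =
   b / n%:R * \sum_(k < n) S (k%:R * (b / n%:R)) (S h u) x.
  rewrite (_ : (fun y => b / n%:R * \sum_(k < n) s k y) =
    (fun y => \sum_(k < n) (b / n%:R) * s k y)); last by apply/funext => y; rewrite mulr_sumr.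
  rewrite (cs_sum _ (fun=> b / n%:R))// mulr_sumr; apply: eq_bigr => k _; congr (_ * _).
  by rewrite /s -!(cs_add hS)// addrC.
rewrite (_ : _ - _ = (S h (I b u) x - S h (fun y => b / n%:R * \sum_(k < n) s k y) x) -
  (I b (S h u) x - b / n%:R * \sum_(k < n) S (k%:R * (b / n%:R)) (S h u) x)); last first.
  by rewrite E; ring.
apply: (le_trans (ler_normB _ _)); rewrite (splitr e); apply: lerD.
  apply: cs_dist => //; first exact: time_integral_C0.
  by move=> y; apply: H1; rewrite leq_maxl.
by apply: H2; rewrite leq_maxr.
Qed.

Lemma time_integralD b h u x : 0 <= b -> 0 <= h -> C0 u ->
  I (b + h) u x = I b u x + I h (S b u) x.
Proof.
move=> b0 h0 Cu.
have := @Rintegral_itvB R (fun s => S s u x) (BLeft 0) (BRight (b + h)) b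
  (integrable_cs _ _ (lexx 0) Cu).
rewrite !bnd_simp b0 lerDl h0 => /(_ isT isT) E.
rewrite /time_integral (_ : \int[mu]_(s in `[0, b + h]) S s u x =
  \int[mu]_(s in `[0, b]) S s u x + \int[mu]_(s in `]b, b + h]) S s u x); last by rewrite -E; ring.
congr (_ + _).
rewrite Rintegral_itv_obnd_cbnd; last first.
  by apply: integrableS (integrable_cs (b + h) x b0 Cu) => //; apply: subset_itvr; rewrite bnd_simp.
rewrite /Rintegral (@integral_shift R b)//; last first.
  by case/integrableP : (integrable_cs (b + h) x b0 Cu).
rewrite (_ : _ @^-1` _ = `[0, h]%classic); last first.
  by apply/seteqP; split => s /=; rewrite !in_itv/=; lra.
congr fine; apply: eq_integral => s; rewrite inE/= in_itv/= => /andP[s0 _].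
by rewrite (cs_add hS).
Qed.

Lemma time_integral_dist a u x (c e : R) : 0 <= a -> C0 u ->
  (forall s, 0 <= s <= a -> `|S s u x - c| <= e) -> `|I a u x - a * c| <= a * e.
Proof.
move=> a0 Cu H.
have := @piecewise_integral_le R (fun s => S s u x) a 1 (fun=> c) (fun=> e) a0.
rewrite mul1r !big_ord_recr !big_ord0/= !add0r; apply; first exact: integrable_cs.
by move=> k s; rewrite ltnS leqn0 => /eqP ->; rewrite mul0r mul1r; exact: H.
Qed.

Lemma time_integral_le a u B x : 0 <= a -> C0 u -> (forall y, `|u y| <= B) ->
  `|I a u x| <= a * B.
Proof.
move=> a0 Cu uB; have := @time_integral_dist a u x 0 B a0 Cu.
rewrite mulr0 subr0; apply => s /andP[s0 _]; rewrite subr0.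
exact: (cs_le hS).
Qed.

(** The difference is the integral over [[a, a + h]] minus that over [[0, h]]. Averaged functions
    thus have [S h v - v = O(h)] with an explicit constant. *)
Lemma time_integral_lipschitz a h u B x : 0 <= a -> 0 <= h -> C0 u ->
  (forall y, `|u y| <= B) -> `|S h (I a u) x - I a u x| <= 2 * B * h.
Proof.
move=> a0 h0 Cu uB; rewrite cs_time_integral//.
have E1 := time_integralD x a0 h0 Cu.
have E2 := time_integralD x h0 a0 Cu.
rewrite addrC E1 in E2.
rewrite (_ : _ - _ = I h (S a u) x - I h u x); last by move: E2; lra.
apply: (le_trans (ler_normB _ _)).
have h1 := @time_integral_le h (S a u) B x h0 (cs_C0 hS a0 Cu) (fun y => cs_le hS y a0 Cu uB).
have h2 := @time_integral_le h u B x h0 Cu uB.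
by lra.
Qed.

(** [[0, h]] is cut into n equal steps: the increments of the orbit telescope, each is a step length
    times [S s v] up to o(step) by contractivity, and their sum is a Riemann sum of [S s v].
    Together with [integral_is_gen] this trades the derivative at 0 for an integral identity that is
    stable under uniform limits. *)
Lemma is_gen_integral u v : is_gen S u v ->
  forall h x, 0 <= h -> S h u x - u x = I h v x.
Proof.
move=> [Cu Cv H] h x h0.
apply/eqP; rewrite -subr_eq0 -normr_le0; apply/ler_addgt0Pr => e e0; rewrite add0r.
have h1 : 0 < h + 1 by rewrite ltr_wpDl.
have e2 : 0 < e / 2 by rewrite divr_gt0.
have [dl dl0 Hd] := H _ (divr_gt0 e2 h1).
have [n1 n10 H1] := riemann_approx h0 Cv e2.
have [->|hn0] := eqVneq h 0.
  rewrite (cs_0 hS)// subrr sub0r normrN; have [B B0 vB] := C0_bounded Cv.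
  have := @time_integral_le 0 v _ x (lexx 0) Cv vB.
  by rewrite mul0r => /le_trans; apply; exact: ltW.
have hpos : 0 < h by rewrite lt_def hn0.
pose n := maxn n1 (Num.truncn (h / dl)).+1.
have nn0 : (0 : R) < n%:R by rewrite ltr0n /n leq_max orbT.
pose k_ := h / n%:R.
have k0 : 0 < k_ by rewrite divr_gt0.
have kdl : k_ <= dl.
  rewrite ler_pdivrMr// mulrC -ler_pdivrMr// ltW//.
  by apply: (lt_le_trans (truncnS_gt _)); rewrite ler_nat leq_maxr.
have hk : n%:R * k_ = h by rewrite /k_ mulrC divfK// gt_eqF.
have kk (k : nat) : 0 <= k%:R * k_ by rewrite mulr_ge0// ltW.
have tele : S h u x - u x = \sum_(k < n) (S (k.+1%:R * k_) u x - S (k%:R * k_) u x).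
  rewrite -(big_mkord xpredT (fun k => S (k.+1%:R * k_) u x - S (k%:R * k_) u x)).
  by rewrite telescope_sumr// hk mul0r (cs_0 hS).
have term k : `|S (k.+1%:R * k_) u x - S (k%:R * k_) u x - k_ * S (k%:R * k_) v x|
    <= e / 2 / (h + 1) * k_.
  rewrite (_ : k.+1%:R * k_ = k%:R * k_ + k_); last by rewrite -natr1; ring.
  rewrite (cs_add hS)//; last exact: ltW.
  have Ck := cs_C0 hS (ltW k0) Cu.
  rewrite -cs_sub// -cs_scale// -cs_sub//; [|exact: C0_sub|exact: C0_scale].
  apply: (cs_le hS) => //.
    by apply: C0_sub; [exact: C0_sub|exact: C0_scale].
  by move=> y; apply: Hd; rewrite k0.
rewrite (_ : _ - _ = (S h u x - u x - k_ * \sum_(k < n) S (k%:R * k_) v x) -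
   (I h v x - k_ * \sum_(k < n) S (k%:R * k_) v x)); last by ring.
apply: (le_trans (ler_normB _ _)); rewrite (splitr e); apply: lerD; last first.
  by apply: H1; rewrite leq_maxl.
rewrite tele mulr_sumr -sumrB; apply: (le_trans (ler_norm_sum _ _ _)).
apply: (@le_trans _ _ (\sum_(k < n) e / 2 / (h + 1) * k_)); first exact: ler_sum.
rewrite sumr_const card_ord -[leLHS]mulr_natl.
have -> : n%:R * (e / 2 / (h + 1) * k_) = e / 2 * (h / (h + 1)).
  by rewrite (_ : n%:R * _ = e / 2 / (h + 1) * (n%:R * k_)); [rewrite hk; ring|ring].
by rewrite ler_piMr ?(ltW e2)// ler_pdivrMr// mul1r lerDl.
Qed.

Lemma integral_is_gen u v : C0 u -> C0 v ->
  (forall h x, 0 <= h -> S h u x - u x = I h v x) -> is_gen S u v.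
Proof.
move=> Cu Cv H; split => // e e0.
have [dl dl0 Hd] := cs_cont hS Cv e0; exists dl => // h x /andP[h0 hd].
rewrite H ?(ltW h0)// [leRHS]mulrC; apply: time_integral_dist => //; first exact: ltW.
by move=> s /andP[s0 sh]; apply: Hd; rewrite s0 (le_trans sh).
Qed.

(** The integral identity passes to the limit. The two terms in u cost one tolerance each and the
    integral of v costs h of them, whence the divisor [h + 2]. *)
Lemma is_gen_closed u v :
  (forall e, 0 < e -> exists u' v', [/\ is_gen S u' v',
     forall x, `|u x - u' x| <= e & forall x, `|v x - v' x| <= e]) ->
  is_gen S u v.
Proof.
move=> H.
have Cu : C0 u.
  by apply: C0_uniform_limit => e /H[u' [v' [[Cu' _ _] hu _]]]; exists u'.
have Cv : C0 v.
  by apply: C0_uniform_limit => e /H[u' [v' [[_ Cv' _] _ hv]]]; exists v'.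
apply: integral_is_gen => // h x h0.
apply/eqP; rewrite -subr_eq0 -normr_le0; apply/ler_addgt0Pr => e e0; rewrite add0r.
have h2 : 0 < h + 2 by rewrite ltr_wpDl.
have [u' [v' [G hu hv]]] := H _ (divr_gt0 e0 h2).
have E := is_gen_integral G x h0; case: G => Cu' Cv' _.
have d1 := @cs_dist h u u' _ x h0 Cu Cu' hu.
have d2 : `|I h v x - I h v' x| <= h * (e / (h + 2)).
  have := @time_integral_le h (fun y => v y - v' y) _ x h0 (C0_sub Cv Cv') hv.
  rewrite {1}/time_integral.
  under eq_Rintegral => s.
    rewrite inE/= in_itv/= => /andP[s0 _]; rewrite cs_sub//. over.
  by rewrite RintegralB//; exact: integrable_cs.
rewrite (_ : _ - _ = (S h u x - S h u' x) - (u x - u' x) - (I h v x - I h v' x)); last first.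
  by rewrite -E; ring.
have := hu x.
have := ler_normB ((S h u x - S h u' x) - (u x - u' x)) (I h v x - I h v' x).
have := ler_normB (S h u x - S h u' x) (u x - u' x).
have : e = h * (e / (h + 2)) + 2 * (e / (h + 2)) by field; rewrite gt_eqF.
move: d1 d2; set k := e / (h + 2); move: (h * k) => hk.
by lra.
Qed.

Lemma is_gen_lin a u v u' v' : is_gen S u v -> is_gen S u' v' ->
  is_gen S (fun x => a * u x + u' x) (fun x => a * v x + v' x).
Proof.
move=> G G'; have E := is_gen_integral G; have E' := is_gen_integral G'.
case: G => Cu Cv _; case: G' => Cu' Cv' _.
apply: integral_is_gen; try exact: C0_lin.
move=> h x h0; rewrite (cs_lin hS)//.
rewrite {1}/time_integral.
under eq_Rintegral => s.
  rewrite inE/= in_itv/= => /andP[s0 _]; rewrite (cs_lin hS)//. over.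
have Iv := integrable_cs h x (lexx 0) Cv; have Iv' := integrable_cs h x (lexx 0) Cv'.
rewrite RintegralD//; last by have := integrableZl (measurable_itv _ : measurable (_ : set (measurableTypeR R))) a Iv.
rewrite RintegralZl//= -!/(time_integral _ _ _ _) -E// -E'//; ring.
Qed.

Lemma is_gen_zero : is_gen S (fun=> 0) (fun=> 0).
Proof.
split; try exact: C0_zero.
move=> e e0; exists 1 => // h x /andP[h0 _].
by rewrite cs_zero ?(ltW h0)// mulr0 !subr0 normr0 mulr_ge0// ltW.
Qed.

Lemma is_gen_sum n (c : nat -> R) (u v : nat -> V -> R) :
  (forall k, is_gen S (u k) (v k)) ->
  is_gen S (fun x => \sum_(k < n) c k * u k x) (fun x => \sum_(k < n) c k * v k x).
Proof.
move=> G; elim: n => [|n IH].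
  by under eq_fun do rewrite big_ord0; under [X in is_gen _ _ X]eq_fun do rewrite big_ord0; exact: is_gen_zero.
rewrite (_ : (fun x => \sum_(k < n.+1) c k * u k x) = (fun x => c n * u n x + \sum_(k < n) c k * u k x)); last first.
  by apply/funext => x; rewrite big_ord_recr/= addrC.
rewrite (_ : (fun x => \sum_(k < n.+1) c k * v k x) = (fun x => c n * v n x + \sum_(k < n) c k * v k x)); last first.
  by apply/funext => x; rewrite big_ord_recr/= addrC.
exact: is_gen_lin.
Qed.

End semigroup_theory.

(** * The resolvent of a semigroup damped at rate f *)

Section resolvent.
Context {R : realType} {V : topologicalType} {T S : R -> (V -> R) -> V -> R}.
Hypothesis hT : contraction_semigroup T.
Hypothesis hS : contraction_semigroup S.
Variables (c : R) (f : V -> R) (C : R).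
Hypothesis c_gt0 : 0 < c.
Hypothesis S_decay : forall t u B x, 0 <= t -> C0 setT u -> (forall y, `|u y| <= B) ->
  `|S t u x| <= expR (- c * t) * B.
Hypothesis f_continuous : continuous f.
Hypothesis f_le : forall x, `|f x| <= C.
(** This expresses that the generator of [S] is that of [T] minus multiplication by f, as an
    expansion valid on all of C_0, so also for functions outside the domains. *)
Hypothesis TS_diff : forall u, C0 setT u -> forall e, 0 < e -> exists2 dl, 0 < dl &
  forall h x, 0 < h <= dl -> `|T h u x - S h u x - h * (f x * u x)| <= e * h.
Local Notation C0 := (C0 [set: V]).
Local Notation I := (time_integral S).

(** [S h] moves [I b g] by [I h (S b g) - I h g], which is [h (S b g - g)] up to o(h); [TS_diff]
    adds [h f] times [I b g]. *)
Lemma time_integral_gen b g : 0 <= b -> C0 g ->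
  is_gen T (I b g) (fun x => f x * I b g x + (S b g x - g x)).
Proof.
move=> b0 Cg.
have Cr := time_integral_C0 hS b0 Cg.
have Cb := cs_C0 hS b0 Cg.
split => //; first by apply: C0_add; [exact: C0_mul|exact: C0_sub].
move=> e e0; have e3 : 0 < e / 3 by rewrite divr_gt0.
have [d1 d10 H1] := TS_diff Cr e3.
have [d2 d20 H2] := cs_cont hS Cg e3.
have [d3 d30 H3] := cs_cont hS Cb e3.
exists (Num.min d1 (Num.min d2 d3)); first by rewrite !lt_min d10 d20.
move=> h x /andP[h0]; rewrite !le_min => /andP[hd1 /andP[hd2 hd3]].
have E1 := time_integralD hS x b0 (ltW h0) Cg.
have E2 := time_integralD hS x (ltW h0) b0 Cg.
rewrite addrC E1 -(cs_time_integral hS x (ltW h0) b0 Cg) in E2.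
have K1 := @time_integral_dist _ _ _ hS h g x (g x) (e / 3) (ltW h0) Cg.
have K2 := @time_integral_dist _ _ _ hS h (S b g) x (S b g x) (e / 3) (ltW h0) Cb.
have {}K1 : `|I h g x - h * g x| <= h * (e / 3).
  by apply: K1 => s /andP[s0 sh]; apply: H2; rewrite s0 (le_trans sh).
have {}K2 : `|I h (S b g) x - h * S b g x| <= h * (e / 3).
  by apply: K2 => s /andP[s0 sh]; apply: H3; rewrite s0 (le_trans sh).
have K3 := H1 h x; rewrite h0 hd1 in K3; have {}K3 := K3 isT.
rewrite (_ : _ - _ = (T h (I b g) x - S h (I b g) x - h * (f x * I b g x)) +
  (I h (S b g) x - h * S b g x) - (I h g x - h * g x)); last first.
  have -> : S h (I b g) x = I b g x + I h (S b g) x - I h g x by move: E2; lra.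
  by ring.
apply: (le_trans (ler_normB _ _)).
have := ler_normD (T h (I b g) x - S h (I b g) x - h * (f x * I b g x)) (I h (S b g) x - h * S b g x).
have -> : e * h = e / 3 * h + h * (e / 3) + h * (e / 3) by field.
by lra.
Qed.

(** Exponential decay makes the cell errors summable: the bound does not grow with [K], which is
    needed because the horizon tends to infinity. *)
Lemma time_integral_riemann_decay h K g x e : 0 < h -> C0 g ->
  (forall r y, 0 <= r <= h -> `|S r g y - g y| <= e) ->
  `|I (K%:R * h) g x - h * \sum_(k < K) S (k%:R * h) g x| <= (h + c^-1) * e.
Proof.
move=> h0 Cg H.
have e0 : 0 <= e by apply: le_trans (H 0 x _); rewrite ?lexx ?(ltW h0).
apply: (@le_trans _ _ (h * \sum_(k < K) (expR (- c * (k%:R * h)) * e))); last first.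
  by rewrite -mulr_suml mulrA ler_wpM2r// geometric_expR_le.
apply: (@piecewise_integral_le R (fun s => S s g x) h K (fun k => S (k%:R * h) g x)
   (fun k => expR (- c * (k%:R * h)) * e)); rewrite ?(ltW h0)//.
  exact: integrable_cs.
move=> k s kK /andP[s1 s2].
have kh0 : 0 <= k%:R * h by rewrite mulr_ge0// ltW.
have sk : 0 <= s - k%:R * h by rewrite subr_ge0.
have Cs := cs_C0 hS sk Cg.
rewrite (_ : s = k%:R * h + (s - k%:R * h)); last by ring.
rewrite (cs_add hS)// -(cs_sub hS)//; apply: S_decay => //; first exact: C0_sub.
move=> y; apply: H; rewrite sk/= lerBlDl (le_trans s2)//.
by rewrite -natr1 mulrDl mul1r.
Qed.

Lemma time_integral_decay K g B x : C0 g -> (forall y, `|g y| <= B) ->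
  `|I K%:R g x| <= (1 + c^-1) * B.
Proof.
move=> Cg gB.
have B0 : 0 <= B by exact: le_trans (gB x).
apply: (@le_trans _ _ (1 * \sum_(k < K) (expR (- c * (k%:R * 1)) * B))); last first.
  by rewrite -mulr_suml mulrA ler_wpM2r// geometric_expR_le.
have := @piecewise_integral_le R (fun s => S s g x) 1 K (fun k => 0)
   (fun k => expR (- c * (k%:R * 1)) * B) ler01.
rewrite mulr1 big1// mulr0 subr0; apply; first exact: integrable_cs.
move=> k s kK /andP[]; rewrite mulr1 => s1 s2; rewrite subr0.
have s0 : 0 <= s by exact: le_trans s1.
apply: (le_trans (S_decay _ _ _ gB)) => //.
by rewrite ler_wpM2r// ler_expR !mulNr lerN2 ler_wpM2l// ltW.
Qed.

Lemma expR_decay (B e : R) : 0 < e -> exists N, forall n, (N <= n)%N ->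
  expR (- c * n%:R) * B <= e.
Proof.
move=> e0; exists (Num.truncn (B / (c * e))).+1 => n Nn.
have nn0 : (0 : R) < n%:R by rewrite ltr0n (leq_trans _ Nn).
have hB : B <= c * e * n%:R.
  rewrite mulrC -ler_pdivrMr ?mulr_gt0// ltW//.
  by apply: (lt_le_trans (truncnS_gt _)); rewrite ler_nat.
apply: (@le_trans _ _ (expR (- c * n%:R) * (c * e * n%:R))).
  by rewrite ler_wpM2l ?expR_ge0.
rewrite mulNr expRN ler_pdivrMl ?expR_gt0//.
have := expR_ge1Dx (c * n%:R).
rewrite -(ler_pM2r e0) mulrDl mul1r => h.
by apply: le_trans h; rewrite ler_wpDl ?(ltW e0)// mulrAC.
Qed.

(* [T h u - u = (S h u - u) + h (f * u) + o(h)]: the first part telescopes, the second one gives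
   a Riemann sum of [S s (f * u)]. *)
Lemma resolvent_gen (u r : V -> R) : C0 u ->
  (forall x, (\sum_(k < n.+1 ^ 2) S (k%:R * n.+1%:R^-1)
      (fun y => T n.+1%:R^-1 u y - u y) x) @[n --> \oo] --> r x - u x) ->
  is_gen T r (fun x => f x * r x - f x * u x).
Proof.
move=> Cu lim.
pose g x := f x * u x.
have Cg : C0 g by exact: C0_mul.
have [Bu Bu0 uB] := C0_bounded Cu; have [Bg Bg0 gB] := C0_bounded Cg.
have nh n : (n.+1 ^ 2)%:R * n.+1%:R^-1 = n.+1%:R :> R.
  by rewrite natrX expr2 mulfK.
have key e : 0 < e -> exists N, forall n x, (N <= n)%N ->
  `|\sum_(k < n.+1 ^ 2) S (k%:R * n.+1%:R^-1) (fun y => T n.+1%:R^-1 u y - u y) x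
    - (I n.+1%:R g x - u x)| <= e.
  move=> e0.
  have c1 : 0 < 1 + c^-1 by rewrite addr_gt0// invr_gt0.
  have e3 : 0 < e / 3 by rewrite divr_gt0.
  (* The weights [h expR (- c k h)] sum to at most [h + c^-1 <= 1 + c^-1]. *)
  have e' : 0 < e / 3 / (1 + c^-1) by rewrite divr_gt0.
  have [d1 d10 H1] := TS_diff Cu e'.
  have [d2 d20 H2] := cs_cont hS Cg e'.
  have [N1 HN1] := expR_decay Bu e3.
  pose N2 := Num.truncn ((Num.min d1 d2)^-1).
  exists (maxn N1 N2) => n x; rewrite geq_max => /andP[n1 n2].
  set h := n.+1%:R^-1.
  have h0 : 0 < h by rewrite invr_gt0.
  have hd : h <= Num.min d1 d2.
    rewrite invf_ple ?posrE ?lt_min ?d10// ltW//.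
    by apply: (lt_le_trans (truncnS_gt _)); rewrite ler_nat.
  have h1 : h <= 1 by rewrite invf_le1// ler1n.
  move: hd; rewrite le_min => /andP[hd1 hd2].
  have CT := cs_C0 hT (ltW h0) Cu; have CS := cs_C0 hS (ltW h0) Cu.
  have kh0 (k : nat) : 0 <= k%:R * h by rewrite mulr_ge0// ltW.
  set K := (n.+1 ^ 2)%N.
  have bracket : (h + c^-1) * (e / 3 / (1 + c^-1)) <= e / 3.
    rewrite mulrCA ler_piMr ?(ltW e3)// ler_pdivrMr// mul1r lerD2r//.
  have -> : \sum_(k < K) S (k%:R * h) (fun y => T h u y - u y) x =
    (\sum_(k < K) S (k%:R * h) (fun y => (T h u y - S h u y) - h * g y) x) +
    h * (\sum_(k < K) S (k%:R * h) g x) + (S (K%:R * h) u x - u x).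
    have -> : S (K%:R * h) u x - u x = \sum_(k < K) (S (k.+1%:R * h) u x - S (k%:R * h) u x).
      rewrite -(big_mkord xpredT (fun k => S (k.+1%:R * h) u x - S (k%:R * h) u x)).
      by rewrite telescope_sumr// mul0r (cs_0 hS).
    rewrite mulr_sumr -!big_split/=; apply: eq_bigr => k _.
    have -> : k.+1%:R * h = k%:R * h + h by rewrite -natr1 mulrDl mul1r.
    rewrite (cs_add hS) ?(ltW h0)//.
    rewrite !(cs_sub hS)//; try exact: C0_scale; try exact: C0_sub.
    by rewrite (cs_scale hS)//; ring.
  have A1 : `|\sum_(k < K) S (k%:R * h) (fun y => (T h u y - S h u y) - h * g y) x| <= e / 3.
    apply: le_trans bracket.
    apply: (le_trans (ler_norm_sum _ _ _)).
    apply: (@le_trans _ _ (\sum_(k < K) expR (- c * (k%:R * h)) * (e / 3 / (1 + c^-1) * h))).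
      apply: ler_sum => k _; apply: S_decay => //.
        by apply: C0_sub; [exact: C0_sub|exact: C0_scale].
      by move=> y; apply: H1; rewrite h0.
    rewrite -mulr_suml [X in _ * X]mulrC mulrA ler_wpM2r ?(ltW e')// mulrC.
    exact: geometric_expR_le.
  have A2 : `|I n.+1%:R g x - h * \sum_(k < K) S (k%:R * h) g x| <= e / 3.
    apply: le_trans bracket; rewrite -[in I _](nh n) -/h -/K.
    apply: time_integral_riemann_decay => // s y /andP[s0 sh].
    by apply: H2; rewrite s0 (le_trans sh).
  have A3 : `|S (K%:R * h) u x| <= e / 3.
    apply: (le_trans (S_decay _ (kh0 K) Cu uB)).
    by rewrite nh; apply: HN1; exact: leqW.
  rewrite (_ : _ - _ = \sum_(k < K) S (k%:R * h) (fun y => (T h u y - S h u y) - h * g y) x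
   - (I n.+1%:R g x - h * \sum_(k < K) S (k%:R * h) g x) + S (K%:R * h) u x); last by ring.
  apply: (le_trans (ler_normD _ _)).
  have := ler_normB (\sum_(k < K) S (k%:R * h) (fun y => (T h u y - S h u y) - h * g y) x)
    (I n.+1%:R g x - h * \sum_(k < K) S (k%:R * h) g x).
  by lra.
(* A Cauchy bound uniform in x: with it the pointwise limit in the hypothesis becomes uniform, and
   [r] is the integral of [S s (f * u)] over all times. *)
have tail n m x : (n <= m)%N -> `|I m%:R g x - I n%:R g x| <= expR (- c * n%:R) * ((1 + c^-1) * Bg).
  move=> nm; rewrite -(subnKC nm) natrD (time_integralD hS)// addrAC subrr add0r.
  have := @time_integral_decay (m - n) (S n%:R g) (expR (- c * n%:R) * Bg) x (cs_C0 hS (ler0n _ _) Cg)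
   (fun y => S_decay y (ler0n _ _) Cg gB).
  by rewrite mulrCA.
have unif e : 0 < e -> exists N, forall n x, (N <= n)%N -> `|r x - I n.+1%:R g x| <= e.
  move=> e0; have e2 : 0 < e / 2 by rewrite divr_gt0.
  have [N1 H1] := key _ e2.
  have [N2 H2] := expR_decay ((1 + c^-1) * Bg) e2.
  exists (maxn N1 N2) => n x; rewrite geq_max => /andP[n1 n2].
  have cv := lim x.
  have cv' : `|\sum_(k < m.+1 ^ 2) S (k%:R * m.+1%:R^-1) (fun y => T m.+1%:R^-1 u y - u y) x
     - (I n.+1%:R g x - u x)| @[m --> \oo] --> `|r x - u x - (I n.+1%:R g x - u x)|.
    by apply: cvg_norm; apply: cvgB => //; exact: cvg_cst.
  rewrite (_ : r x - u x - (I n.+1%:R g x - u x) = r x - I n.+1%:R g x) in cv'; last by ring.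
  apply: (cvgr_to_le cv'); exists n => // m /= nm.
  have h1 := H1 m x (leq_trans n1 nm).
  have h2 := @tail n.+1 m.+1 x nm.
  have h3 := H2 n.+1 (leqW n2).
  rewrite (_ : _ - _ = (\sum_(k < m.+1 ^ 2) S (k%:R * m.+1%:R^-1) (fun y => T m.+1%:R^-1 u y - u y) x
     - (I m.+1%:R g x - u x)) + (I m.+1%:R g x - I n.+1%:R g x)); last by ring.
  apply: (le_trans (ler_normD _ _)); lra.
apply: (is_gen_closed hT) => e e0.
have C1 : 0 < `|C| + 1 by rewrite ltr_wpDl.
have e2 : 0 < e / 2 by rewrite divr_gt0.
have e' : 0 < Num.min e (e / 2 / (`|C| + 1)) by rewrite lt_min e0 divr_gt0.
have [N1 H1] := unif _ e'.
have [N2 H2] := expR_decay Bg e2.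
pose n := maxn N1 N2.
(* The boundary term [S n.+1 g] decays exponentially, which leaves [f r - f u] in the limit. *)
exists (I n.+1%:R g), (fun x => f x * I n.+1%:R g x + (S n.+1%:R g x - g x)).
have hr x : `|r x - I n.+1%:R g x| <= Num.min e (e / 2 / (`|C| + 1)).
  by apply: H1; rewrite leq_maxl.
split; first exact: time_integral_gen.
  by move=> x; apply: (le_trans (hr x)); rewrite ge_min lexx.
move=> x.
rewrite (_ : _ - _ = f x * (r x - I n.+1%:R g x) - S n.+1%:R g x); last by rewrite /g; ring.
apply: (le_trans (ler_normB _ _)); rewrite (splitr e); apply: lerD.
  rewrite normrM; apply: (@le_trans _ _ ((`|C| + 1) * (e / 2 / (`|C| + 1)))).
    apply: ler_pM => //.
      by apply: (le_trans (f_le x)); apply: (le_trans (ler_norm _)); rewrite lerDl.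
    by apply: (le_trans (hr x)); rewrite ge_min lexx orbT.
  by rewrite mulrC divfK// gt_eqF.
apply: (le_trans (S_decay x (ler0n _ _) Cg gB)).
by apply: H2; rewrite leqW// leq_maxr.
Qed.

End resolvent.

(** * Uniform convergence in epsilon-delta form, and elementary bounds *)

Section uniform_cvg.
Context {R : realType} {V : choiceType}.

Lemma uniform_cvgP {T : Type} (F : set_system T) (D : set V) (g : T -> V -> R)
    (f : V -> R) : Filter F ->
  {uniform D, g @ F --> f} <->
  (forall e, 0 < e -> \forall t \near F, forall x, D x -> `|g t x - f x| <= e).
Proof.
move=> FF; split=> [h e e0|h Q].
  have : nbhs (f : {uniform` D -> R}) [set k : {uniform` D -> R} |
      forall y, D y -> `|(k : V -> R) y - f y| <= e].
    apply/uniform_nbhs; exists [set xy | ball xy.1 e xy.2]; split.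
      exact: (entourage_ball _ (PosNum e0)).
    by move=> k /= hk y Dy; rewrite distrC ltW//; exact: hk.
  by move=> /h.
move=> /uniform_nbhs[E [entE hE]].
move: entE; rewrite -entourage_ballE => -[e /= e0 eE].
have e2 : 0 < e / 2 by rewrite divr_gt0.
apply: filterS (h _ e2) => t ht; apply: hE => /= y Dy; apply: eE => /=.
rewrite /ball/= distrC; apply: (le_lt_trans (ht y Dy)).
by rewrite ltr_pdivrMr// ltr_pMr// ltr1n.
Qed.

Lemma uniform_at_rightP (D : set V) (g : R -> V -> R) (f : V -> R) :
  {uniform D, g @ 0^'+ --> f} <->
  (forall e, 0 < e -> exists2 dl, 0 < dl &
    forall h x, 0 < h <= dl -> D x -> `|g h x - f x| <= e).
Proof.
rewrite uniform_cvgP; split=> h e e0.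
  have /nbhs_ballP[r /= r0 hr] := h e e0.
  exists (r / 2); first by rewrite divr_gt0.
  move=> s x /andP[s0 sr] Dx; apply: hr => //=.
  rewrite /ball/= sub0r normrN gtr0_norm//; apply: (le_lt_trans sr).
  by rewrite ltr_pdivrMr// ltr_pMr// ltr1n.
have [dl dl0 hd] := h e e0.
apply/nbhs_ballP; exists dl => //= s; rewrite /ball/= sub0r normrN => sdl s0 x Dx.
by apply: hd => //; rewrite s0/= ltW// (le_lt_trans _ sdl)// ler_norm.
Qed.

End uniform_cvg.

(** [(1 - i + i^2) (1 + i) = 1 + i^3 >= 1], and [expR i >= 1 + i]. *)
Lemma expRN_le_quadratic {R : realType} (i : R) : 0 <= i -> expR (- i) <= 1 - i + i ^+ 2.
Proof.
move=> i0; rewrite expRN -[leLHS]mul1r ler_pdivrMr ?expR_gt0//.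
apply: (@le_trans _ _ ((1 - i + i ^+ 2) * (1 + i))); first by nra.
by rewrite ler_wpM2l ?expR_ge1Dx//; nra.
Qed.

Lemma expRN_remainder {R : realType} (i k : R) : 0 <= i -> i ^+ 2 <= k ->
  `|1 - expR (- i) - i| <= k.
Proof.
move=> i0 ik; have := expRN_le_quadratic i0; have := expR_ge1Dx (- i).
by rewrite ler_norml; move: ik; lra.
Qed.

Lemma generatorP {R : realType} {V : topologicalType} (S : R -> (V -> R) -> V -> R) u v :
  generator setT S u v <-> is_gen S u v.
Proof.
split=> -[Cu Cv h]; split => //.
  move=> e /((uniform_at_rightP _ _ _).1 h)[dl dl0 hd]; exists dl => // s x sd.
  have s0 : 0 < s by case/andP: sd.
  have := hd s x sd I.
  rewrite (_ : _ - v x = (S s u x - u x - s * v x) / s); last by field; rewrite gt_eqF.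
  by rewrite normrM normfV (gtr0_norm s0) ler_pdivrMr.
apply/uniform_at_rightP => e /h[dl dl0 hd]; exists dl => // s x sd _.
have s0 : 0 < s by case/andP: sd.
rewrite (_ : _ - v x = (S s u x - u x - s * v x) / s); last by field; rewrite gt_eqF.
by rewrite normrM normfV (gtr0_norm s0) ler_pdivrMr// hd.
Qed.

Lemma continuous_measurable_rV {R : realType} {d : nat} (u : 'rV[R]_d -> R) :
  continuous u -> measurable_fun setT u.
Proof.
move=> cu; apply: (measurability _ (RGenOpens.measurableE R)) => _ [_ [a [b ->]] <-].
rewrite setTI; apply: sub_sigma_algebra.
by move/continuousP : cu; apply; exact: interval_open.
Qed.

(** * The damped semigroup of a Markov additive process and its first-order expansion *)

(** A Feynman-Kac type semigroup: conditioning on the path of M turns the damping into the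
    exponential of minus the integral of [f l] along the path. *)
Definition damped_semigroup {R : realType} {d : nat} {dO : measure_display}
  {Omega : measurableType dO} (M : R -> Omega -> 'rV[R]_d)
  (P : 'rV[R]_d -> probability Omega R) (sigma : R -> Omega -> R) (l : R)
  (t : R) (u : 'rV[R]_d -> R) (x : 'rV[R]_d) : R :=
  \int[P x]_w (u (M t w) * expR (- l * sigma t w)).

Section markov_additive.
Context {R : realType} {d : nat} {dO : measure_display} {Omega : measurableType dO}
  {F : R -> set (set Omega)} {M : R -> Omega -> 'rV[R]_d}
  {theta : R -> Omega -> Omega} {P : 'rV[R]_d -> probability Omega R}
  {sigma : R -> Omega -> R} {nu : 'rV[R]_d -> {measure set R -> \bar R}}.
Hypothesis hM : hunt_process F M theta P.
Hypothesis hsigma : markov_additive_process F M theta P sigma.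
Hypothesis hnu : conditional_levy_structure M P sigma nu.
Hypothesis hT : feller_semigroup setT (semigroup M P).
Hypothesis hP : feller_semigroup (half_space (V := 'rV[R]_d)) (joint_semigroup M P sigma).
Notation mu := (@lebesgue_measure R).
Notation E := 'rV[R]_d.
Notation T := (semigroup M P).
Notation Tl := (damped_semigroup M P sigma).

Lemma measurable_process t : 0 <= t -> measurable_fun setT (M t).
Proof.
move=> t0 _ B mB; rewrite setTI.
have [_ hF _] := hunt_filtration hM.
by apply: (hF t t0); exact: (hunt_adapted hM).
Qed.

Lemma measurable_additive t : 0 <= t -> measurable_fun setT (sigma t).
Proof.
move=> t0 _ B mB; rewrite setTI.
have [_ hF _] := hunt_filtration hM.
by apply: (hF t t0); exact: (map_adapted hsigma).
Qed.

Lemma additive_mono s t w : 0 <= s -> s <= t -> sigma s w <= sigma t w.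
Proof.
move=> s0; rewrite le_eqVlt => /predU1P[->//|st].
by rewrite ltW// (map_increasing hsigma).
Qed.

Lemma additive_ge0 t w : 0 <= t -> 0 <= sigma t w.
Proof. by move=> t0; rewrite -(map_0 hsigma w); exact: additive_mono. Qed.

Lemma measurable_comp_process t (u : E -> R) : 0 <= t -> continuous u ->
  measurable_fun setT (fun w => u (M t w)).
Proof.
move=> t0 cu; apply: (@measurableT_comp _ _ _ _ _ _ u); last exact: measurable_process.
exact: continuous_measurable_rV.
Qed.

Lemma damping_le1 l t w : 0 <= l -> 0 <= t -> 0 <= expR (- l * sigma t w) <= 1.
Proof.
move=> l0 t0; rewrite expR_ge0/= -expR0 ler_expR mulNr oppr_le0.
by rewrite mulr_ge0// additive_ge0.
Qed.

Lemma measurable_damping l t : 0 <= t ->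
  measurable_fun setT (fun w => expR (- l * sigma t w)).
Proof.
move=> t0; apply: measurableT_comp => //; apply: measurable_funM => //.
exact: measurable_additive.
Qed.

Lemma process_integrable x t (u : E -> R) B : 0 <= t -> continuous u ->
  (forall y, `|u y| <= B) -> (P x).-integrable setT (EFin \o (fun w => u (M t w))).
Proof.
move=> t0 cu uB; apply: (@prob_integrable _ _ _ _ _ B) => //.
exact: measurable_comp_process.
Qed.

Lemma semigroup_contraction : contraction_semigroup T.
Proof.
split.
- by move=> t u; exact: (feller_C0 hT).
- move=> t a u v x t0 Cu Cv.
  have [B _ uB] := C0_bounded Cu; have [B' _ vB] := C0_bounded Cv.
  have Iu := process_integrable x t0 (C0_continuous Cu) uB.
  have Iv := process_integrable x t0 (C0_continuous Cv) vB.
  rewrite /T RintegralD//; last by have := integrableZl measurableT a Iu.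
  by rewrite RintegralZl.
- move=> t u B x t0 Cu uB; apply: prob_norm_le => //.
  by apply: measurable_comp_process => //; exact: C0_continuous.
- by move=> u x Cu; rewrite (feller_id hT).
- by move=> s t u x s0 t0 Cu; rewrite (feller_add hT).
- move=> u Cu e e0.
  have [dl dl0 hd] := (uniform_at_rightP _ _ _).1 (feller_strong_continuity hT Cu) e e0.
  exists dl => // h x /andP[]; rewrite le_eqVlt => /predU1P[<- _|h0 hdl].
    by rewrite (feller_id hT)// subrr normr0 ltW.
  by apply: hd => //; rewrite h0.
Qed.

Lemma initial_value (u : E -> R) x : continuous u -> \int[P x]_w u (M 0 w) = u x.
Proof.
move=> cu.
have m0 := measurable_process (lexx 0).
have mx : measurable (M 0 @^-1` [set x]).
  rewrite -[X in measurable X]setTI; apply: m0 => //.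
  rewrite -(setCK [set x]); apply: measurableC; apply: sub_sigma_algebra.
  by rewrite openC; exact: accessible_closed_set1 (hausdorff_accessible (@norm_hausdorff _ _)) x.
rewrite /Rintegral; have -> : (\int[P x]_w (u (M 0 w))%:E = \int[P x]_w (u x)%:E)%E.
  apply: ae_eq_integral => //.
    by apply/measurable_EFinP; exact: measurable_comp_process.
  exists (~` (M 0 @^-1` [set x])); split; first exact: measurableC.
    by apply: etrans (probability_setC (P x) mx) _; rewrite (hunt_normal hM) subee.
  by move=> w /= hw eq; apply: hw => _; rewrite eq.
by rewrite integral_cst//= probability_setT mule1.
Qed.

Section damped.
Variable l : R.
Hypothesis l_gt0 : 0 < l.

(** The joint semigroup preserves functions of this product form, because sigma enters additively.
    The Feller properties of the damped semigroup are read off on the slice [p.2 = 0]. *)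
Let lift_fun (u : E -> R) (p : E * R) : R := u p.1 * expR (- l * p.2).

Let joint_lift t u (p : E * R) : 0 <= t -> C0 setT u ->
  joint_semigroup M P sigma t (lift_fun u) p = lift_fun (Tl l t u) p.
Proof.
move=> t0 Cu; have [B _ uB] := C0_bounded Cu.
rewrite /joint_semigroup /lift_fun /damped_semigroup mulrC -RintegralZl//.
  apply: eq_Rintegral => w _; rewrite mulrCA -expRD/=; congr (_ * expR _); ring.
apply: (@prob_integrable _ _ _ _ _ B).
  apply: measurable_funM; last exact: measurable_damping.
  by apply: measurable_comp_process => //; exact: C0_continuous.
move=> w; have /andP[e0 e1] := damping_le1 w (ltW l_gt0) t0.
by rewrite normrM (ger0_norm e0) (le_trans _ (uB (M t w)))// ler_piMr.
Qed.

Let lift_C0 u : C0 setT u -> C0 (half_space (V := E)) (lift_fun u).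
Proof.
move=> Cu; have [B B0 uB] := C0_bounded Cu; split.
  apply: continuous_subspaceT => p.
  apply: cvgM.
    by apply: (@cvg_comp _ _ _ fst u); [exact: cvg_fst|exact: (C0_continuous Cu)].
  apply: (@cvg_comp _ _ _ snd (fun z => expR (- l * z))); first exact: cvg_snd.
  by apply: continuous_comp; [exact: mulrl_continuous|exact: continuous_expR].
move=> e e0; have [K cK hK] := C0_outside Cu e0.
(* Above this height [e (1 + l z)] exceeds [B], hence so does [e expR (l z)]. *)
pose N := (B + e) / (l * e).
exists (K `*` `[0, N]%classic); split.
- by apply: compact_setX => //; exact: segment_compact.
- by move=> [y z] [_ /=]; rewrite in_itv/= => /andP[].
- move=> [y z] /= z0 nK; rewrite /half_space/= in z0.
  have e1 : expR (- l * z) <= 1 by rewrite -expR0 ler_expR mulNr oppr_le0 mulr_ge0// ltW.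
  rewrite /lift_fun/= normrM (ger0_norm (expR_ge0 _)).
  have [Ky|nKy] := pselect (K y); last first.
    by apply: le_lt_trans (hK y nKy); rewrite ler_piMr.
  have Nz : N < z.
    rewrite ltNge; apply/negP => zN; apply: nK; split => //=.
    by rewrite in_itv/= z0.
  rewrite mulNr expRN ltr_pdivrMr ?expR_gt0//.
  have h1 := expR_ge1Dx (l * z).
  rewrite ltr_pdivrMr ?mulr_gt0// in Nz.
  apply: (le_lt_trans (uB y)); apply: (@lt_le_trans _ _ (e * (1 + l * z))); last first.
    by rewrite ler_wpM2l// ltW.
  by move: Nz; have -> : z * (l * e) = e * (l * z) by [ring]; lra.
Qed.

Lemma damped_C0 t u : 0 <= t -> C0 setT u -> C0 setT (Tl l t u).
Proof.
move=> t0 Cu; have [cw hw] := feller_C0 hP t0 (lift_C0 Cu).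
have E0 x : Tl l t u x = joint_semigroup M P sigma t (lift_fun u) (x, 0).
  by rewrite joint_lift// /lift_fun/= mulr0 expR0 mulr1.
apply: C0_intro.
  move=> x; rewrite /continuous_at E0.
  rewrite (_ : Tl l t u = joint_semigroup M P sigma t (lift_fun u) \o (fun y => (y, 0))); last first.
    by apply/funext => y; rewrite E0.
  have D0 (y : E) : half_space (y, 0 : R) by rewrite /half_space/=.
  apply: (cvg_comp _ _ _ ((subspace_continuousP _ _).1 cw (x, 0) (D0 x))).
  move=> B [[B1 B2] /= [h1 h2] hB]; apply: filterS h1 => y hy /=; apply: hB => //.
  by split => //=; exact: nbhs_singleton.
move=> e /hw[K [cK _ hK]]; exists (fst @` K).
  by apply: continuous_compact => //; apply: continuous_subspaceT => p; exact: cvg_fst.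
move=> x nK; rewrite E0; apply: hK; first by rewrite /half_space/= lexx.
by move=> Kx; apply: nK; exists (x, 0).
Qed.

Lemma damped_contraction : contraction_semigroup (Tl l).
Proof.
have meas t u : 0 <= t -> C0 setT u -> measurable_fun setT (fun w => u (M t w) * expR (- l * sigma t w)).
  move=> t0 Cu; apply: measurable_funM; last exact: measurable_damping.
  by apply: measurable_comp_process => //; exact: C0_continuous.
have bnd t u B w : 0 <= t -> (forall y, `|u y| <= B) -> `|u (M t w) * expR (- l * sigma t w)| <= B.
  move=> t0 uB; have /andP[e0 e1] := damping_le1 w (ltW l_gt0) t0.
  by rewrite normrM (ger0_norm e0) (le_trans _ (uB (M t w)))// ler_piMr.
have E0 t u x : 0 <= t -> C0 setT u -> Tl l t u x = joint_semigroup M P sigma t (lift_fun u) (x, 0).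
  by move=> t0 Cu; rewrite joint_lift// /lift_fun/= mulr0 expR0 mulr1.
have D0 (x : E) : half_space (x, 0 : R) by rewrite /half_space/=.
split.
- by move=> t u; exact: damped_C0.
- move=> t a u v x t0 Cu Cv.
  have [B _ uB] := C0_bounded Cu; have [B' _ vB] := C0_bounded Cv.
  have Iu := prob_integrable (P x) (meas t u t0 Cu) (fun w => bnd t u B w t0 uB).
  have Iv := prob_integrable (P x) (meas t v t0 Cv) (fun w => bnd t v B' w t0 vB).
  rewrite /damped_semigroup -RintegralZl// -RintegralD//; last first.
    by have := integrableZl measurableT a Iu.
  by apply: eq_Rintegral => w _; ring.
- by move=> t u B x t0 Cu uB; apply: prob_norm_le => [|w]; [exact: meas|exact: bnd].
- move=> u x Cu; rewrite E0// (feller_id hP)//; last exact: lift_C0.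
  by rewrite /lift_fun/= mulr0 expR0 mulr1.
- move=> s t u x s0 t0 Cu; rewrite E0 ?addr_ge0//.
  rewrite (feller_add hP)//; last exact: lift_C0.
  rewrite E0//; last exact: damped_C0.
  congr (joint_semigroup _ _ _ _ _ _); apply/funext => p; exact: joint_lift.
- move=> u Cu e e0.
  have [dl dl0 hd] := (uniform_at_rightP _ _ _).1 (feller_strong_continuity hP (lift_C0 Cu)) e e0.
  have L0 x : lift_fun u (x, 0) = u x by rewrite /lift_fun/= mulr0 expR0 mulr1.
  exists dl => // h x /andP[]; rewrite le_eqVlt => /predU1P[<- _|h0 hdl].
    by rewrite E0// (feller_id hP)//; [rewrite L0 subrr normr0 ltW|exact: lift_C0].
  by rewrite E0 ?(ltW h0)// -[u x]L0; apply: hd => //; rewrite h0.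
Qed.

Variables (f : E -> R) (c C : R).
Hypothesis fE : forall x, f x = laplace_exponent (nu x) l.
Hypothesis f_continuous : continuous f.
Hypothesis c_gt0 : 0 < c.
Hypothesis f_bounds : forall x, c <= f x <= C.

Lemma measurable_rate : measurable_fun setT (fun p : R * Omega => f (M (Num.max p.1 0) p.2)).
Proof.
apply: (@right_continuous_measurable R _ _ (fun s w => f (M s w))).
  by move=> s s0; exact: measurable_comp_process.
move=> w s s0; apply: (@cvg_comp _ _ _ (M ^~ w) f _ (nbhs (M s w))); last exact: f_continuous.
exact: (hunt_right_continuous hM).
Qed.

Let rate t w := \int[mu]_(s in `[0, t]) f (M s w).

Lemma integrable_rate t w : mu.-integrable `[0, t] (EFin \o (fun s => f (M s w))).
Proof.
have I1 : mu.-integrable `[0, t] (EFin \o (fun s : R => f (M (Num.max s 0) w))).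
  apply: (@bounded_integrable _ _ _ _ _ _ C) => //.
  - exact: lebesgue_measure_cc_lty.
  - apply: measurable_funTS.
    exact: (measurable_fun_pair1 _ measurable_rate).
  - move=> s _; have /andP[h1 h2] := f_bounds (M (Num.max s 0) w).
    by rewrite ger0_norm// (le_trans _ h1)// ltW.
apply: eq_integrable I1 => // s; rewrite inE/= in_itv/= => /andP[s0 _].
by rewrite max_l.
Qed.

Lemma rate_bounds t w : 0 <= t -> c * t <= rate t w <= C * t.
Proof.
move=> t0; have It := integrable_rate t w.
have Ic (k : R) : mu.-integrable `[0, t] (EFin \o cst k).
  apply: (@bounded_integrable _ _ _ _ _ _ `|k|) => //.
  exact: lebesgue_measure_cc_lty.
have Ec (k : R) : k * t = \int[mu]_(s in `[0, t]) k by rewrite Rintegral_cst_itv// subr0.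
rewrite !Ec /rate; apply/andP; split; apply: le_Rintegral => //; try exact: Ic.
  by move=> s _; case/andP: (f_bounds (M s w)).
by move=> s _; case/andP: (f_bounds (M s w)).
Qed.

(** Tonelli for [f'], the rate along the path set to 0 outside [[0, t]], which is jointly measurable
    by right-continuity of paths. *)
Lemma rate_fubini t x : 0 <= t ->
  [/\ mu.-integrable `[0, t] (EFin \o (fun s => \int[P x]_w f (M s w))),
      measurable_fun setT (rate t) &
      \int[P x]_w rate t w = \int[mu]_(s in `[0, t]) \int[P x]_w f (M s w)].
Proof.
move=> t0.
have f0 y : 0 <= f y by case/andP: (f_bounds y) => h _; rewrite (le_trans _ h)// ltW.
pose f' (p : measurableTypeR R * Omega) : \bar R :=
  if (0 <= p.1) && (p.1 <= t) then (f (M (Num.max p.1 0) p.2))%:E else 0%E.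
have f'0 p : (0 <= f' p)%E by rewrite /f'; case: ifP => // _; rewrite lee_fin.
have mf' : measurable_fun setT f'.
  apply: measurable_fun_ifT.
  - apply: measurable_and; apply: measurable_fun_ler; try exact: measurable_cst;
    exact: measurable_fst.
  - by apply/measurable_EFinP; exact: measurable_rate.
  - exact: measurable_cst.
have Gw w : (\int[mu]_s f' (s, w) = (rate t w)%:E)%E.
  rewrite /rate /Rintegral fineK; last by apply: integrable_fin_num => //; exact: integrable_rate.
  rewrite [RHS]integral_mkcond; apply: eq_integral => s _.
  rewrite patchE mem_setE in_itv/= /f'/=; case: ifP => // /andP[s0 _].
  by rewrite max_l.
have fm s : 0 <= s -> measurable_fun setT (fun w => f (M s w)).
  by move=> s0; exact: measurable_comp_process.
have fC s w : `|f (M s w)| <= C.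
  by have /andP[_ h] := f_bounds (M s w); rewrite ger0_norm.
have Ifs s : 0 <= s -> (P x).-integrable setT (EFin \o (fun w => f (M s w))).
  by move=> s0; apply: (@prob_integrable _ _ _ _ _ C) => //; exact: fm.
have Fs s : 0 <= s <= t -> (\int[P x]_w f' (s, w) = (\int[P x]_w f (M s w))%:E)%E.
  move=> st; rewrite /Rintegral fineK; last first.
    by apply: integrable_fin_num => //; apply: Ifs; case/andP: st.
  by apply: eq_integral => w _; rewrite /f'/= st max_l//; case/andP: st.
have mF := @measurable_fun_fubini_tonelli_F _ _ _ _ R (P x) f' mf' f'0.
have mG := @measurable_fun_fubini_tonelli_G _ _ _ _ R mu f' mf' f'0.
split.
- apply: (@bounded_integrable _ _ _ _ _ _ C) => //.
  + exact: lebesgue_measure_cc_lty.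
  + apply/measurable_EFinP; apply: eq_measurable_fun (measurable_funTS mF) => s.
    by rewrite inE/= in_itv/= => st; rewrite /fubini_F Fs.
  + move=> s /=; rewrite in_itv/= => /andP[s0 _]; apply: prob_norm_le => //.
    exact: fm.
- apply/measurable_EFinP; apply: eq_measurable_fun mG => w _.
  by rewrite /fubini_G Gw.
- rewrite [LHS]/Rintegral [RHS]/Rintegral; congr fine.
  transitivity (\int[P x]_w \int[mu]_s f' (s, w))%E.
    by apply: eq_integral => w _; rewrite Gw.
  rewrite -(@fubini_tonelli _ _ _ _ R mu (P x) f' mf' f'0).
  rewrite [RHS]integral_mkcond; apply: eq_integral => s _.
  rewrite patchE mem_setE in_itv/=; case: ifPn => st; first by rewrite Fs.
  by rewrite (eq_integral (cst 0%E)) ?integral0// => w _; rewrite /f'/= (negbTE st).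
Qed.

Lemma path_sub t : path_sigma_algebra M `[0, t] `<=` @measurable _ Omega.
Proof.
apply: smallest_sub; first exact: sigma_algebra_measurable.
move=> A [s /= + [B mB <-]]; rewrite in_itv/= => /andP[s0 _].
by rewrite -[X in measurable X]setTI; exact: measurable_process.
Qed.

(** The conditional Laplace transform, integrated over an event of the path. The freedom in [A]
    matters: [1 - expR (- l sigma_t)] depends on M_t, and its mass on a rare path event has to be
    small compared with t. *)
Lemma damping_cond x t A : 0 <= t -> path_sigma_algebra M `[0, t] A ->
  \int[P x]_(w in A) (1 - expR (- l * sigma t w)) =
  \int[P x]_(w in A) (1 - expR (- rate t w)).
Proof.
move=> t0 hA; have mA := path_sub hA.
have [_ IY H] := cls_laplace hnu x t0 (ltW l_gt0).
have IX : (P x).-integrable setT (EFin \o (fun w => expR (- l * sigma t w))).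
  apply: (@prob_integrable _ _ _ _ _ 1); first exact: measurable_damping.
  by move=> w; have /andP[h0 h1] := damping_le1 w (ltW l_gt0) t0; rewrite ger0_norm.
have I1 : (P x).-integrable setT (EFin \o cst (1 : R)).
  by apply: (@prob_integrable _ _ _ _ _ 1) => // w; rewrite normr1.
have IY' : (P x).-integrable setT (EFin \o (fun w => expR (- rate t w))).
  apply: eq_integrable IY => // w _ /=; congr (expR (- _))%:E.
  by apply: eq_Rintegral => s _; rewrite fE.
have S g : (P x).-integrable setT (EFin \o g) -> (P x).-integrable A (EFin \o g).
  by move=> Ig; apply: integrableS Ig.
rewrite (RintegralB mA (S _ I1) (S _ IX)) (RintegralB mA (S _ I1) (S _ IY')).
congr (_ - _); rewrite /Rintegral; congr fine; rewrite -(H A hA).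
apply: eq_integral => w _ /=; congr (expR (- _))%:E.
by apply: eq_Rintegral => s _; rewrite fE.
Qed.

Lemma measurable_expR_rate t (x : E) : 0 <= t ->
  measurable_fun setT (fun w => expR (- rate t w)).
Proof.
move=> t0; have [_ mr _] := rate_fubini x t0.
by apply: measurableT_comp => //; exact: measurableT_comp.
Qed.

Lemma damping_integrable t x : 0 <= t ->
  (P x).-integrable setT (EFin \o (fun w => expR (- l * sigma t w))).
Proof.
move=> t0; apply: (@prob_integrable _ _ _ _ _ 1); first exact: measurable_damping.
by move=> w; have /andP[h0 h1] := damping_le1 w (ltW l_gt0) t0; rewrite ger0_norm.
Qed.

Lemma expR_rate_integrable t x : 0 <= t ->
  (P x).-integrable setT (EFin \o (fun w => expR (- rate t w))).
Proof.
move=> t0; apply: (@prob_integrable _ _ _ _ _ 1); first exact: (measurable_expR_rate x).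
move=> w; rewrite ger0_norm ?expR_ge0// -expR0 ler_expR oppr_le0.
by have /andP[h _] := rate_bounds w t0; rewrite (le_trans _ h)// mulr_ge0// ltW.
Qed.

Lemma path_setT t : path_sigma_algebra M `[0, t] setT.
Proof. by rewrite -setC0; apply: sigma_algebraC; exact: sigma_algebra0. Qed.

Lemma damping_mean_eq t x : 0 <= t ->
  \int[P x]_w expR (- l * sigma t w) = \int[P x]_w expR (- rate t w).
Proof.
move=> t0; have := damping_cond x t0 (@path_setT t).
have I1 : (P x).-integrable setT (EFin \o cst (1 : R)).
  by apply: (@prob_integrable _ _ _ _ _ 1) => // w; rewrite normr1.
have IX := damping_integrable x t0; have IY := expR_rate_integrable x t0.
rewrite (RintegralB measurableT I1 IX) (RintegralB measurableT I1 IY).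
by move/addrI/oppr_inj.
Qed.

Lemma damping_mean_le t x : 0 <= t ->
  \int[P x]_w expR (- l * sigma t w) <= expR (- c * t).
Proof.
move=> t0; rewrite damping_mean_eq// -[leRHS](prob_cst (P x)).
apply: le_Rintegral => //; first exact: expR_rate_integrable.
  apply: (@prob_integrable _ _ _ _ _ (expR (- c * t))) => // w.
  by rewrite ger0_norm ?expR_ge0.
move=> w _; rewrite ler_expR mulNr lerN2.
by case/andP: (rate_bounds w t0).
Qed.

Lemma damped_decay t u B x : 0 <= t -> C0 setT u -> (forall y, `|u y| <= B) ->
  `|Tl l t u x| <= expR (- c * t) * B.
Proof.
move=> t0 Cu uB.
have mX := @measurable_damping l t t0.
have mu_ : measurable_fun setT (fun w => u (M t w)).
  by apply: measurable_comp_process => //; exact: C0_continuous.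
have IX := damping_integrable x t0.
have I2 : (P x).-integrable setT (EFin \o (fun w => u (M t w) * expR (- l * sigma t w))).
  apply: (@prob_integrable _ _ _ _ _ B); first exact: measurable_funM.
  move=> w; have /andP[h0 h1] := damping_le1 w (ltW l_gt0) t0.
  by rewrite normrM (ger0_norm h0) (le_trans _ (uB (M t w)))// ler_piMr.
apply: (le_trans (le_normr_Rintegral measurableT I2)).
rewrite mulrC; have B0 : 0 <= B by exact: le_trans (uB x).
apply: (@le_trans _ _ (B * \int[P x]_w expR (- l * sigma t w))).
  rewrite -RintegralZl//; apply: le_Rintegral => //.
  - exact: integrable_norm.
  - by have := integrableZl measurableT B IX.
  - by move=> w _; rewrite normrM [X in _ * X]ger0_norm ?expR_ge0// ler_wpM2r ?expR_ge0.
by rewrite ler_wpM2l// damping_mean_le.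
Qed.

(** [|a| <= k + a^2 / k] reduces the claim to the second moment of [u (M h w) - u x], which is
    [(T h u^2 - u^2) - 2 u (T h u - u)] at x and is small uniformly in x by strong continuity at u
    and at u^2. *)
Lemma mean_dist u eta : C0 setT u -> 0 < eta -> exists2 dl, 0 < dl &
  forall h x, 0 <= h <= dl -> \int[P x]_w `|u (M h w) - u x| <= eta.
Proof.
move=> Cu eta0; have [B B0 uB] := C0_bounded Cu.
have cu := C0_continuous Cu.
have Cu2 : C0 setT (fun y => u y * u y) by exact: C0_mul Cu.
pose k := eta / 2.
have k0 : 0 < k by rewrite divr_gt0.
(* The second moment is at most [(1 + 2 B) e1 = k^2], so the bound is [k + k = eta]. *)
pose e1 := k ^+ 2 / (1 + 2 * B).
have B1 : 0 < 1 + 2 * B by rewrite ltr_wpDr// mulr_ge0.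
have e10 : 0 < e1 by rewrite divr_gt0// exprn_gt0.
have [d1 d10 H1] := cs_cont semigroup_contraction Cu e10.
have [d2 d20 H2] := cs_cont semigroup_contraction Cu2 e10.
exists (Num.min d1 d2); first by rewrite lt_min d10.
move=> h x /andP[h0]; rewrite le_min => /andP[hd1 hd2].
have hh1 := H1 h x; rewrite h0 hd1 in hh1; have {}hh1 := hh1 isT.
have hh2 := H2 h x; rewrite h0 hd2 in hh2; have {}hh2 := hh2 isT.
have mu_ : measurable_fun setT (fun w => u (M h w)) by exact: measurable_comp_process.
have Iu := process_integrable x h0 cu uB.
have uB2 y : `|u y * u y| <= B * B by rewrite normrM ler_pM.
have Iu2 := process_integrable x h0 (C0_continuous Cu2) uB2.
have Ia : (P x).-integrable setT (EFin \o (fun w => `|u (M h w) - u x|)).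
  apply: (@prob_integrable _ _ _ _ _ (B + B)).
    by apply: measurableT_comp => //; exact: measurable_funB.
  by move=> w; rewrite normr_id (le_trans (ler_normB _ _))// lerD.
have Ic (a : R) : (P x).-integrable setT (EFin \o cst a).
  by apply: (@prob_integrable _ _ _ _ _ `|a|).
have I1 : (P x).-integrable setT (EFin \o (fun w => (- 2 * u x) * u (M h w))).
  by have := integrableZl measurableT (- 2 * u x) Iu.
have I2 : (P x).-integrable setT (EFin \o (fun w => u (M h w) * u (M h w) + (- 2 * u x) * u (M h w))).
  by have := integrableD measurableT Iu2 I1.
have I3 : (P x).-integrable setT (EFin \o (fun w => u (M h w) * u (M h w) + (- 2 * u x) * u (M h w) + u x * u x)).
  by have := integrableD measurableT I2 (Ic (u x * u x)).
have I4 : (P x).-integrable setT (EFin \o (fun w => k^-1 * (u (M h w) * u (M h w) + (- 2 * u x) * u (M h w) + u x * u x))).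
  by have := integrableZl measurableT k^-1 I3.
have I5 : (P x).-integrable setT (EFin \o (fun w => k + k^-1 * (u (M h w) * u (M h w) + (- 2 * u x) * u (M h w) + u x * u x))).
  by have := integrableD measurableT (Ic k) I4.
apply: (@le_trans _ _ (\int[P x]_w (k + k^-1 * (u (M h w) * u (M h w) + (- 2 * u x) * u (M h w) + u x * u x)))).
  apply: le_Rintegral => // w _.
  rewrite (_ : _ + u x * u x = `|u (M h w) - u x| ^+ 2); last first.
    by rewrite real_normK ?num_real//; ring.
  set a := `| _ |; have a0 : 0 <= a by exact: normr_ge0.
  rewrite -(ler_pM2l k0) mulrDr mulVKf ?gt_eqF//.
  by nra.
rewrite (RintegralD measurableT (Ic k) I4) /cst prob_cst (RintegralZl k^-1 measurableT I3).
rewrite (RintegralD measurableT I2 (Ic (u x * u x))) /cst prob_cst.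
rewrite (RintegralD measurableT Iu2 I1) (RintegralZl (- 2 * u x) measurableT Iu).
have -> : eta = k + k^-1 * k ^+ 2 by rewrite /k; field; rewrite gt_eqF.
rewrite lerD2l ler_wpM2l ?invr_ge0 ?(ltW k0)//.
have -> : k ^+ 2 = e1 + 2 * B * e1 by rewrite /e1; field; rewrite gt_eqF.
have /(_ (fun y => u y * u y)) E2 : forall v, \int[P x]_w v (M h w) = T h v x by [].
rewrite E2 (_ : _ + u x * u x = (T h (fun y => u y * u y) x - u x * u x) - 2 * (u x * (T h u x - u x))); last by rewrite /semigroup; ring.
have h3 : `|u x * (T h u x - u x)| <= B * e1 by rewrite normrM ler_pM.
have := ler_norm (T h (fun y => u y * u y) x - u x * u x).
have := ler_norm (- (u x * (T h u x - u x))); rewrite normrN.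
by lra.
Qed.

(** With [X = expR (- l sigma_h)] the difference is the mean of [u (M_h) (1 - X)]. As [1 - X] has
    mean of order h, replacing [u (M_h)] by [u x] must be shown to cost o(h), although X and M_h are
    dependent. What remains, [u x] times the mean of [1 - X], is expanded to first order in the
    integrated rate. *)
Lemma damped_diff u : C0 setT u -> forall e, 0 < e -> exists2 dl, 0 < dl &
  forall h x, 0 < h <= dl -> `|T h u x - Tl l h u x - h * (f x * u x)| <= e * h.
Proof.
move=> Cu e e0; have [B B0 uB] := C0_bounded Cu; have cu := C0_continuous Cu.
have C0_ : 0 <= C.
  by case/andP: (f_bounds 0) => h1 h2; rewrite (le_trans _ h2)// (le_trans _ h1)// ltW.
have f0 y : 0 <= f y by case/andP: (f_bounds y) => h _; rewrite (le_trans _ h)// ltW.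
have fC y : `|f y| <= C by rewrite ger0_norm//; case/andP: (f_bounds y).
have Cfu : C0 setT (fun y => f y * u y) by exact: C0_mul Cu.
have frac (a k : R) : 0 <= a -> 0 <= k -> a * (k / (a + 1)) <= k.
  move=> a0 k0; have a1 : 0 < a + 1 by rewrite ltr_wpDl.
  by rewrite mulrCA ler_piMr// ler_pdivrMr// mul1r lerDl.
have e5 : 0 < e / 5 by rewrite divr_gt0.
have pos1 (a : R) : 0 <= a -> 0 < a + 1 by move=> a0; rewrite ltr_wpDl.
pose ep := e / 5 / (C + 1).
have ep0 : 0 < ep by rewrite divr_gt0// pos1.
have BC0 : 0 <= 2 * B * C by rewrite !mulr_ge0.
have BCC0 : 0 <= B * C ^+ 2 by rewrite mulr_ge0// exprn_ge0.
(* The first entry makes [eta / ep], the Markov bound on the probability of the event [A] below,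
   small; the second gives [C * eta <= e / 5]. *)
pose eta := Num.min (ep * (e / 5 / (2 * B * C + 1))) ep.
have eta0 : 0 < eta by rewrite lt_min ep0 mulr_gt0// divr_gt0// pos1.
have [d1 d10 H1] := mean_dist Cu eta0.
have [d2 d20 H2] := cs_cont semigroup_contraction Cfu e5.
exists (Num.min d1 (Num.min d2 (e / 5 / (B * C ^+ 2 + 1)))).
  by rewrite !lt_min d10 d20 divr_gt0// pos1.
move=> h x /andP[hpos]; rewrite !le_min => /andP[hd1 /andP[hd2 hd3]].
have h0 := ltW hpos.
have Md s : 0 <= s <= h -> \int[P x]_w `|u (M s w) - u x| <= eta.
  by move=> /andP[s0 sh]; apply: H1; rewrite s0 (le_trans sh).
pose X w := expR (- l * sigma h w).
have X01 w : 0 <= X w <= 1 := damping_le1 w (ltW l_gt0) h0.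
have mX : measurable_fun setT X by exact: measurable_damping.
have mU : measurable_fun setT (fun w => u (M h w)) by exact: measurable_comp_process.
have IX : (P x).-integrable setT (EFin \o X) := damping_integrable x h0.
have I1X : (P x).-integrable setT (EFin \o (fun w => 1 - X w)).
  apply: (@prob_integrable _ _ _ _ _ 1); first exact: measurable_funB.
  by move=> w; have /andP[? ?] := X01 w; rewrite ger0_norm; lra.
have IU := process_integrable x h0 cu uB.
have IUX : (P x).-integrable setT (EFin \o (fun w => u (M h w) * X w)).
  apply: (@prob_integrable _ _ _ _ _ B); first exact: measurable_funM.
  move=> w; have /andP[k0 k1] := X01 w.
  by rewrite normrM (ger0_norm k0) (le_trans _ (uB (M h w)))// ler_piMr.
have mD : measurable_fun setT (fun w => u (M h w) - u x) by exact: measurable_funB.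
have D2B w : `|u (M h w) - u x| <= 2 * B.
  by apply: (le_trans (ler_normB _ _)); have := uB (M h w); have := uB x; lra.
have ID : (P x).-integrable setT (EFin \o (fun w => (u (M h w) - u x) * (1 - X w))).
  apply: (@prob_integrable _ _ _ _ _ (2 * B)); first by apply: measurable_funM => //; exact: measurable_funB.
  move=> w; have /andP[k0 k1] := X01 w.
  by rewrite normrM (le_trans _ (D2B w))// ler_piMr// ger0_norm; lra.
have split1 : T h u x - Tl l h u x =
    \int[P x]_w ((u (M h w) - u x) * (1 - X w)) + u x * \int[P x]_w (1 - X w).
  rewrite /semigroup /damped_semigroup -RintegralB// -RintegralZl// -RintegralD//; last first.
    by have := integrableZl measurableT (u x) I1X.
  by apply: eq_Rintegral => w _; rewrite /X; ring.
pose Y w := expR (- rate h w).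
have rb w := rate_bounds w h0.
have r0 w : 0 <= rate h w by have /andP[k _] := rb w; rewrite (le_trans _ k)// mulr_ge0// ltW.
have Y1 w : 0 <= 1 - Y w <= C * h.
  rewrite subr_ge0 -{1}expR0 ler_expR oppr_le0 r0/=.
  by have := expR_ge1Dx (- rate h w); have /andP[_ k] := rb w; rewrite /Y; lra.
have IY : (P x).-integrable setT (EFin \o Y) := expR_rate_integrable x h0.
have I1 (a : R) : (P x).-integrable setT (EFin \o cst a) by apply: (@prob_integrable _ _ _ _ _ `|a|).
have I1Y : (P x).-integrable setT (EFin \o (fun w => 1 - Y w)) by have := integrableB measurableT (I1 1) IY.
have EXY : \int[P x]_w (1 - X w) = \int[P x]_w (1 - Y w).
  rewrite (RintegralB measurableT (I1 1) IX) (RintegralB measurableT (I1 1) IY).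
  by congr (_ - _); exact: damping_mean_eq.
have EXle : \int[P x]_w (1 - X w) <= C * h.
  rewrite EXY -[leRHS](prob_cst (P x)).
  by apply: (le_Rintegral measurableT I1Y (I1 (C * h))) => w _; case/andP: (Y1 w).
(* Off [A] the cost is at most [ep (1 - X)]. On [A], an event of the path up to h, [damping_cond]
   bounds the mass of [1 - X] by [C h P(A)]. *)
pose A := [set w | ep < `|u (M h w) - u x|].
have pA : path_sigma_algebra M `[0, h] A.
  apply: sub_sigma_algebra; exists h => /=; first by rewrite in_itv/= h0 lexx.
  exists [set y | ep < `|u y - u x|] => //.
  have mg : measurable_fun setT (fun y => `|u y - u x|).
    by apply: measurableT_comp => //; apply: measurable_funB => //; exact: continuous_measurable_rV.
  rewrite (_ : mkset _ = (fun y => `|u y - u x|) @^-1` `]ep, +oo[%classic); last first.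
    by apply/seteqP; split => y /=; rewrite in_itv/= andbT.
  by rewrite -[X in measurable X]setTI; exact: mg.
have mA := path_sub pA.
have IA g : (P x).-integrable setT (EFin \o g) -> (P x).-integrable A (EFin \o g).
  by move=> Ig; apply: integrableS Ig.
have IDa : (P x).-integrable setT (EFin \o (fun w => `|u (M h w) - u x|)).
  apply: (@prob_integrable _ _ _ _ _ (2 * B)); first exact: measurableT_comp.
  by move=> w; rewrite normr_id.
have PA : ep * fine (P x A) <= eta.
  rewrite -(Rintegral_cst (P x))//.
  apply: (@le_trans _ _ (\int[P x]_(w in A) `|u (M h w) - u x|)).
    by apply: (le_Rintegral mA (IA _ (I1 ep)) (IA _ IDa)) => w /ltW.
  apply: le_trans (Md h _); last by rewrite h0 lexx.
  rewrite /Rintegral fine_le//; try exact: integrable_fin_num.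
    by apply: integrable_fin_num => //; exact: IA.
  by apply: ge0_subset_integral => //; apply/measurable_EFinP; exact: measurableT_comp.
have hA : \int[P x]_(w in A) (1 - X w) <= C * h * fine (P x A).
  rewrite damping_cond// -(Rintegral_cst (P x))//.
  by apply: (le_Rintegral mA (IA _ I1Y) (IA _ (I1 (C * h)))) => w _; case/andP: (Y1 w).
have second : `|\int[P x]_w ((u (M h w) - u x) * (1 - X w))| <= 2 * (e / 5) * h.
  have I3 : (P x).-integrable setT (EFin \o (fun w => ep * (1 - X w))).
    by have := integrableZl measurableT ep I1X.
  have I4 : (P x).-integrable setT (EFin \o (((fun w => 2 * B * (1 - X w))) \_ A)).
    rewrite -restrict_EFin; apply/integrable_restrict => //; rewrite setTI.
    by apply: IA; have := integrableZl measurableT (2 * B) I1X.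
  apply: (@le_trans _ _ (\int[P x]_w (ep * (1 - X w) + ((fun w => 2 * B * (1 - X w)) \_ A) w))).
    apply: (le_trans (le_normr_Rintegral measurableT ID)).
    apply: le_Rintegral => //; first exact: integrable_norm.
      by have := integrableD measurableT I3 I4.
    move=> w _; have /andP[k0 k1] := X01 w.
    have k2 : 0 <= 1 - X w by rewrite subr_ge0.
    rewrite normrM [X in _ * X]ger0_norm// patchE.
    case: ifPn => [_|/negP nA].
      by rewrite -mulrDl ler_wpM2r// (le_trans (D2B w))// lerDr ltW.
    rewrite addr0 ler_wpM2r// leNgt; apply/negP => wA; apply: nA.
    by rewrite inE.
  rewrite (RintegralD measurableT I3 I4) (RintegralZl ep measurableT I1X).
  rewrite -Rintegral_mkcond (RintegralZl (2 * B) mA (IA _ I1X)).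
  have q1 : ep * \int[P x]_w (1 - X w) <= e / 5 * h.
    apply: (@le_trans _ _ (ep * (C * h))); first by rewrite ler_wpM2l// ltW.
    rewrite mulrA ler_wpM2r// mulrC; apply: frac => //; exact: ltW.
  have q2 : 2 * B * \int[P x]_(w in A) (1 - X w) <= e / 5 * h.
    apply: (@le_trans _ _ (2 * B * (C * h * fine (P x A)))); first by rewrite ler_wpM2l// mulr_ge0.
    have PA' : fine (P x A) <= e / 5 / (2 * B * C + 1).
      rewrite -(ler_pM2l ep0); apply: (le_trans PA).
      by rewrite /eta ge_min lexx.
    rewrite (_ : 2 * B * _ = 2 * B * C * fine (P x A) * h); last by ring.
    rewrite ler_wpM2r//; apply: (@le_trans _ _ (2 * B * C * (e / 5 / (2 * B * C + 1)))).
      by rewrite ler_wpM2l.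
    by apply: frac => //; exact: ltW.
  by rewrite (_ : 2 * (e / 5) * h = e / 5 * h + e / 5 * h); [exact: lerD|ring].
have [IE mr EI] := rate_fubini x h0.
have Ir : (P x).-integrable setT (EFin \o rate h).
  apply: (@prob_integrable _ _ _ _ _ (C * h)) => // w.
  by rewrite ger0_norm//; case/andP: (rb w).
have third : `|\int[P x]_w (1 - Y w) - \int[P x]_w rate h w| <= (C * h) ^+ 2.
  rewrite -[leRHS](prob_cst (P x)).
  apply: (Rintegral_dist_le measurableT I1Y Ir (I1 ((C * h) ^+ 2))) => w _ /=.
  set i := rate h w; have i0 : 0 <= i by exact: r0.
  have k3 : i ^+ 2 <= (C * h) ^+ 2.
    by rewrite ler_sqr ?nnegrE ?mulr_ge0//; case/andP: (rb w).
  exact: expRN_remainder.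
(* [f] need not vanish at infinity, so strong continuity is used for [f * u]: first [u x * f (M_s)]
   is replaced by [(f * u) (M_s)] at the cost [C * eta]. *)
have fourth : `|u x * \int[P x]_w rate h w - h * (f x * u x)| <= h * (2 * (e / 5)).
  rewrite EI.
  have Iux : mu.-integrable `[0, h] (EFin \o (fun s => u x * \int[P x]_w f (M s w))).
    by have := integrableZl (measurable_itv _ : measurable (_ : set (measurableTypeR R))) (u x) IE.
  rewrite -RintegralZl//.
  have := @piecewise_integral_le R (fun s => u x * \int[P x]_w f (M s w)) h 1
    (fun=> f x * u x) (fun=> 2 * (e / 5)) h0.
  rewrite mul1r !big_ord_recr !big_ord0/= !add0r; apply => // k s.
  rewrite ltnS leqn0 => /eqP ->; rewrite mul0r mul1r => /andP[s0 sh].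
  have mfs : measurable_fun setT (fun w => f (M s w)) by exact: measurable_comp_process.
  have mus : measurable_fun setT (fun w => u (M s w)) by exact: measurable_comp_process.
  have Ifs := process_integrable x s0 f_continuous fC.
  have [Bf _ fuB] := C0_bounded Cfu.
  have Ifu := process_integrable x s0 (C0_continuous Cfu) fuB.
  have Ids : (P x).-integrable setT (EFin \o (fun w => `|u (M s w) - u x|)).
    apply: (@prob_integrable _ _ _ _ _ (2 * B)).
      by apply: measurableT_comp => //; exact: measurable_funB.
    by move=> w; rewrite normr_id (le_trans (ler_normB _ _))//; have := uB (M s w); have := uB x; lra.
  have k1 : `|\int[P x]_w (u x * f (M s w)) - \int[P x]_w (f (M s w) * u (M s w))| <= C * eta.
    apply: (@le_trans _ _ (\int[P x]_w (C * `|u (M s w) - u x|))).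
      apply: Rintegral_dist_le => //.
      - by have := integrableZl measurableT (u x) Ifs.
      - by have := integrableZl measurableT C Ids.
      - move=> w _; rewrite (_ : _ - _ = f (M s w) * (u x - u (M s w))); last by ring.
        by rewrite normrM distrC ler_wpM2r.
    by rewrite RintegralZl// ler_wpM2l// Md// s0.
  have k2 := H2 s x; rewrite s0 (le_trans sh)// in k2; have {}k2 := k2 isT.
  rewrite RintegralZl// in k1.
  have k3 : C * eta <= e / 5.
    apply: (@le_trans _ _ (C * ep)); last by apply: frac => //; exact: ltW.
    by rewrite ler_wpM2l// /eta ge_min lexx orbT.
  rewrite /semigroup in k2.
  set a := \int[P x]_w (f (M s w) * u (M s w)) in k1 k2.
  rewrite (_ : _ - _ = (u x * \int[P x]_w f (M s w) - a) + (a - f x * u x)); last by ring.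
  apply: (le_trans (ler_normD _ _)).
  by rewrite (_ : 2 * (e / 5) = e / 5 + e / 5); [exact: lerD (le_trans k1 k3) k2|ring].
rewrite split1 EXY.
set j1 := \int[P x]_w ((u (M h w) - u x) * (1 - X w)) in second *.
set j2 := \int[P x]_w (1 - Y w) in third *.
set j3 := \int[P x]_w rate h w in third fourth *.
have fifth : `|u x * (j2 - j3)| <= e / 5 * h.
  rewrite normrM; apply: (@le_trans _ _ (B * (C * h) ^+ 2)); first exact: ler_pM.
  rewrite (_ : B * (C * h) ^+ 2 = B * C ^+ 2 * h * h); last by ring.
  rewrite ler_wpM2r//; apply: (@le_trans _ _ (B * C ^+ 2 * (e / 5 / (B * C ^+ 2 + 1)))).
    by rewrite ler_wpM2l.
  by apply: frac => //; exact: ltW.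
rewrite (_ : _ - _ = j1 + u x * (j2 - j3) + (u x * j3 - h * (f x * u x))); last by ring.
apply: (le_trans (ler_normD _ _)).
rewrite (_ : e * h = 2 * (e / 5) * h + e / 5 * h + h * (2 * (e / 5))); last by field.
exact: lerD (le_trans (ler_normD _ _) (lerD second fifth)) fourth.
Qed.

End damped.
End markov_additive.

(** * Markov property on a grid, a renewal estimate, and the discretised inverse of sigma *)

(** The left-hand side is a partial sum of p delayed by [m.+1] places. In the renewal estimate m is
    the step in which sigma passes the level and k a later visit. *)
Lemma convolution_sum_le {R : realType} (p : nat -> R) m K : (forall j, 0 <= p j) ->
  \sum_(k < K) (if (m < k)%N then p (k - m.+1)%N else 0) <= \sum_(j < K) p j.
Proof.
move=> p0; elim: K m => [|K IH] m; first by rewrite !big_ord0.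
rewrite big_ord_recl/= add0r big_ord_recr/=.
case: m => [|m].
  apply: (@le_trans _ _ (\sum_(k < K) p k)); last by rewrite lerDl.
  by apply: ler_sum => k _; rewrite /bump/= add1n subn1.
apply: (@le_trans _ _ (\sum_(k < K) (if (m < k)%N then p (k - m.+1)%N else 0))).
  by apply: ler_sum => k _; rewrite /bump/= add1n ltnS subSS.
by apply: (le_trans (IH m)); rewrite lerDl.
Qed.

Section discretisation.
Context {R : realType} {d : nat} {dO : measure_display} {Omega : measurableType dO}
  {F : R -> set (set Omega)} {M : R -> Omega -> 'rV[R]_d}
  {theta : R -> Omega -> Omega} {P : 'rV[R]_d -> probability Omega R}
  {sigma : R -> Omega -> R}.
Hypothesis hM : hunt_process F M theta P.
Hypothesis hsigma : markov_additive_process F M theta P sigma.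
Hypothesis hT : feller_semigroup setT (semigroup M P).
Notation E := 'rV[R]_d.
Notation T := (semigroup M P).

Lemma filtration_measurable t A : 0 <= t -> F t A -> measurable A.
Proof. by move=> t0 FA; have [_ hF _] := hunt_filtration hM; exact: hF FA. Qed.

Lemma markov_indicator x s h A B B' : 0 <= s -> 0 <= h -> F s A ->
  measurable B -> measurable B' ->
  \int[P x]_(w in A) \1_(theta s @^-1` ((M h @^-1` B) `&` (sigma h @^-1` B'))) w =
  \int[P x]_(w in A) fine (P (M s w) ((M h @^-1` B) `&` (sigma h @^-1` B'))).
Proof.
move=> s0 h0 FA mB mB'; have [_ _ H] := map_markov hsigma x s0 h0 mB mB'.
by rewrite /Rintegral (H A FA).
Qed.

Lemma transition_integrable x s h A B B' : 0 <= s -> 0 <= h -> measurable A ->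
  measurable B -> measurable B' ->
  (P x).-integrable A (EFin \o (fun w => fine (P (M s w) ((M h @^-1` B) `&` (sigma h @^-1` B'))))).
Proof.
move=> s0 h0 mA mB mB'; have [_ I _] := map_markov hsigma x s0 h0 mB mB'.
exact: integrableS I.
Qed.

Lemma measurable_event h B B' : 0 <= h -> measurable B -> measurable B' ->
  measurable ((M h @^-1` B) `&` (sigma h @^-1` B')).
Proof.
move=> h0 mB mB'; apply: measurableI; rewrite -[X in measurable X]setTI.
  exact: (measurable_process hM).
exact: (measurable_additive hM hsigma).
Qed.

Lemma measurable_shifted_event s h B B' : 0 <= s -> 0 <= h -> measurable B -> measurable B' ->
  measurable (theta s @^-1` ((M h @^-1` B) `&` (sigma h @^-1` B'))).
Proof.
move=> s0 h0 mB mB'; rewrite -[X in measurable X]setTI.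
by apply: (hunt_shift_measurable hM) => //; exact: measurable_event.
Qed.

Lemma prob_cst_integrable x A (a : R) : measurable A -> (P x).-integrable A (EFin \o cst a).
Proof.
move=> mA; apply: (@bounded_integrable _ _ _ _ _ _ `|a|) => //.
by apply: (le_lt_trans (probability_le1 (P x) mA)); rewrite ltry.
Qed.

Lemma prob_fine_le1 x A : measurable A -> 0 <= fine (P x A) <= 1.
Proof.
move=> mA; rewrite fine_ge0//=; have := probability_le1 (P x) mA.
by rewrite -[X in (X <= _)%E]fineK ?fin_num_measure// lee_fin.
Qed.

(** [map_markov] speaks of events; slicing the range of [u] extends it to C_0 functions. Taking
    [setT] as the condition on sigma leaves the transition of M alone. *)
Lemma markov_process x s h A u : 0 <= s -> 0 <= h -> F s A -> C0 setT u ->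
  \int[P x]_(w in A) u (M (s + h) w) = \int[P x]_(w in A) T h u (M s w).
Proof.
move=> s0 h0 FA Cu; have mA := filtration_measurable s0 FA.
have [B B0 uB] := C0_bounded Cu; have cu := C0_continuous Cu.
have mu_ := continuous_measurable_rV cu.
have CT := cs_C0 (semigroup_contraction hM hT) h0 Cu.
have sh0 : 0 <= s + h by rewrite addr_ge0.
apply/eqP; rewrite -subr_eq0 -normr_le0; apply/ler_addgt0Pr => e e0; rewrite add0r.
have e2 : 0 < e / 2 by rewrite divr_gt0.
have [n [c [Ak [mAk uA]]]] := step_approximation mu_ uB e2.
pose Bk k := u @^-1` Ak k.
have mBk k : measurable (Bk k) by rewrite -[X in measurable X]setTI; exact: mu_.
pose Ev k : set Omega := (M h @^-1` Bk k) `&` (sigma h @^-1` setT).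
have mEv k : measurable (Ev k) by exact: measurable_event.
pose th k : set Omega := theta s @^-1` Ev k.
have mth k : measurable (th k) by exact: measurable_shifted_event.
have Ith k : (P x).-integrable A (EFin \o (\1_(th k) : Omega -> R)).
  apply: (@bounded_integrable _ _ _ _ _ _ 1) => //.
  - by apply: (le_lt_trans (probability_le1 (P x) mA)); rewrite ltry.
  - by move=> w _; rewrite indicE; case: (_ \in _); rewrite ?normr0 ?normr1.
have Itr k : (P x).-integrable A (EFin \o (fun w => fine (P (M s w) (Ev k)))).
  exact: transition_integrable.
have PA1 (a : R) : 0 <= a -> \int[P x]_(w in A) a <= a.
  by move=> a0; rewrite Rintegral_cst// ler_piMr//; case/andP: (prob_fine_le1 x mA).
pose S1 w := \sum_(k < n) c k * \1_(th k) w.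
pose S2 w := \sum_(k < n) c k * fine (P (M s w) (Ev k)).
have I1 k : (P x).-integrable A (EFin \o (fun w => c k * \1_(th k) w)).
  by have := integrableZl mA (c k) (Ith k).
have I2 k : (P x).-integrable A (EFin \o (fun w => c k * fine (P (M s w) (Ev k)))).
  by have := integrableZl mA (c k) (Itr k).
have IS (g : nat -> Omega -> R) : (forall k, (P x).-integrable A (EFin \o g k)) ->
    (P x).-integrable A (EFin \o (fun w => \sum_(k < n) g k w)).
  move=> Ig; rewrite (_ : _ \o _ = (fun w => \sum_(k < n) (g k w)%:E)%E).
    by apply: integrable_sum => // k _; exact: Ig.
  by apply/funext => w /=; rewrite sumEFin.
have S12 : \int[P x]_(w in A) S1 w = \int[P x]_(w in A) S2 w.
  rewrite /S1 /S2 (Rintegral_sum n mA I1) (Rintegral_sum n mA I2).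
  apply: eq_bigr => k _; rewrite (RintegralZl (c k) mA (Ith k)) (RintegralZl (c k) mA (Itr k)).
  by congr (_ * _); rewrite markov_indicator.
have d1 : `|\int[P x]_(w in A) u (M (s + h) w) - \int[P x]_(w in A) S1 w| <= e / 2.
  apply: le_trans (PA1 _ (ltW e2)); apply: (Rintegral_dist_le mA _ (IS _ I1) (prob_cst_integrable x (e / 2) mA)).
    by apply: (integrableS measurableT) => //; exact: (process_integrable hM _ _ cu uB).
  move=> w _; apply: le_trans (uA (M (s + h) w)).
  rewrite [X in `|_ - X|](_ : _ = \sum_(k < n) c k * \1_(u @^-1` Ak k) (M (s + h) w))//.
  apply: eq_bigr => k _; congr (_ * _); rewrite !indicE; congr (nat_of_bool _)%:R.
  apply/idP/idP; rewrite !inE /th /Ev /Bk /= (hunt_shift hM)//.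
  by case.
have d2 : `|\int[P x]_(w in A) T h u (M s w) - \int[P x]_(w in A) S2 w| <= e / 2.
  apply: le_trans (PA1 _ (ltW e2)); apply: (Rintegral_dist_le mA _ (IS _ I2) (prob_cst_integrable x (e / 2) mA)).
    apply: (integrableS measurableT) => //; apply: (process_integrable hM _ _ (C0_continuous CT)) => // y.
    exact: (cs_le (semigroup_contraction hM hT)).
  move=> w _; set y := M s w.
  have IEv k : (P y).-integrable setT (EFin \o (\1_(Ev k) : Omega -> R)).
    apply: (@prob_integrable _ _ _ _ _ 1) => // v.
    by rewrite indicE; case: (_ \in _); rewrite ?normr0 ?normr1.
  have IcEv k : (P y).-integrable setT (EFin \o (fun v => c k * \1_(Ev k) v)).
    by have := integrableZl measurableT (c k) (IEv k).
  rewrite [X in `|_ - X|](_ : _ = \int[P y]_v (\sum_(k < n) c k * \1_(Ev k) v)); last first.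
    rewrite (Rintegral_sum n measurableT IcEv); apply: eq_bigr => k _.
    rewrite (RintegralZl (c k) measurableT (IEv k)); congr (_ * _).
    by rewrite /Rintegral integral_indic// setIT.
  rewrite /semigroup -[leRHS](prob_cst (P y)); apply: Rintegral_dist_le => //.
  - exact: (process_integrable hM _ _ cu uB).
  - rewrite (_ : _ \o _ = (fun v => \sum_(k < n) (c k * \1_(Ev k) v)%:E)%E); last first.
      by apply/funext => v /=; rewrite sumEFin.
    by apply: integrable_sum => // k _; exact: IcEv.
  - exact: prob_cst_integrable.
  - move=> v _; apply: le_trans (uA (M h v)).
    rewrite [X in `|_ - X|](_ : _ = \sum_(k < n) c k * \1_(u @^-1` Ak k) (M h v))//.
    apply: eq_bigr => k _; congr (_ * _); rewrite !indicE; congr (nat_of_bool _)%:R.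
    apply/idP/idP; rewrite !inE /Ev /Bk /=; last by [].
    by case.
rewrite (_ : _ - _ = (\int[P x]_(w in A) u (M (s + h) w) - \int[P x]_(w in A) S1 w) -
  (\int[P x]_(w in A) T h u (M s w) - \int[P x]_(w in A) S2 w)); last by rewrite S12; ring.
by apply: (le_trans (ler_normB _ _)); rewrite (splitr e) lerD.
Qed.

(** Almost surely the increment of sigma after s is sigma_h of the shifted path, so a bound on
    P^y(sigma_h <= a) uniform in y survives conditioning on the past. *)
Lemma markov_increment x s h A (a k : R) : 0 <= s -> 0 <= h -> F s A ->
  (forall y, fine (P y [set w | sigma h w <= a]) <= k) ->
  \int[P x]_(w in A) \1_[set w | sigma (s + h) w - sigma s w <= a] w <= k * fine (P x A).
Proof.
move=> s0 h0 FA H; have mA := filtration_measurable s0 FA.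
have mB' : measurable (`]-oo, a]%classic : set R) by exact: measurable_itv.
have EvE : (M h @^-1` setT) `&` (sigma h @^-1` `]-oo, a]%classic) = [set w | sigma h w <= a].
  by apply/seteqP; split => w /=; [case=> _|]; rewrite in_itv.
have -> : \int[P x]_(w in A) \1_[set w | sigma (s + h) w - sigma s w <= a] w =
    \int[P x]_(w in A) \1_(theta s @^-1` ((M h @^-1` setT) `&` (sigma h @^-1` `]-oo, a]%classic))) w.
  rewrite /Rintegral; congr fine; apply: ae_eq_integral => //.
  - apply/measurable_EFinP; apply: measurable_funTS; apply: measurable_indic.
    rewrite (_ : mkset _ = (fun w => sigma (s + h) w - sigma s w) @^-1` `]-oo, a]%classic); last first.
      by apply/seteqP; split => w /=; rewrite in_itv.
    rewrite -[X in measurable X]setTI; apply: measurable_funB => //.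
      by apply: (measurable_additive hM hsigma); rewrite addr_ge0.
    exact: (measurable_additive hM hsigma).
  - apply/measurable_EFinP; apply: measurable_funTS; apply: measurable_indic.
    exact: measurable_shifted_event.
  - apply: filterS (map_additive hsigma x h0 s0) => w Hw _; rewrite EvE.
    rewrite !indicE; congr ((nat_of_bool _)%:R%:E).
    by apply/idP/idP; rewrite !inE /= Hw addrAC subrr add0r.
rewrite markov_indicator// -Rintegral_cst//; apply: le_Rintegral => //.
- exact: transition_integrable.
- exact: prob_cst_integrable.
- by move=> w _; rewrite EvE.
Qed.

(** Chernoff's bound: on the event, [expR (l a - l sigma_h) >= 1]. *)
Lemma additive_chernoff (l c : R) y h a : 0 < l -> 0 <= h ->
  (forall x, \int[P x]_w expR (- l * sigma h w) <= expR (- c * h)) ->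
  fine (P y [set w | sigma h w <= a]) <= expR (l * a) * expR (- c * h).
Proof.
move=> l0 h0 H.
have mS : measurable [set w | sigma h w <= a].
  rewrite (_ : mkset _ = sigma h @^-1` `]-oo, a]%classic); last first.
    by apply/seteqP; split => w /=; rewrite in_itv.
  by rewrite -[X in measurable X]setTI; exact: (measurable_additive hM hsigma).
have IX : (P y).-integrable setT (EFin \o (fun w => expR (- l * sigma h w))).
  apply: (@prob_integrable _ _ _ _ _ 1); first exact: (measurable_damping hM hsigma).
  by move=> w; have /andP[k0 k1] := damping_le1 hsigma w (ltW l0) h0; rewrite ger0_norm.
have -> : fine (P y [set w | sigma h w <= a]) = \int[P y]_w \1_[set w | sigma h w <= a] w.
  by rewrite /Rintegral integral_indic// setIT.
apply: (@le_trans _ _ (expR (l * a) * \int[P y]_w expR (- l * sigma h w))); last first.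
  by rewrite ler_wpM2l ?expR_ge0.
rewrite -RintegralZl//; apply: le_Rintegral => //.
- apply: (@prob_integrable _ _ _ _ _ 1) => //.
  by move=> w; rewrite indicE; case: (_ \in _); rewrite ?normr0 ?normr1.
- by have := integrableZl measurableT (expR (l * a)) IX.
- move=> w _; rewrite -expRD indicE; case: (boolP (_ \in _)) => [|_]; last exact: expR_ge0.
  rewrite inE/= => wa; rewrite -expR0 ler_expR mulNr subr_ge0.
  by rewrite ler_wpM2l// ltW.
Qed.

(* Once sigma has passed [t] it stays in [`]t, t']] only while it advances by at most
   [t' - t], which [additive_chernoff] makes exponentially unlikely. *)
Lemma renewal_bound (l c t t' h : R) x K : 0 < l -> 0 < c -> 0 < h -> 0 <= t -> t <= t' ->
  (forall s x, 0 <= s -> \int[P x]_w expR (- l * sigma s w) <= expR (- c * s)) ->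
  h * \sum_(k < K) \int[P x]_w (if t < sigma (k%:R * h) w <= t' then 1 else 0)
    <= expR (l * (t' - t)) * (h + c^-1).
Proof.
move=> l0 c0 h0 t0 tt' H.
pose sg k w := sigma (k%:R * h) w.
have kh0 (k : nat) : 0 <= k%:R * h by rewrite mulr_ge0// ltW.
have msg k : measurable_fun setT (sg k) by exact: (measurable_additive hM hsigma).
pose b k w : R := if sg k w <= t then 1 else 0.
(* Sigma passes the level [t] during step m. These events are disjoint, and [A m] is known at time
   [m.+1 * h], from which the process is restarted. *)
pose A m := [set w | sg m w <= t < sg m.+1 w].
have FA m : F (m.+1%:R * h) (A m).
  have [sF _ mono] := hunt_filtration hM.
  have sA := sF _ (kh0 m.+1).
  have F1 : F (m.+1%:R * h) (sg m @^-1` `]-oo, t]%classic).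
    apply: (mono _ _ (kh0 m)); first by rewrite ler_wpM2r ?(ltW h0)// ler_nat.
    by apply: (map_adapted hsigma) => //; exact: measurable_itv.
  have F2 : F (m.+1%:R * h) (sg m.+1 @^-1` `]t, +oo[%classic).
    by apply: (map_adapted hsigma) => //; exact: measurable_itv.
  have -> : A m = (sg m @^-1` `]-oo, t]%classic) `&` (sg m.+1 @^-1` `]t, +oo[%classic).
    by apply/seteqP; split => w /=; rewrite !in_itv/= andbT => /andP.
  rewrite -(sigma_algebra_id sA) in F1 F2 *.
  exact: (@measurableI _ (g_sigma_algebraType (F (m.+1%:R * h)))).
have mA m := filtration_measurable (kh0 m.+1) (FA m).
have bA m w : \1_(A m) w = b m w - b m.+1 w.
  rewrite indicE /b; have mono : sg m w <= sg m.+1 w.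
    by apply: (additive_mono hsigma) => //; rewrite ler_wpM2r ?(ltW h0)// ler_nat.
  case: (boolP (_ \in _)) => [|]; rewrite ?notin_setE ?inE /A/=.
    by move=> /andP[-> h2]; rewrite leNgt h2/= subr0.
  move/negP; rewrite negb_and -leNgt => /orP[h1|h1].
    by rewrite (negbTE h1) ifF ?subrr//; apply/negbTE; rewrite -ltNge; rewrite -ltNge in h1; exact: lt_le_trans mono.
  by rewrite h1 (le_trans mono h1) subrr.
have sumA k w : \sum_(m < k) \1_(A m) w = 1 - b k w.
  elim: k => [|k IH]; last by rewrite big_ord_recr/= IH bA; ring.
  by rewrite big_ord0 /b /sg mul0r (map_0 hsigma) t0 subrr.
pose q k w : R := if t < sg k w <= t' then 1 else 0.
pose D m k := [set w | sigma (m.+1%:R * h + (k - m.+1)%:R * h) w - sigma (m.+1%:R * h) w <= t' - t].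
have mD m k : measurable (D m k).
  rewrite (_ : D m k = (fun w => sigma (m.+1%:R * h + (k - m.+1)%:R * h) w - sigma (m.+1%:R * h) w) @^-1` `]-oo, (t' - t)]%classic); last first.
    by apply/seteqP; split => w /=; rewrite /D/= in_itv.
  rewrite -[X in measurable X]setTI; apply: measurable_funB => //.
    by apply: (measurable_additive hM hsigma); rewrite addr_ge0.
  exact: msg.
have ind01 (A' : set Omega) w : `|\1_A' w : R| <= 1.
  by rewrite indicE; case: (_ \in _); rewrite ?normr0 ?normr1.
have ind0 (A' : set Omega) w : 0 <= (\1_A' w : R) by rewrite indicE.
(* A visit of []t, t']] at step k is attributed to the unique passage step [m < k]; since then sigma
   has advanced by at most [t' - t]. *)
have qle k w : (k < K)%N ->
    q k w <= \sum_(m < K) (if (m < k)%N then \1_(A m) w * \1_(D m k) w else 0 : R).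
  move=> kK; have nn (m : nat) : 0 <= (if (m < k)%N then \1_(A m) w * \1_(D m k) w else 0 : R).
    by case: ifP => // _; rewrite mulr_ge0.
  rewrite /q; case: ifP => [/andP[tk kt']|_]; last by apply: sumr_ge0 => m _; exact: nn.
  have -> : 1 = \sum_(m < k) \1_(A m) w :> R.
    by rewrite sumA /b leNgt tk/= subr0.
  rewrite (big_ord_widen K (fun m => \1_(A m) w : R) (ltnW kK)) big_mkcond/=.
  apply: ler_sum => m _; case: ifP => // mk.
  case: (boolP (w \in A m)) => [|nA]; last by rewrite !indicE (negbTE nA) mul0r.
  rewrite inE => /andP[_ tm]; rewrite [X in _ <= _ * X]indicE mem_set ?mulr1//.
  by rewrite /D/= -mulrDl -natrD subnKC// lerB// ltW.
pose p j := expR (l * (t' - t)) * expR (- c * (j%:R * h)).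
have p0 j : 0 <= p j by rewrite mulr_ge0 ?expR_ge0.
pose pi m := fine (P x (A m)).
have IAD m k : (P x).-integrable setT (EFin \o (fun w => \1_(A m) w * \1_(D m k) w)).
  apply: (@prob_integrable _ _ _ _ _ 1); first exact: measurable_funM.
  by move=> w; rewrite normrM mulr_ile1.
have AD m k : \int[P x]_w (\1_(A m) w * \1_(D m k) w) <= p (k - m.+1)%N * pi m.
  have Hp y : fine (P y [set w | sigma ((k - m.+1)%:R * h) w <= t' - t]) <= p (k - m.+1)%N.
    by apply: additive_chernoff => // z; exact: H.
  have := @markov_increment x (m.+1%:R * h) ((k - m.+1)%:R * h) (A m) (t' - t) (p (k - m.+1)%N)
    (kh0 _) (kh0 _) (FA m) Hp.
  rewrite Rintegral_mkcond; apply: le_trans.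
  rewrite le_eqVlt; apply/orP; left; apply/eqP; apply: eq_Rintegral => w _.
  by rewrite patchE indicE; case: (_ \in _); rewrite ?mul1r ?mul0r.
have Iif m k : (P x).-integrable setT (EFin \o (fun w => if (m < k)%N then \1_(A m) w * \1_(D m k) w else 0 : R)).
  by case: (m < k)%N; [exact: IAD|exact: (prob_cst_integrable x 0 measurableT)].
have Isum k : (P x).-integrable setT (EFin \o (fun w => \sum_(m < K) (if (m < k)%N then \1_(A m) w * \1_(D m k) w else 0 : R))).
  rewrite (_ : _ \o _ = (fun w => \sum_(m < K) (if (m < k)%N then \1_(A m) w * \1_(D m k) w else 0 : R)%:E)%E).
    by apply: integrable_sum => // m _; exact: Iif.
  by apply/funext => w /=; rewrite sumEFin.
have Iq k : (P x).-integrable setT (EFin \o q k).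
  apply: (@prob_integrable _ _ _ _ _ 1).
    apply: measurable_fun_ifT => //; apply: measurable_and.
      by apply: measurable_fun_ltr => //; exact: msg.
    by apply: measurable_fun_ler => //; exact: msg.
  by move=> w; rewrite /q; case: ifP => _; rewrite ?normr0 ?normr1.
have Iqle k : (k < K)%N -> \int[P x]_w q k w <=
    \sum_(m < K) pi m * (if (m < k)%N then p (k - m.+1)%N else 0).
  move=> kK; apply: (@le_trans _ _ (\int[P x]_w (\sum_(m < K) (if (m < k)%N then \1_(A m) w * \1_(D m k) w else 0 : R)))).
    by apply: (le_Rintegral measurableT (Iq k) (Isum k)) => w _; exact: qle.
  rewrite (Rintegral_sum K measurableT (fun m => Iif m k)); apply: ler_sum => m _.
  case: ifP => _; first by rewrite mulrC.
  by rewrite mulr0 prob_cst.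
have IA m : (P x).-integrable setT (EFin \o (\1_(A m) : Omega -> R)).
  exact: (@prob_integrable _ _ _ _ _ 1).
have pi1 : \sum_(m < K) pi m <= 1.
  have -> : \sum_(m < K) pi m = \int[P x]_w \sum_(m < K) \1_(A m) w.
    rewrite (Rintegral_sum K measurableT IA); apply: eq_bigr => m _.
    by rewrite /Rintegral integral_indic// setIT.
  rewrite -[leRHS](prob_cst (P x)); apply: le_Rintegral => //.
  - rewrite (_ : _ \o _ = (fun w => \sum_(m < K) (\1_(A m) w)%:E)%E).
      by apply: integrable_sum => // m _; exact: IA.
    by apply/funext => w /=; rewrite sumEFin.
  - exact: prob_cst_integrable.
  - by move=> w _; rewrite sumA gerBl /b; case: ifP.
have pi0 m : 0 <= pi m by exact: fine_ge0.
(* Summing over k first bounds the visits after each passage by the same geometric sum; the passage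
   probabilities [pi m] add up to at most 1. *)
apply: (@le_trans _ _ (h * \sum_(j < K) p j)).
  rewrite ler_wpM2l ?(ltW h0)//.
  apply: (@le_trans _ _ (\sum_(k < K) \sum_(m < K) pi m * (if (m < k)%N then p (k - m.+1)%N else 0))).
    by apply: ler_sum => k _; exact: Iqle.
  rewrite exchange_big/=.
  apply: (@le_trans _ _ (\sum_(m < K) pi m * \sum_(j < K) p j)).
    apply: ler_sum => m _; rewrite -mulr_sumr ler_wpM2l//.
    exact: convolution_sum_le.
  by rewrite -mulr_suml ler_piMl// sumr_ge0.
rewrite /p -mulr_sumr mulrCA ler_wpM2l ?expR_ge0//.
exact: geometric_expR_le.
Qed.

(** Sigma is monotone, so the indicators are 1 up to some index and 0 afterwards, and the sum
    telescopes. The index m is the first grid point with sigma above t, or K if there is none. *)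
Lemma running_sum (u : E -> R) t h : 0 < h -> C0 setT u -> forall K w,
  exists m, [/\ (m <= K)%N, (forall k, (k < m)%N -> sigma (k%:R * h) w <= t),
    (m < K)%N -> t < sigma (m%:R * h) w &
    u (M 0 w) + \sum_(k < K) (if sigma (k%:R * h) w <= t
       then u (M (k.+1%:R * h) w) - u (M (k%:R * h) w) else 0) = u (M (m%:R * h) w)].
Proof.
move=> h0 Cu K w; have kh0 (k : nat) : 0 <= k%:R * h by rewrite mulr_ge0// ltW.
elim: K => [|K [m [mK h1 h2 E]]].
  by exists 0%N; split => //; rewrite big_ord0 addr0 mul0r.
rewrite big_ord_recr/= addrA E.
have [Kt|tK] := leP (sigma (K%:R * h) w) t.
  have mEK : m = K.
    apply/eqP; rewrite eqn_leq mK/= leqNgt; apply/negP => /[dup] mK' /h2.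
    apply/negP; rewrite -leNgt; apply: le_trans Kt; apply: (additive_mono hsigma) => //.
    by rewrite ler_wpM2r ?(ltW h0)// ler_nat.
  exists K.+1; split => //; last by rewrite mEK addrC subrK.
    move=> k; rewrite ltnS leq_eqVlt => /predU1P[->//|kK]; apply: h1.
    by rewrite mEK.
  by rewrite ltnn.
exists m; split => //; last by rewrite addr0.
  exact: leqW.
rewrite ltnS leq_eqVlt => /predU1P[->//|]; exact: h2.
Qed.

(** The grid time never precedes the inverse, so right-continuity of M suffices when h tends to
    0. *)
Lemma inverse_approx t h w m : 0 <= t -> 0 < h -> t < sigma (m%:R * h) w ->
  (forall k, (k < m)%N -> sigma (k%:R * h) w <= t) ->
  inverse sigma t w <= m%:R * h <= inverse sigma t w + h.
Proof.
move=> t0 h0 tm km; have kh0 (k : nat) : 0 <= k%:R * h by rewrite mulr_ge0// ltW.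
have lb0 : lbound [set s | 0 <= s /\ t < sigma s w] 0 by move=> s /= [].
have Sm : [set s | 0 <= s /\ t < sigma s w] (m%:R * h) by split.
apply/andP; split; first by apply: ge_inf => //; exists 0.
case: m tm km Sm => [|m] tm km Sm.
  rewrite mul0r addr_ge0 ?(ltW h0)//; apply: lb_le_inf => //; by exists (0%:R * h).
rewrite -natr1 mulrDl mul1r lerD2r; apply: lb_le_inf; first by exists (m.+1%:R * h).
move=> s [s0 ts]; rewrite leNgt; apply/negP => sm.
have := km m (ltnSn m); rewrite leNgt => /negP; apply; apply: (lt_le_trans ts).
by apply: (additive_mono hsigma) => //; exact: ltW.
Qed.

Lemma inverse_bounded t w : (forall s, 0 <= s -> sigma s w <= t) -> inverse sigma t w = 0.
Proof.
move=> H; rewrite /inverse (_ : mkset _ = set0) ?inf0//.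
apply/seteqP; split => // s [s0]; rewrite ltNge => /negP; apply; exact: H.
Qed.

End discretisation.

(** * The time-changed operators: approximation, continuity in time, Laplace transform *)

Section time_change.
Context {R : realType} {d : nat} {dO : measure_display} {Omega : measurableType dO}
  {F : R -> set (set Omega)} {M : R -> Omega -> 'rV[R]_d}
  {theta : R -> Omega -> Omega} {P : 'rV[R]_d -> probability Omega R}
  {sigma : R -> Omega -> R} {nu : 'rV[R]_d -> {measure set R -> \bar R}}.
Hypothesis hM : hunt_process F M theta P.
Hypothesis hsigma : markov_additive_process F M theta P sigma.
Hypothesis hnu : conditional_levy_structure M P sigma nu.
Hypothesis hT : feller_semigroup setT (semigroup M P).
Hypothesis hP : feller_semigroup (half_space (V := 'rV[R]_d)) (joint_semigroup M P sigma).
Notation mu := (@lebesgue_measure R).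
Notation E := 'rV[R]_d.
Notation T := (semigroup M P).
Notation Tl := (damped_semigroup M P sigma).
Notation Pi := (time_changed_semigroup M P sigma).
Notation f l := (fun x => laplace_exponent (nu x) l).
Hypothesis hf : forall l : R, 0 < l -> continuous (f l).
Hypothesis hvi : forall l : R, 0 < l -> exists c C : R,
  [/\ 0 < c, c <= C & forall x, c <= f l x <= C].
Hypothesis rate_unbounded : forall K : R, exists2 l, 0 < l & forall x, K <= f l x.

Lemma damping_mean l c s x : 0 < l -> 0 < c -> (forall x, c <= f l x) -> 0 <= s ->
  \int[P x]_w expR (- l * sigma s w) <= expR (- c * s).
Proof.
move=> l0 c0 cf s0; have [c' [C [_ _ hC]]] := hvi l0.
apply: (@damping_mean_le _ _ _ _ _ _ _ _ _ _ hM hsigma hnu l l0 (f l) c C (fun=> erefl) (hf l0) c0) => // y.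
by rewrite cf/=; case/andP: (hC y).
Qed.

(** By [running_sum] this is u at the position of M at the first grid time with sigma above t, or at
    [K * h]. In the summed form each increment is multiplied by an indicator known at its left
    endpoint. *)
Definition discrete_path h K t (u : E -> R) w :=
  u (M 0 w) + \sum_(k < K) (if sigma (k%:R * h) w <= t
       then u (M (k.+1%:R * h) w) - u (M (k%:R * h) w) else 0).

Lemma discrete_path_le h K t u B w : 0 < h -> C0 setT u -> (forall y, `|u y| <= B) ->
  `|discrete_path h K t u w| <= B.
Proof.
by move=> h0 Cu uB; have [m [_ _ _]] := running_sum hsigma t h0 Cu K w; rewrite /discrete_path => ->.
Qed.

Lemma measurable_le_additive t s : 0 <= s -> measurable_fun setT (fun w => sigma s w <= t).
Proof.
by move=> s0; apply: measurable_fun_ler => //; exact: (measurable_additive hM hsigma).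
Qed.

Lemma measurable_discrete_path h K t u : 0 < h -> C0 setT u ->
  measurable_fun setT (discrete_path h K t u).
Proof.
move=> h0 Cu; have kh0 (k : nat) : 0 <= k%:R * h by rewrite mulr_ge0// ltW.
have mM s : 0 <= s -> measurable_fun setT (fun w => u (M s w)).
  by move=> s0; apply: (measurable_comp_process hM) => //; exact: C0_continuous.
apply: measurable_funD; first exact: mM.
apply: measurable_sum => k.
apply: measurable_fun_ifT => //; first exact: measurable_le_additive.
by apply: measurable_funB; exact: mM.
Qed.

(** A discrete Dynkin formula: [{sigma (k h) <= t}] belongs to the past of [k h], so the Markov
    property there replaces the increment of [u] by [T h u - u]. *)
Lemma discrete_path_mean h K t u x : 0 < h -> C0 setT u ->
  \int[P x]_w discrete_path h K t u w = u x +
  \sum_(k < K) \int[P x]_w (if sigma (k%:R * h) w <= t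
     then T h u (M (k%:R * h) w) - u (M (k%:R * h) w) else 0).
Proof.
move=> h0 Cu; have kh0 (k : nat) : 0 <= k%:R * h by rewrite mulr_ge0// ltW.
have [B B0 uB] := C0_bounded Cu; have cu := C0_continuous Cu.
have CT := cs_C0 (semigroup_contraction hM hT) (ltW h0) Cu.
have TB y := cs_le (semigroup_contraction hM hT) y (ltW h0) Cu uB.
have IM s : 0 <= s -> (P x).-integrable setT (EFin \o (fun w => u (M s w))).
  by move=> s0; exact: (process_integrable hM).
have IT s : 0 <= s -> (P x).-integrable setT (EFin \o (fun w => T h u (M s w))).
  by move=> s0; exact: (process_integrable hM x s0 (C0_continuous CT) TB).
have mA k : measurable [set w | sigma (k%:R * h) w <= t].
  rewrite (_ : mkset _ = sigma (k%:R * h) @^-1` `]-oo, t]%classic); last first.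
    by apply/seteqP; split => w /=; rewrite in_itv.
  by rewrite -[X in measurable X]setTI; exact: (measurable_additive hM hsigma).
have FA k : F (k%:R * h) [set w | sigma (k%:R * h) w <= t].
  rewrite (_ : mkset _ = sigma (k%:R * h) @^-1` `]-oo, t]%classic); last first.
    by apply/seteqP; split => w /=; rewrite in_itv.
  by apply: (map_adapted hsigma) => //; exact: measurable_itv.
have ifE k (g : Omega -> R) : \int[P x]_w (if sigma (k%:R * h) w <= t then g w else 0) =
    \int[P x]_(w in [set w | sigma (k%:R * h) w <= t]) g w.
  rewrite [RHS]Rintegral_mkcond; apply: eq_Rintegral => w _; rewrite patchE.
  by case: ifPn => hw; [rewrite mem_set|rewrite memNset//; exact/negP].
have Iif k : (P x).-integrable setT (EFin \o (fun w => if sigma (k%:R * h) w <= t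
       then u (M (k.+1%:R * h) w) - u (M (k%:R * h) w) else 0)).
  apply: (@prob_integrable _ _ _ _ _ (B + B)).
    apply: measurable_fun_ifT => //; first exact: measurable_le_additive.
    by apply: measurable_funB; apply: (measurable_comp_process hM).
  move=> w; case: ifP => _; last by rewrite normr0 addr_ge0.
  by apply: (le_trans (ler_normB _ _)); rewrite lerD.
have IS : (P x).-integrable setT (EFin \o (fun w => \sum_(k < K) (if sigma (k%:R * h) w <= t
       then u (M (k.+1%:R * h) w) - u (M (k%:R * h) w) else 0))).
  rewrite (_ : _ \o _ = (fun w => \sum_(k < K) (if sigma (k%:R * h) w <= t
       then u (M (k.+1%:R * h) w) - u (M (k%:R * h) w) else 0)%:E)%E).
    by apply: integrable_sum => // k _; exact: Iif.
  by apply/funext => w /=; rewrite sumEFin.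
rewrite /discrete_path (RintegralD measurableT (IM 0 (lexx 0)) IS) (initial_value hM)//.
congr (_ + _); rewrite (Rintegral_sum K measurableT Iif); apply: eq_bigr => k _.
have S (g : Omega -> R) : (P x).-integrable setT (EFin \o g) ->
    (P x).-integrable [set w | sigma (k%:R * h) w <= t] (EFin \o g).
  by move=> Ig; apply: integrableS Ig.
rewrite !ifE (RintegralB (mA k) (S _ (IM _ (kh0 k.+1))) (S _ (IM _ (kh0 k)))).
rewrite (RintegralB (mA k) (S _ (IT _ (kh0 k))) (S _ (IM _ (kh0 k)))).
congr (_ - _); rewrite -(markov_process hM hsigma hT x (kh0 k) (ltW h0) (FA k) Cu).
by rewrite -natr1 mulrDl mul1r.
Qed.

Lemma inverse_ge0 t w : 0 <= inverse sigma t w.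
Proof.
rewrite /inverse; have [->|/set0P ne] := eqVneq [set s | 0 <= s /\ t < sigma s w] set0.
  by rewrite inf0.
by apply: lb_le_inf => // s [].
Qed.

Let hn (n : nat) : R := n.+1%:R^-1.
Let Kn (n : nat) := (n.+1 ^ 2)%N.

Let hn0 n : 0 < hn n. Proof. by rewrite /hn invr_gt0. Qed.

Let Khn n : (Kn n)%:R * hn n = n.+1%:R.
Proof. by rewrite /Kn /hn natrX expr2 mulfK. Qed.

(* If sigma never exceeds [t] then [inverse] is [inf set0 = 0]. *)
Let stopped_path t u n w :=
  if t < sigma n.+1%:R w then discrete_path (hn n) (Kn n) t u w else u (M 0 w).

(** Once the horizon n+1 lies beyond some time at which sigma exceeds t, the selected grid time is
    in [[L, L + hn n]], with L the inverse at t. The convergence holds on every path, so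
    measurability in w follows too. *)
Let stopped_path_cvg t u w : 0 <= t -> C0 setT u ->
  stopped_path t u n w @[n --> \oo] --> u (time_changed M sigma t w).
Proof.
move=> t0 Cu; rewrite /time_changed; have cu := C0_continuous Cu.
have [[s [s0 ts]]|ns] := pselect (exists s, 0 <= s /\ t < sigma s w); last first.
  have ub s : 0 <= s -> sigma s w <= t.
    by move=> s0; rewrite leNgt; apply/negP => ts; apply: ns; exists s.
  rewrite inverse_bounded//; apply: cvg_near_cst; apply: nearW => n.
  by rewrite /stopped_path ltNge ub.
set L := inverse sigma t w; have L0 : 0 <= L by exact: inverse_ge0.
have rc : u (M r w) @[r --> L^'+] --> u (M L w).
  apply: (@cvg_comp _ _ _ (M ^~ w) u _ (nbhs (M L w))); last exact: cu.
  exact: (hunt_right_continuous hM).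
apply/cvgrPdist_le => e e0.
have /cvgrPdist_le /(_ e e0) /nbhs_ballP[dl /= dl0 hdl] := rc.
have dle r : L <= r -> r - L < dl -> `|u (M L w) - u (M r w)| <= e.
  rewrite le_eqVlt => /predU1P[<- _|Lr rd]; first by rewrite subrr normr0 ltW.
  apply: hdl => //; rewrite /ball/= distrC ger0_norm// subr_ge0 ltW//.
exists (maxn (Num.truncn s) (Num.truncn dl^-1)) => // n /=; rewrite geq_max => /andP[n1 n2].
have sn : s <= n.+1%:R.
  by rewrite ltW// (lt_le_trans (truncnS_gt _))// ler_nat ltnS.
have tn : t < sigma n.+1%:R w.
  by apply: (lt_le_trans ts); exact: (additive_mono hsigma).
rewrite /stopped_path tn /discrete_path.
have [m [mK h1 h2 ->]] := running_sum hsigma t (hn0 n) Cu (Kn n) w.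
have tm : t < sigma (m%:R * hn n) w.
  by move: mK; rewrite leq_eqVlt => /predU1P[->|/h2//]; rewrite Khn.
have /andP[a1 a2] := inverse_approx hsigma t0 (hn0 n) tm h1.
apply: dle => //; rewrite ltrBlDl; apply: (le_lt_trans a2); rewrite ltrD2l.
rewrite /hn invf_plt ?posrE//.
by apply: (lt_le_trans (truncnS_gt _)); rewrite ler_nat ltnS.
Qed.

Let measurable_stopped_path t u n : C0 setT u -> measurable_fun setT (stopped_path t u n).
Proof.
move=> Cu; apply: measurable_fun_ifT.
- by apply: measurable_fun_ltr => //; exact: (measurable_additive hM hsigma).
- exact: measurable_discrete_path.
- by apply: (measurable_comp_process hM) => //; exact: C0_continuous.
Qed.

Lemma measurable_time_changed t (u : E -> R) : 0 <= t -> C0 setT u ->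
  measurable_fun setT (fun w => u (time_changed M sigma t w)).
Proof.
move=> t0 Cu; apply: (@measurable_fun_cvg _ _ _ _ (stopped_path t u)).
  by move=> n; exact: measurable_stopped_path.
by move=> w _; exact: stopped_path_cvg.
Qed.

Lemma time_changed_le t u B x : 0 <= t -> C0 setT u -> (forall y, `|u y| <= B) ->
  `|Pi t u x| <= B.
Proof. by move=> t0 Cu uB; apply: prob_norm_le => //; exact: measurable_time_changed. Qed.

Lemma time_changed_dist t u v e x : 0 <= t -> C0 setT u -> C0 setT v ->
  (forall y, `|u y - v y| <= e) -> `|Pi t u x - Pi t v x| <= e.
Proof.
move=> t0 Cu Cv uv; have [B _ uB] := C0_bounded Cu; have [B' _ vB] := C0_bounded Cv.
apply: (@prob_dist_le _ _ _ _ _ _ (Num.max B B')) => //; try exact: measurable_time_changed.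
  by move=> w; rewrite le_max uB.
by move=> w; rewrite le_max vB orbT.
Qed.

(** [discrete_path] and [stopped_path] differ only where sigma has not passed t by time n+1; by
    Chernoff the probability of this is exponentially small in n. Dominated convergence handles
    [stopped_path]. *)
Lemma discrete_path_mean_cvg t u x : 0 <= t -> C0 setT u ->
  \int[P x]_w discrete_path (hn n) (Kn n) t u w @[n --> \oo] --> Pi t u x.
Proof.
move=> t0 Cu; have [B B0 uB] := C0_bounded Cu.
have [c [C [c0 _ cf]]] := hvi ltr01.
have cf1 y : c <= f 1 y by case/andP: (cf y).
have sB n w : `|stopped_path t u n w| <= B.
  by rewrite /stopped_path; case: ifP => // _; exact: discrete_path_le.
have cvg1 : \int[P x]_w stopped_path t u n w @[n --> \oo] --> Pi t u x.
  apply: (@bounded_cvg_Rintegral _ _ _ setT (P x) (stopped_path t u) _ (cst B)) => //.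
  - by move=> n; exact: measurable_stopped_path.
  - exact: measurable_time_changed.
  - by move=> w _; exact: stopped_path_cvg.
  - exact: prob_cst_integrable.
have mS n : measurable [set w | sigma n.+1%:R w <= t].
  rewrite (_ : mkset _ = sigma n.+1%:R @^-1` `]-oo, t]%classic); last first.
    by apply/seteqP; split => w /=; rewrite in_itv.
  by rewrite -[X in measurable X]setTI; exact: (measurable_additive hM hsigma).
have diff n : `|\int[P x]_w stopped_path t u n w - \int[P x]_w discrete_path (hn n) (Kn n) t u w|
    <= expR (- c * n.+1%:R) * (2 * B * expR (1 * t)).
  have I1 : (P x).-integrable setT (EFin \o (\1_[set w | sigma n.+1%:R w <= t] : Omega -> R)).
    apply: (@prob_integrable _ _ _ _ _ 1) => // w.
    by rewrite indicE; case: (_ \in _); rewrite ?normr0 ?normr1.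
  have I2 : (P x).-integrable setT (EFin \o (fun w => 2 * B * (\1_[set w | sigma n.+1%:R w <= t] w : R))).
    by have := integrableZl measurableT (2 * B) I1.
  apply: (@le_trans _ _ (\int[P x]_w (2 * B * \1_[set w | sigma n.+1%:R w <= t] w))).
    apply: (Rintegral_dist_le measurableT _ _ I2).
    - by apply: (prob_integrable _ _ (sB n)); exact: measurable_stopped_path.
    - by apply: (@prob_integrable _ _ _ _ _ B) => [|w]; [exact: measurable_discrete_path|exact: discrete_path_le].
    - move=> w _; rewrite /stopped_path; case: ifPn => tn.
        by rewrite subrr normr0 !mulr_ge0.
      rewrite indicE mem_set ?mulr1; last by rewrite /= leNgt.
      apply: (le_trans (ler_normB _ _)); rewrite mulr_natl mulr2n lerD//.
      exact: discrete_path_le.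
  rewrite (RintegralZl (2 * B) measurableT I1).
  rewrite (_ : \int[P x]_w _ = fine (P x [set w | sigma n.+1%:R w <= t])); last first.
    by rewrite /Rintegral integral_indic// setIT.
  rewrite mulrC -mulrA [X in _ <= X]mulrC mulrA -[leRHS]mulrA.
  rewrite mulrC ler_wpM2l ?mulr_ge0//.
  apply: (additive_chernoff hM hsigma) => // y.
  exact: (damping_mean _ ltr01 c0 cf1).
have cvg2 : (\int[P x]_w stopped_path t u n w -
    \int[P x]_w discrete_path (hn n) (Kn n) t u w) @[n --> \oo] --> (0 : R).
  apply/cvgrPdist_le => e e0.
  have [N HN] := expR_decay c0 (2 * B * expR (1 * t)) e0.
  exists N => // n /= Nn; rewrite sub0r normrN (le_trans (diff n))// HN//.
  exact: leqW.
have : (\int[P x]_w stopped_path t u n w - (\int[P x]_w stopped_path t u n w -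
    \int[P x]_w discrete_path (hn n) (Kn n) t u w)) @[n --> \oo] --> Pi t u x - 0.
  exact: cvgB cvg1 cvg2.
by rewrite subr0; under eq_cvg do rewrite subKr.
Qed.

(** The two discretised sums differ by the terms with sigma in []t, t']], each at most [Bu h], and
    [renewal_bound] counts them. The bound does not vanish as t' tends to t with l fixed: it becomes
    small through a large lower bound c of [f l], and [t' - t <= 1 / l] then controls the
    exponential. *)
Lemma time_changed_lipschitz u Bu l c t t' x : C0 setT u ->
  (forall h y, 0 <= h -> `|T h u y - u y| <= Bu * h) ->
  0 < l -> 0 < c -> (forall x, c <= f l x) -> 0 <= t -> t <= t' ->
  `|Pi t' u x - Pi t u x| <= Bu * (expR (l * (t' - t)) / c).
Proof.
move=> Cu uL l0 c0 cf t0 tt'.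
have t'0 : 0 <= t' by exact: le_trans tt'.
have Bu0 : 0 <= Bu by have := uL 1 x ler01; rewrite mulr1; exact: le_trans.
have c1 : \int[P x]_w discrete_path (hn n) (Kn n) t' u w -
    \int[P x]_w discrete_path (hn n) (Kn n) t u w @[n --> \oo] --> Pi t' u x - Pi t u x.
  by apply: cvgB; exact: discrete_path_mean_cvg.
have c2 : `|\int[P x]_w discrete_path (hn n) (Kn n) t' u w -
    \int[P x]_w discrete_path (hn n) (Kn n) t u w| @[n --> \oo] --> `|Pi t' u x - Pi t u x|.
  exact: cvg_norm.
have c3 : Bu * (expR (l * (t' - t)) * (hn n + c^-1)) @[n --> \oo] -->
    Bu * (expR (l * (t' - t)) / c).
  apply: cvgM; first exact: cvg_cst.
  apply: cvgM; first exact: cvg_cst.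
  rewrite -[X in _ --> X]add0r; apply: cvgD; last exact: cvg_cst.
  exact: cvg_harmonic.
apply: (ler_cvg_to c2 c3); apply: nearW => n.
set h := hn n; have h0 : 0 < h := hn0 n.
have kh0 (k : nat) : 0 <= k%:R * h by rewrite mulr_ge0// ltW.
rewrite !discrete_path_mean// opprD addrACA subrr add0r -sumrB.
pose psi y := T h u y - u y.
have Cpsi : C0 setT psi by apply: C0_sub => //; exact: (cs_C0 (semigroup_contraction hM hT) (ltW h0) Cu).
have psiB y : `|psi y| <= Bu * h by apply: uL; exact: ltW.
have mpsi k : measurable_fun setT (fun w => psi (M (k%:R * h) w)).
  by apply: (measurable_comp_process hM) => //; exact: C0_continuous.
have Iif k s : (P x).-integrable setT (EFin \o (fun w => if sigma (k%:R * h) w <= s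
       then psi (M (k%:R * h) w) else 0)).
  apply: (@prob_integrable _ _ _ _ _ (Bu * h)).
    by apply: measurable_fun_ifT => //; exact: measurable_le_additive.
  by move=> w; case: ifP => // _; rewrite normr0 mulr_ge0// ltW.
have Iind k : (P x).-integrable setT (EFin \o (fun w => if t < sigma (k%:R * h) w <= t' then 1 else 0 : R)).
  apply: (@prob_integrable _ _ _ _ _ 1).
    have ms := measurable_additive hM hsigma (kh0 k).
    by apply: measurable_fun_ifT => //; apply: measurable_and; [exact: measurable_fun_ltr|exact: measurable_fun_ler].
  by move=> w; case: ifP => _; rewrite ?normr0 ?normr1.
have term k : `|\int[P x]_w (if sigma (k%:R * h) w <= t' then psi (M (k%:R * h) w) else 0) -
    \int[P x]_w (if sigma (k%:R * h) w <= t then psi (M (k%:R * h) w) else 0)| <=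
    Bu * h * \int[P x]_w (if t < sigma (k%:R * h) w <= t' then 1 else 0).
  have I2 : (P x).-integrable setT (EFin \o (fun w => Bu * h * (if t < sigma (k%:R * h) w <= t' then 1 else 0 : R))).
    by have := integrableZl measurableT (Bu * h) (Iind k).
  rewrite -(RintegralZl (Bu * h) measurableT (Iind k)).
  apply: (Rintegral_dist_le measurableT (Iif k t') (Iif k t) I2) => w _.
  have [st|ts] := leP (sigma (k%:R * h) w) t.
    by rewrite (le_trans st tt') subrr normr0 mulr0.
  by rewrite subr0/=; case: ifP => _; rewrite ?normr0 ?mulr0// mulr1.
apply: (le_trans (ler_norm_sum _ _ _)).
apply: (@le_trans _ _ (\sum_(k < Kn n) Bu * h *
    \int[P x]_w (if t < sigma (k%:R * h) w <= t' then 1 else 0))).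
  by apply: ler_sum => k _; exact: term.
rewrite -mulr_sumr -mulrA ler_wpM2l//.
apply: (renewal_bound hM hsigma) => // s y s0.
exact: damping_mean.
Qed.

(** [u] is replaced by its average [v] over a short time, uniformly close to it, for which
    [T h v - v = O(h)]. Three tolerances of [e / 3]: two for this replacement, one for
    [time_changed_lipschitz]. *)
Lemma time_changed_modulus u e : C0 setT u -> 0 < e -> exists2 dl, 0 < dl &
  forall t t' x, 0 <= t -> 0 <= t' -> `|t - t'| <= dl -> `|Pi t u x - Pi t' u x| <= e.
Proof.
move=> Cu e0; have hTc := semigroup_contraction hM hT.
have [B B0 uB] := C0_bounded Cu.
have e3 : 0 < e / 3 by rewrite divr_gt0.
have [a a0 Ha] := cs_cont hTc Cu e3.
pose v y := a^-1 * time_integral T a u y.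
have CI := time_integral_C0 hTc (ltW a0) Cu.
have Cv : C0 setT v by exact: C0_scale.
have uv y : `|u y - v y| <= e / 3.
  have := @time_integral_dist _ _ _ hTc a u y (u y) (e / 3) (ltW a0) Cu (fun s => Ha s y) => H.
  rewrite distrC /v (_ : a^-1 * _ - u y = a^-1 * (time_integral T a u y - a * u y)); last first.
    by rewrite mulrBr mulKf// gt_eqF.
  by rewrite normrM gtr0_norm ?invr_gt0// ler_pdivrMl.
pose Bu := a^-1 * (2 * B).
have Bu0 : 0 <= Bu by rewrite mulr_ge0 ?invr_ge0 ?(ltW a0)// mulr_ge0.
have vL h y : 0 <= h -> `|T h v y - v y| <= Bu * h.
  move=> h0; rewrite /v (cs_scale hTc)// -mulrBr normrM gtr0_norm ?invr_gt0//.
  rewrite /Bu -mulrA ler_wpM2l ?invr_ge0 ?(ltW a0)//.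
  by apply: (time_integral_lipschitz hTc) => //; exact: ltW.
(* For [|t - t'| <= l^-1] the exponential is at most [expR 1], and this c makes the quotient at most
   [e / 3]. *)
pose c := (Bu * expR 1 + 1) / (e / 3).
have c0 : 0 < c by rewrite divr_gt0// ltr_wpDl// mulr_ge0// expR_ge0.
have [l l0 cf] := rate_unbounded c.
exists l^-1; first by rewrite invr_gt0.
move=> t t' x; wlog tt' : t t' / t <= t' => [W t0 t'0 h|].
  have [h'|/ltW h'] := leP t t'; first exact: W.
  by rewrite distrC; apply: W => //; rewrite distrC.
move=> t0 t'0; rewrite distrC ger0_norm ?subr_ge0// => td.
have L := @time_changed_lipschitz v Bu l c t t' x Cv vL l0 c0 cf t0 tt'.
have {}L : `|Pi t' v x - Pi t v x| <= e / 3.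
  apply: (le_trans L); rewrite mulrA ler_pdivrMr// /c mulrCA divff ?mulr1 ?gt_eqF//.
  apply: (@le_trans _ _ (Bu * expR 1)); last by rewrite lerDl.
  by rewrite ler_wpM2l// ler_expR mulrC -ler_pdivlMr// mul1r.
have d1 := @time_changed_dist t u v (e / 3) x t0 Cu Cv uv.
have d2 := @time_changed_dist t' u v (e / 3) x t'0 Cu Cv uv.
move: d1 d2 L; move: (Pi t u x) (Pi t' u x) (Pi t v x) (Pi t' v x) => a1 a2 a3 a4 d1 d2 L.
rewrite (_ : a1 - a2 = (a1 - a3) - (a2 - a4) - (a4 - a3)); last by ring.
rewrite (_ : e = e / 3 + e / 3 + e / 3); last by field.
apply: (le_trans (ler_normB _ _)); apply: lerD => //.
by apply: (le_trans (ler_normB _ _)); exact: lerD.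
Qed.

Lemma continuous_time_changed u x : C0 setT u -> continuous (fun t : R => Pi (Num.max t 0) u x).
Proof.
move=> Cu s; apply/cvgrPdist_le => e e0; have [dl dl0 h] := time_changed_modulus Cu e0.
near=> r; apply: h; rewrite ?le_max ?lexx ?orbT//.
apply: (@le_trans _ _ `|s - r|); last by near: r; apply: cvgr_dist_le; first exact: cvg_id.
have := ler_norm (s - r); have := ler_norm (r - s); rewrite distrC => h1 h2.
by rewrite /Num.max; case: ifP => a1; case: ifP => a2; rewrite ler_norml; lra.
Unshelve. all: end_near. Qed.

Lemma measurable_time_changed_fun u x : C0 setT u ->
  measurable_fun (`[0, +oo[ : set R) (fun t => Pi t u x).
Proof.
move=> Cu; have m1 : measurable_fun (`[0, +oo[ : set R) (fun t : R => Pi (Num.max t 0) u x).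
  by apply: measurable_funTS; apply: continuous_measurable_fun; exact: continuous_time_changed.
apply: eq_measurable_fun m1 => t; rewrite inE/= in_itv/= andbT => t0.
by rewrite max_l.
Qed.

(** The Laplace transform in t turns the indicator of [sigma (k h) <= t] into
    [expR (- l sigma (k h))]. The transform of the discretised mean is therefore exactly [u] plus
    the sum in [resolvent_gen], for each n. *)
Lemma laplace_time_changed_gen l u : 0 < l -> C0 setT u ->
  is_gen T (fun x => \int[mu]_(t in `[0, +oo[) (l * expR (- l * t) * Pi t u x))
   (fun x => f l x * (\int[mu]_(t in `[0, +oo[) (l * expR (- l * t) * Pi t u x)) - f l x * u x).
Proof.
move=> l0 Cu; have [c [C [c0 _ cf]]] := hvi l0.
have hTc := semigroup_contraction hM hT.
have hSc := damped_contraction hM hsigma hP l0.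
have [B B0 uB] := C0_bounded Cu.
have fC x : `|f l x| <= C.
  by case/andP: (cf x) => h1 h2; rewrite ger0_norm// (le_trans _ h1)// ltW.
apply: (@resolvent_gen R E T (Tl l) hTc hSc c (f l) C c0) => //.
- move=> t v B' x t0 Cv vB.
  exact: (@damped_decay _ _ _ _ _ _ _ _ _ _ hM hsigma hnu l l0 (f l) c C (fun=> erefl) (hf l0) c0 cf).
- exact: hf.
- move=> v Cv e e0.
  exact: (@damped_diff _ _ _ _ _ _ _ _ _ _ hM hsigma hnu hT l l0 (f l) c C (fun=> erefl) (hf l0) c0 cf).
move=> x.
have mD : measurable (`[0, +oo[%classic : set (measurableTypeR R)) by exact: measurable_itv.
have Ie := integrable_expR_itvy l0.
pose psi n y := T (hn n) u y - u y.
have Cpsi n : C0 setT (psi n) by apply: C0_sub => //; exact: (cs_C0 hTc (ltW (hn0 n)) Cu).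
pose ak n k t := \int[P x]_w (if sigma (k%:R * hn n) w <= t then psi n (M (k%:R * hn n) w) else 0).
have LF n k : mu.-integrable `[0, +oo[ (EFin \o (fun t => l * expR (- l * t) * ak n k t)) /\
    \int[mu]_(t in `[0, +oo[) (l * expR (- l * t) * ak n k t) = Tl l (k%:R * hn n) (psi n) x.
  have kh0 : 0 <= k%:R * hn n by rewrite mulr_ge0// ltW.
  have [Bp Bp0 psiB] := C0_bounded (Cpsi n).
  have mp : measurable_fun setT (fun w => psi n (M (k%:R * hn n) w)).
    by apply: (measurable_comp_process hM) => //; exact: C0_continuous.
  have [||||I1 E1] := @laplace_fubini R _ _ (P x) (sigma (k%:R * hn n))
     (fun w => psi n (M (k%:R * hn n) w)) l l0.
  - exact: (measurable_additive hM hsigma).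
  - exact: mp.
  - by move=> w; exact: (additive_ge0 hsigma).
  - apply: (@prob_integrable _ _ _ _ _ Bp).
      by apply: measurable_funM => //; exact: (measurable_damping hM hsigma).
    move=> w; have /andP[k0 k1] := damping_le1 hsigma w (ltW l0) kh0.
    by rewrite normrM (ger0_norm k0) (le_trans _ (psiB (M (k%:R * hn n) w)))// ler_piMl.
  split; first exact: I1.
  by rewrite /ak E1 /damped_semigroup; apply: eq_Rintegral => w _; rewrite mulrC.
pose Z n t := \int[P x]_w discrete_path (hn n) (Kn n) t u w.
have ZE n t : l * expR (- l * t) * Z n t = l * expR (- l * t) * u x +
   \sum_(k < Kn n) l * expR (- l * t) * ak n k t.
  by rewrite /Z discrete_path_mean// mulrDr mulr_sumr.
have I0 : mu.-integrable `[0, +oo[ (EFin \o (fun t => l * expR (- l * t) * u x)).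
  by have := integrableZr mD (u x) Ie; apply: eq_integrable.
have IS n : mu.-integrable `[0, +oo[ (EFin \o (fun t => \sum_(k < Kn n) l * expR (- l * t) * ak n k t)).
  rewrite (_ : _ \o _ = (fun t => \sum_(k < Kn n) (l * expR (- l * t) * ak n k t)%:E)%E).
    by apply: integrable_sum => // k _; exact: (LF n k).1.
  by apply/funext => t /=; rewrite sumEFin.
have IZ n : mu.-integrable `[0, +oo[ (EFin \o (fun t => l * expR (- l * t) * Z n t)).
  have := integrableD mD I0 (IS n); apply: eq_integrable => // t _.
  by rewrite /= ZE EFinD.
have intZ n : \int[mu]_(t in `[0, +oo[) (l * expR (- l * t) * Z n t) =
    u x + \sum_(k < Kn n) Tl l (k%:R * hn n) (psi n) x.
  transitivity (\int[mu]_(t in `[0, +oo[) (l * expR (- l * t) * u x +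
     \sum_(k < Kn n) l * expR (- l * t) * ak n k t)).
    by apply: eq_Rintegral => t _; rewrite ZE.
  rewrite (RintegralD mD I0 (IS n)) (RintegralZr (u x) mD Ie).
  rewrite [X in X * _]/Rintegral integral_expR_itvy// mulr0 expR0 mul1r.
  congr (_ + _); rewrite (Rintegral_sum (Kn n) mD (fun k => (LF n k).1)).
  by apply: eq_bigr => k _; rewrite (LF n k).2.
have IB : mu.-integrable `[0, +oo[ (EFin \o (fun t => l * expR (- l * t) * B)).
  by have := integrableZr mD B Ie; apply: eq_integrable.
have le0 t : 0 <= l * expR (- l * t) by rewrite mulr_ge0 ?expR_ge0 ?(ltW l0).
have cv : \int[mu]_(t in `[0, +oo[) (l * expR (- l * t) * Z n t) @[n --> \oo] -->
    \int[mu]_(t in `[0, +oo[) (l * expR (- l * t) * Pi t u x).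
  apply: (bounded_cvg_Rintegral mD _ _ _ IB).
  - by move=> n; apply/measurable_EFinP; case/integrableP : (IZ n).
  - apply: measurable_funM; last exact: measurable_time_changed_fun.
    by apply/measurable_EFinP; case/integrableP : Ie.
  - move=> t /=; rewrite in_itv/= andbT => t0; apply: cvgM; first exact: cvg_cst.
    exact: discrete_path_mean_cvg.
  - move=> n t _; rewrite normrM ger0_norm// ler_wpM2l//.
    apply: prob_norm_le; first exact: measurable_discrete_path.
    by move=> w; exact: discrete_path_le.
have : (\int[mu]_(t in `[0, +oo[) (l * expR (- l * t) * Z n t) - u x) @[n --> \oo] -->
    \int[mu]_(t in `[0, +oo[) (l * expR (- l * t) * Pi t u x) - u x.
  by apply: cvgB => //; exact: cvg_cst.
by under eq_cvg do rewrite intZ addrAC subrr add0r.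
Qed.

End time_change.

(** * Combinations of Laplace transforms at integer rates *)

Section laplace_combination.
Context {R : realType}.
Notation mu := (@lebesgue_measure R).

Let mD : measurable (`[0, +oo[%classic : set (measurableTypeR R)).
Proof. exact: measurable_itv. Qed.

Lemma laplace_integrable (G : R -> R) (B l : R) : 2 <= l ->
  measurable_fun (`[0, +oo[ : set R) G -> (forall r, 0 <= r -> `|G r| <= B * expR r) ->
  mu.-integrable `[0, +oo[ (EFin \o (fun r => l * expR (- l * r) * G r)).
Proof.
move=> l2 mG GB; have l0 : 0 <= l by exact: le_trans l2.
apply: (@exp_dominated_integrable _ _ (l * B)).
  apply: measurable_funM => //; apply: measurable_funTS; apply: measurable_funM => //.
  by apply: measurableT_comp => //; exact: measurable_funM.
move=> r r0; rewrite normrM ger0_norm ?mulr_ge0 ?expR_ge0//.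
rewrite -!mulrA ler_wpM2l//.
apply: (@le_trans _ _ (expR (- l * r) * (B * expR r))).
  by rewrite ler_wpM2l ?expR_ge0 ?GB.
have B0 : 0 <= B by have := GB 0 (lexx _); rewrite expR0 mulr1; exact: le_trans.
rewrite mulrCA ler_wpM2l// -expRD ler_expR.
have : 2 * r <= l * r by rewrite ler_wpM2r.
by lra.
Qed.

(** The monomial of degree k corresponds to the rate [k + 2]; a rate of at least 2 dominates the
    growth [expR r] and leaves an integrable [expR (- r)]. *)
Lemma laplace_combination (p : {poly R}) (G : R -> R) (B : R) :
  measurable_fun (`[0, +oo[ : set R) G -> (forall r, 0 <= r -> `|G r| <= B * expR r) ->
  \int[mu]_(r in `[0, +oo[) (expR (- 2 * r) * p.[expR (- r)] * G r) =
  \sum_(k < size p) p`_k / k.+2%:R *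
    \int[mu]_(r in `[0, +oo[) (k.+2%:R * expR (- k.+2%:R * r) * G r).
Proof.
move=> mG GB.
have Ik k : mu.-integrable `[0, +oo[ (EFin \o (fun r => k.+2%:R * expR (- k.+2%:R * r) * G r)).
  by apply: laplace_integrable GB => //; rewrite ler_nat.
have Ikc k : mu.-integrable `[0, +oo[ (EFin \o (fun r => p`_k / k.+2%:R * (k.+2%:R * expR (- k.+2%:R * r) * G r))).
  by have := integrableZl mD (p`_k / k.+2%:R) (Ik k).
transitivity (\int[mu]_(r in `[0, +oo[) (\sum_(k < size p)
    p`_k / k.+2%:R * (k.+2%:R * expR (- k.+2%:R * r) * G r))).
  apply: eq_Rintegral => r _; rewrite horner_coef mulr_sumr mulr_suml.
  apply: eq_bigr => k _; rewrite -expRM_natl.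
  rewrite (_ : - k.+2%:R * r = - 2 * r + (k%:R * - r)); last by rewrite -addn2 natrD; ring.
  by rewrite expRD; field; rewrite -addn2 natrD gt_eqF// ltr_wpDl.
rewrite (Rintegral_sum (size p) mD Ikc); apply: eq_bigr => k _.
by rewrite (RintegralZl (p`_k / k.+2%:R) mD (Ik k)).
Qed.

End laplace_combination.

(** * Inversion of the Laplace transform and the mild equation *)

Section mild_solution.
Context {R : realType} {d : nat} {dO : measure_display} {Omega : measurableType dO}
  {F : R -> set (set Omega)} {M : R -> Omega -> 'rV[R]_d}
  {theta : R -> Omega -> Omega} {P : 'rV[R]_d -> probability Omega R}
  {sigma : R -> Omega -> R} {nu : 'rV[R]_d -> {measure set R -> \bar R}}.
Hypothesis hM : hunt_process F M theta P.
Hypothesis hsigma : markov_additive_process F M theta P sigma.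
Hypothesis hnu : conditional_levy_structure M P sigma nu.
Hypothesis hT : feller_semigroup setT (semigroup M P).
Hypothesis hP : feller_semigroup (half_space (V := 'rV[R]_d)) (joint_semigroup M P sigma).
Notation mu := (@lebesgue_measure R).
Notation E := 'rV[R]_d.
Notation T := (semigroup M P).
Notation Pi := (time_changed_semigroup M P sigma).
Notation f l := (fun x => laplace_exponent (nu x) l).
Hypothesis hf : forall l : R, 0 < l -> continuous (f l).
Hypothesis hvi : forall l : R, 0 < l -> exists c C : R,
  [/\ 0 < c, c <= C & forall x, c <= f l x <= C].

(** For [s > 1 / l] one has [1 - expR (- l s) >= 1 / 2], so [f l x] is at least half the tail of
    [nu x] at [1 / l]. The infimum of these tails over x is a tail of [m], which tends to infinity
    at 0. *)
Lemma exponent_unbounded (m : {measure set R -> \bar R}) :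
  m `]0, +oo[%classic = +oo%E ->
  (forall s : R, 0 < s -> ereal_inf [set tail nu s x | x in setT] = m `]s, +oo[%classic) ->
  forall K : R, exists2 l, 0 < l & forall x, K <= f l x.
Proof.
move=> moo minf K.
pose D n : set R := `]n.+1%:R^-1, +oo[%classic.
have mDn n : measurable (D n) by exact: measurable_itv.
have UD : \bigcup_n D n = `]0, +oo[%classic.
  apply/seteqP; split => [s [n _]|s]; rewrite /D/= !in_itv/= !andbT.
    by apply: lt_trans; rewrite invr_gt0.
  move=> s0; exists (Num.truncn s^-1) => //=; rewrite in_itv/= andbT.
  by rewrite invf_plt ?posrE// truncnS_gt.
have cv : m (D n) @[n --> \oo] --> m (\bigcup_n D n).
  apply: nondecreasing_cvg_mu => //; first by rewrite UD; exact: measurable_itv.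
  move=> i j ij; apply/subsetPset; apply: subset_itvr; rewrite bnd_simp.
  by rewrite lef_pV2 ?posrE// ler_nat ltnS.
rewrite UD moo in cv.
(* The factor 2 compensates the lower bound 1/2; the rate will be [N.+1]. *)
have /cvgeyPge /(_ (2 * K)) [N _ HN] := cv.
have hN := HN N (leqnn N); rewrite /= in hN.
pose a : R := N.+1%:R^-1; have a0 : 0 < a by rewrite invr_gt0.
exists (N.+1%:R) => // x.
have levy := cls_levy hnu x.
have Doo := levy_tail_lty levy a0.
have tailD : (2 * K <= fine (nu x (D N))).
  rewrite -lee_fin fineK ?ge0_fin_numE//; apply: (le_trans hN).
  rewrite -(minf a a0); apply: ereal_inf_lbound; by exists x.
have If := @integrable_levy_exponent R (nu x) levy N.+1%:R (ltr0Sn _ _).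
have sub : D N `<=` `]0, +oo[%classic.
  by apply: subset_itvr; rewrite bnd_simp ltW.
have IfD : (nu x).-integrable (D N) (EFin \o (fun s => 1 - expR (- N.+1%:R * s))).
  by apply: integrableS If.
have ge0 (s : R) : 0 < s -> 0 <= 1 - expR (- N.+1%:R * s).
  by move=> s0; rewrite subr_ge0 -expR0 ler_expR mulNr oppr_le0 mulr_ge0// ltW.
apply: (@le_trans _ _ (\int[nu x]_(s in D N) (1 - expR (- N.+1%:R * s)))); last first.
  rewrite /laplace_exponent /Rintegral fine_le//; try exact: integrable_fin_num.
  apply: ge0_subset_integral => //; first by case/integrableP : If.
  by move=> s /=; rewrite in_itv/= andbT => s0; rewrite lee_fin ge0.
apply: (@le_trans _ _ (\int[nu x]_(s in D N) 2^-1)).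
  by rewrite Rintegral_cst// ler_pdivlMl.
apply: le_Rintegral => //.
  apply: (@bounded_integrable _ _ _ _ _ _ 2^-1) => // s _.
  by rewrite ger0_norm ?invr_ge0.
move=> s; rewrite /D/= in_itv/= andbT => sa.
have : 1 <= N.+1%:R * s.
  by rewrite mulrC -ler_pdivrMr// mul1r ltW.
have e2 : expR (- 1) <= 2^-1 :> R.
  rewrite expRN lef_pV2 ?posrE ?expR_gt0//.
  by have := expR_ge1Dx (1 : R); rewrite -[1 + 1]/(2 : R).
move=> h; have : expR (- N.+1%:R * s) <= expR (- 1).
  by rewrite ler_expR mulNr lerN2.
by lra.
Qed.

Hypothesis rate_unbounded : forall K : R, exists2 l, 0 < l & forall x, K <= f l x.

Let mD : measurable (`[0, +oo[%classic : set (measurableTypeR R)).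
Proof. exact: measurable_itv. Qed.

(** Strict increase makes sigma positive at every positive time. *)
Lemma inverse0 w : inverse sigma 0 w = 0.
Proof.
apply/eqP; rewrite eq_le inverse_ge0 andbT; apply/ler_addgt0Pr => e e0; rewrite add0r.
have s0 : 0 < sigma (1%:R * e) w.
  by rewrite mul1r -(map_0 hsigma w); exact: (map_increasing hsigma).
have km k : (k < 1)%N -> sigma (k%:R * e) w <= 0.
  by rewrite ltnS leqn0 => /eqP ->; rewrite mul0r (map_0 hsigma).
by have /andP[] := inverse_approx hsigma (lexx 0) e0 s0 km; rewrite mul1r.
Qed.

Lemma time_changed0 u x : C0 setT u -> Pi 0 u x = u x.
Proof.
move=> Cu; rewrite -(initial_value hM x (C0_continuous Cu)).
by apply: eq_Rintegral => w _; rewrite /time_changed inverse0.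
Qed.

Variables (u : E -> R) (B : R).
Hypothesis Cu : C0 setT u.
Hypothesis B_ge0 : 0 <= B.
Hypothesis uB : forall y, `|u y| <= B.

Let Pi_le t x : 0 <= t -> `|Pi t u x| <= B.
Proof. by move=> t0; exact: (time_changed_le hM hsigma). Qed.

Let Pi_modulus e : 0 < e -> exists2 dl, 0 < dl & forall t t' x, 0 <= t -> 0 <= t' ->
  `|t - t'| <= dl -> `|Pi t u x - Pi t' u x| <= e.
Proof.
by move=> e0; exact: (time_changed_modulus hM hsigma hnu hT hf hvi rate_unbounded).
Qed.

Let mPi x : measurable_fun (`[0, +oo[ : set R) (fun t => Pi t u x).
Proof. exact: (measurable_time_changed_fun hM hsigma hnu hT hf hvi rate_unbounded). Qed.

Let laplace l x := \int[mu]_(t in `[0, +oo[) (l * expR (- l * t) * Pi t u x).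

Let laplace_gen l : 0 < l -> is_gen T (laplace l) (fun x => f l x * laplace l x - f l x * u x).
Proof. by move=> l0; exact: (laplace_time_changed_gen hM hsigma hnu hT hP hf hvi rate_unbounded). Qed.

Let Pi_growth x r : 0 <= r -> `|Pi r u x| <= B * expR r.
Proof.
move=> r0; apply: (le_trans (Pi_le x r0)); rewrite ler_peMr// -expR0 ler_expR//.
Qed.

(** The Laplace transforms lie in the domain of the generator, hence in C_0. As the time modulus is
    uniform in x, [approx_identity] exhibits [Pi t u] as a uniform limit of their combinations. *)
Lemma time_changed_C0 t : 0 <= t -> C0 setT (Pi t u).
Proof.
rewrite le_eqVlt => /predU1P[<-|t0].
  by rewrite (_ : Pi 0 u = u)//; apply/funext => x; exact: time_changed0.
apply: C0_uniform_limit => e e0; have e2 : 0 < e / 2 by rewrite divr_gt0.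
have [dl dl0 Hd] := Pi_modulus e2.
have B1 : 0 < B + 1 by rewrite ltr_wpDl.
pose eta := Num.min dl (e / 2 / (B + 1)).
have eta0 : 0 < eta by rewrite lt_min dl0 divr_gt0.
have [p Hp] := approx_identity t0 eta0.
exists (fun x => \sum_(k < size p) p`_k / k.+2%:R * laplace k.+2%:R x).
  apply: (@C0_sum _ _ (size p) (fun k => p`_k / k.+2%:R) (fun k => laplace k.+2%:R)) => k.
  by have [] := laplace_gen (ltr0Sn R k.+1).
move=> x; rewrite distrC -(laplace_combination p (mPi x) (Pi_growth x)).
apply: (le_trans (Hp _ B (e / 2) (mPi x) (Pi_growth x) _)).
  move=> r r0 rt; apply: Hd => //; first exact: ltW.
  by apply: (le_trans rt); rewrite ge_min lexx.
rewrite [leRHS](splitr e) lerD2l; apply: (@le_trans _ _ (e / 2 / (B + 1) * B)).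
  by rewrite ler_wpM2r// ge_min lexx orbT.
by rewrite mulrAC ler_pdivrMr// ler_wpM2l ?(ltW e2)// lerDl.
Qed.

Let V r x := \int[mu]_(s in `[0, r]) Pi s u x.

Let integrable_Pi a b x : 0 <= a -> mu.-integrable `[a, b] (EFin \o (fun s => Pi s u x)).
Proof.
move=> a0; apply: (@bounded_integrable _ _ _ _ _ _ B) => //.
- exact: lebesgue_measure_cc_lty.
- by apply: measurable_funS (mPi x) => //; apply: subset_itv; rewrite bnd_simp.
- move=> s /=; rewrite in_itv/= => /andP[sa _]; apply: Pi_le; exact: le_trans sa.
Qed.

Let V_dist r r' x : 0 <= r -> r <= r' -> `|V r' x - V r x| <= B * (r' - r).
Proof.
move=> r0 rr'.
have I1 := integrable_Pi r' x (lexx 0).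
have I2 := integrable_Pi r' x r0.
have := @Rintegral_itvB R (fun s => Pi s u x) (BLeft 0) (BRight r') r I1.
rewrite !bnd_simp r0 rr' => /(_ isT isT); rewrite -/(V r' x) -/(V r x) => ->.
rewrite Rintegral_itv_obnd_cbnd; last first.
  by apply: integrableS I2 => //; apply: subset_itvr; rewrite bnd_simp.
rewrite -Rintegral_cst_itv//.
apply: (le_trans (le_normr_Rintegral _ I2)) => //.
apply: le_Rintegral => //; first exact: integrable_norm.
  apply: (@bounded_integrable _ _ _ _ _ _ `|B|) => //.
  exact: lebesgue_measure_cc_lty.
move=> s /=; rewrite in_itv/= => /andP[rs _]; apply: Pi_le; exact: le_trans rs.
Qed.

Let V_lip r r' x : 0 <= r -> 0 <= r' -> `|V r' x - V r x| <= B * `|r' - r|.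
Proof.
move=> r0 r'0; have [rr'|/ltW r'r] := leP r r'.
  by rewrite [X in _ * X]ger0_norm ?subr_ge0//; exact: V_dist.
by rewrite distrC [`|r' - r|]distrC [X in _ * X]ger0_norm ?subr_ge0//; exact: V_dist.
Qed.

Let V0 x : V 0 x = 0.
Proof. by rewrite /V set_itv1 Rintegral_set1. Qed.

Let V_growth x r : 0 <= r -> `|V r x| <= B * expR r.
Proof.
move=> r0; have := V_lip x (lexx 0) r0; rewrite V0 !subr0 [X in _ * X]ger0_norm// => h.
apply: (le_trans h); rewrite ler_wpM2l//.
by apply: le_trans (expR_ge1Dx r); rewrite lerDr.
Qed.

Let mV x : measurable_fun (`[0, +oo[ : set R) (fun r => V r x).
Proof.
have cV : continuous (fun r : R => V (Num.max r 0) x).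
  move=> s; apply/cvgrPdist_le => e e0; near=> r.
  have B1 : 0 < B + 1 by rewrite ltr_wpDl.
  have mx (a : R) : 0 <= Num.max a 0 by rewrite le_max lexx orbT.
  apply: (le_trans (V_lip x (mx r) (mx s))).
  apply: (@le_trans _ _ ((B + 1) * `|s - r|)).
    apply: ler_pM => //; first by rewrite lerDl.
    have := ler_norm (s - r); have := ler_norm (r - s); rewrite distrC => h1 h2.
    by rewrite /Num.max; case: ifP => a1; case: ifP => a2; rewrite ler_norml; lra.
  rewrite mulrC -ler_pdivlMr//; near: r; apply: cvgr_dist_le; first exact: cvg_id.
  by rewrite divr_gt0// ltr_wpDl.
have m1 : measurable_fun (`[0, +oo[ : set R) (fun r : R => V (Num.max r 0) x).
  by apply: measurable_funTS; exact: continuous_measurable_fun.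
apply: eq_measurable_fun m1 => t; rewrite inE/= in_itv/= andbT => t0.
by rewrite max_l.
Unshelve. all: end_near. Qed.

(** Integration in time divides the Laplace transform by l; it is [laplace_fubini] for Lebesgue
    measure, with [b] set to 0 at negative times. *)
Let laplace_V l x : 0 < l ->
  \int[mu]_(r in `[0, +oo[) (l * expR (- l * r) * V r x) = l^-1 * laplace l x.
Proof.
move=> l0.
pose b (s : R) : R := if 0 <= s then Pi (Num.max s 0) u x else 0.
have cPi : continuous (fun t : R => Pi (Num.max t 0) u x).
  exact: (continuous_time_changed hM hsigma hnu hT hf hvi rate_unbounded).
have mb : measurable_fun setT b.
  apply: measurable_fun_ifT => //; first exact: measurable_fun_ler.
  exact: continuous_measurable_fun.
have mmax : measurable_fun setT (fun s : R => Num.max s 0) by exact: measurable_maxr.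
have Ie := integrable_expR_itvy l0.
have IP : mu.-integrable `[0, +oo[ (EFin \o (fun s => l * expR (- l * s) * Pi s u x)).
  have I1 := integrableZr mD B Ie; apply: le_integrable I1 => //.
    apply/measurable_EFinP; apply: measurable_funM; last exact: mPi.
    by apply/measurable_EFinP; case/integrableP : Ie.
  move=> s /=; rewrite in_itv/= andbT => s0; rewrite lee_fin !normrM.
  by rewrite ler_wpM2l ?mulr_ge0// (le_trans (Pi_le x s0))// ler_norm.
have bE : (fun s => (expR (- l * Num.max s 0) * b s)%:E) =
    (fun s => (l^-1 * (l * expR (- l * s) * Pi s u x))%:E) \_ (`[0, +oo[ : set R).
  apply/funext => s; rewrite patchE mem_setE in_itv/= andbT /b.
  case: ifP => s0; last by rewrite mulr0.
  by rewrite max_l//; congr (_%:E); rewrite -mulrA mulKf// gt_eqF.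
have Ib : mu.-integrable setT (fun s => (expR (- l * Num.max s 0) * b s)%:E).
  rewrite bE; apply/integrable_restrict => //; rewrite setTI.
  by have := integrableZl mD l^-1 IP.
have [_ E1] := @laplace_fubini R _ _ mu (fun s => Num.max s 0) b l l0 mmax mb
   ltac:(by move=> s; rewrite le_max lexx orbT) Ib.
transitivity (\int[mu]_(t in `[0, +oo[) (l * expR (- l * t) *
     \int[mu]_s (if Num.max s 0 <= t then b s else 0))).
  apply: eq_Rintegral => t; rewrite inE/= in_itv/= andbT => t0; congr (_ * _).
  rewrite /V Rintegral_mkcond; apply: eq_Rintegral => s _.
  rewrite patchE mem_setE in_itv/= ge_max t0 andbT /b.
  have [s0|s0] := leP 0 s; last by rewrite andFb if_same.
  by rewrite andTb; case: ifP => // _; rewrite max_l.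
rewrite E1 -(RintegralZl l^-1 mD IP) /Rintegral bE -integral_mkcond//.
Qed.

(** The same combination of exponentials is applied to both sides of the resolvent identity divided
    by l. On one side it approximates [V t], on the other the convolution at time t, both uniformly
    in x, and closedness of the generator concludes. *)
Lemma mild_time_changed t : 0 < t ->
  is_gen T (V t) (fun x => \int[mu]_(s in `[0, t])
                  ((Pi s u x - u x) * fine (tail nu (t - s) x))).
Proof.
move=> t0; have hTc := semigroup_contraction hM hT.
have [c1 [C1 [c10 cC1 fC1]]] := hvi ltr01.
have C10 : 0 <= C1 by rewrite (le_trans _ cC1)// ltW.
pose nb x s := fine (tail nu s x).
(* The increment of [Pi u] delayed by s, equal to 0 for [r <= s]. Its integral over [s >= 0] against
   the tail at [s] is the convolution at time r. *)
pose Fs x s r := Pi (Num.max (r - s) 0) u x - u x.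
have mx (a : R) : 0 <= Num.max a 0 by rewrite le_max lexx orbT.
have tailE x l (l0 : 0 < l) := levy_exponent_tail (cls_levy hnu x) l0.
have mnb x : measurable_fun (`[0, +oo[ : set R) (fun s => expR (- s) * nb x s).
  have [I1 _] := tailE x 1 ltr01.
  case/integrableP : I1 => /measurable_EFinP m1 _.
  apply: eq_measurable_fun m1 => s _.
  by rewrite mul1r mulN1r.
have Inb x : mu.-integrable `[0, +oo[ (EFin \o (fun s => expR (- s) * nb x s)).
  have [I1 _] := tailE x 1 ltr01.
  by apply: eq_integrable I1 => // s _; rewrite /= mul1r mulN1r.
have nb0 x s : 0 <= nb x s by exact: fine_ge0.
(* The left-hand side is [f 1 x]. The tail may be unbounded at 0 and non-integrable at infinity, so
   errors in s are measured against the weight [expR (- s)]. *)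
have intnb x : \int[mu]_(s in `[0, +oo[) (expR (- s) * nb x s) <= C1.
  have [_ E1] := tailE x 1 ltr01.
  have /andP[_ h] := fC1 x; apply: le_trans h; rewrite /laplace_exponent E1.
  rewrite le_eqVlt; apply/orP; left; apply/eqP; apply: eq_Rintegral => s _.
  by rewrite mul1r mulN1r.
have Ig x (g : R -> R) K : measurable_fun (`[0, +oo[ : set R) g ->
    (forall s, 0 <= s -> `|g s| <= K * expR (- s)) ->
    mu.-integrable `[0, +oo[ (EFin \o (fun s => nb x s * g s)).
  move=> mg gK; have I1 := integrableZl mD K (Inb x).
  apply: le_integrable I1 => //.
    apply/measurable_EFinP.
    have m1 : measurable_fun (`[0, +oo[ : set R) (fun s => (expR (- s) * nb x s) * (expR s * g s)).
      by apply: measurable_funM => //; apply: measurable_funM => //; exact: measurable_funTS.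
    apply: eq_measurable_fun m1 => s _.
    by rewrite expRN mulrACA mulVf ?mul1r// gt_eqF// expR_gt0.
  move=> s /=; rewrite in_itv/= andbT => s0; rewrite lee_fin.
  rewrite normrM (ger0_norm (nb0 x s)) [leRHS]ger0_norm; last first.
    rewrite mulr_ge0 ?mulr_ge0 ?expR_ge0//.
    by have := gK 0 (lexx _); rewrite oppr0 expR0 mulr1; exact: le_trans.
  by rewrite mulrA mulrC ler_wpM2r// gK.
have Ie l : 0 < l -> mu.-integrable `[0, +oo[ (EFin \o (fun r => l * expR (- l * r))).
  by move=> l0; exact: integrable_expR_itvy.
have IPl l x : 2 <= l -> mu.-integrable `[0, +oo[ (EFin \o (fun r => l * expR (- l * r) * Pi r u x)).
  by move=> l2; exact: laplace_integrable (mPi x) (Pi_growth x).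
have cPi x : continuous (fun t : R => Pi (Num.max t 0) u x).
  exact: (continuous_time_changed hM hsigma hnu hT hf hvi rate_unbounded).
have mF x s : measurable_fun setT (Fs x s).
  apply: measurable_funB => //.
  apply: (@measurableT_comp _ _ _ _ _ _ (fun a : R => Pi (Num.max a 0) u x)).
    exact: continuous_measurable_fun.
  exact: measurable_funB.
have mF' x r : measurable_fun setT (fun s => Fs x s r).
  apply: measurable_funB => //.
  apply: (@measurableT_comp _ _ _ _ _ _ (fun a : R => Pi (Num.max a 0) u x)).
    exact: continuous_measurable_fun.
  exact: measurable_funB.
have FB x s r : `|Fs x s r| <= 2 * B.
  apply: (le_trans (ler_normB _ _)); rewrite mulr_natl mulr2n lerD//.
  exact: Pi_le.
have F0 x s r : r <= s -> Fs x s r = 0.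
  by move=> rs; rewrite /Fs max_r ?subr_le0// time_changed0// subrr.
have laplace_F l x s : 2 <= l -> 0 <= s ->
    \int[mu]_(r in `[0, +oo[) (l * expR (- l * r) * Fs x s r) =
    expR (- l * s) * (laplace l x - u x).
  move=> l2 s0; have l0 : 0 < l by exact: lt_le_trans l2.
  pose G r := l * expR (- l * r) * Fs x s r.
  have mG : measurable_fun setT G.
    apply: measurable_funM => //; apply: measurable_funM => //.
    by apply: measurableT_comp => //; exact: measurable_funM.
  transitivity (\int[mu]_(r in `[s, +oo[) G r).
    rewrite Rintegral_mkcond [RHS]Rintegral_mkcond; apply: eq_Rintegral => r _.
    rewrite !patchE !mem_setE !in_itv/= !andbT.
    have [sr|rs] := leP s r; first by rewrite (le_trans s0 sr).
    by case: ifP => // _; rewrite F0 ?mulr0// ltW.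
  rewrite /Rintegral (@integral_shift R s)//; last first.
    by apply/measurable_EFinP; exact: measurable_funTS.
  rewrite (_ : _ @^-1` _ = `[0, +oo[%classic); last first.
    by apply/seteqP; split => r /=; rewrite !in_itv/= !andbT lerDr.
  have Iu : mu.-integrable `[0, +oo[ (EFin \o (fun r => l * expR (- l * r) * u x)).
    by have := integrableZr mD (u x) (Ie l l0).
  have ID : mu.-integrable `[0, +oo[ (EFin \o (fun r => l * expR (- l * r) * Pi r u x - l * expR (- l * r) * u x)).
    by have := integrableB mD (IPl l x l2) Iu.
  transitivity (\int[mu]_(r in `[0, +oo[) (expR (- l * s) *
      (l * expR (- l * r) * Pi r u x - l * expR (- l * r) * u x))).
    rewrite [RHS]/Rintegral; congr fine; apply: eq_integral => r.
    rewrite inE/= in_itv/= andbT => r0; congr (_%:E).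
    rewrite /G /Fs addrK max_l// -mulrBr [- l * (r + s)]mulrDr expRD.
    by rewrite !mulrA; congr (_ * _); rewrite mulrC mulrA.
  rewrite (RintegralZl (expR (- l * s)) mD ID); congr (_ * _).
  rewrite (RintegralB mD (IPl l x l2) Iu); congr (_ - _).
  rewrite (RintegralZr (u x) mD (Ie l l0)).
  by rewrite [X in X * _]/Rintegral integral_expR_itvy// mulr0 expR0 mul1r.
apply: (is_gen_closed hTc) => e e0.
have frac (a k : R) : 0 <= a -> 0 <= k -> a * (k / (a + 1)) <= k.
  move=> a0 k0; have a1 : 0 < a + 1 by rewrite ltr_wpDl.
  by rewrite mulrCA ler_piMr// ler_pdivrMr// mul1r lerDl.
have pos1 (a : R) : 0 <= a -> 0 < a + 1 by move=> a0; rewrite ltr_wpDl.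
have e2 : 0 < e / 2 by rewrite divr_gt0.
have CE0 : 0 <= C1 * expR (t + 1) by rewrite mulr_ge0 ?expR_ge0.
have CB0 : 0 <= C1 * (2 * B) by rewrite !mulr_ge0.
have B20 : 0 <= 2 * B by rewrite mulr_ge0.
(* [C1] comes from the weighted integral of the tail, [expR (t + 1)] from the range [s <= t + 1] on
   which [expR s] has to be bounded. *)
pose om := e / 2 / (C1 * expR (t + 1) + 1).
have om0 : 0 < om by rewrite divr_gt0// pos1.
have [dl dl0 Hd] := Pi_modulus om0.
(* In order: the time modulus, the localisation [r <= t + 1], the error of the convolution side, the
   error of [V t]. *)
pose eta := Num.min (Num.min dl 1) (Num.min (e / 2 / (C1 * (2 * B) + 1)) (e / (2 * B + 1))).
have eta0 : 0 < eta by rewrite !lt_min dl0 ltr01 !divr_gt0// pos1.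
have [p Hp] := approx_identity t0 eta0.
have eta1 : eta <= 1 by rewrite !ge_min lexx orbT.
have etad : eta <= dl by rewrite !ge_min lexx.
have etaC : C1 * (2 * B) * eta <= e / 2.
  apply: le_trans (frac _ _ CB0 (ltW e2)); rewrite ler_wpM2l//.
  by rewrite !ge_min lexx !orbT.
have etaB : 2 * B * eta <= e.
  apply: le_trans (frac _ _ B20 (ltW e0)); rewrite ler_wpM2l//.
  by rewrite !ge_min lexx !orbT.
pose a k : R := p`_k / k.+2%:R.
(* The trailing [+ 0] matches [is_gen_lin], used with the zero function to scale a single pair. *)
pose U x := \sum_(k < size p) a k * (k.+2%:R^-1 * laplace k.+2%:R x + 0).
pose W x := \sum_(k < size p) a k * (k.+2%:R^-1 *
   (f k.+2%:R x * laplace k.+2%:R x - f k.+2%:R x * u x) + 0).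
exists U, W; split.
- apply: (@is_gen_sum _ _ _ hTc (size p) a
    (fun k x => k.+2%:R^-1 * laplace k.+2%:R x + 0)
    (fun k x => k.+2%:R^-1 * (f k.+2%:R x * laplace k.+2%:R x - f k.+2%:R x * u x) + 0)) => k.
  apply: (is_gen_lin hTc k.+2%:R^-1); last exact: is_gen_zero.
  exact: laplace_gen.
- move=> x; rewrite distrC.
  have -> : U x = \int[mu]_(r in `[0, +oo[) (expR (- 2 * r) * p.[expR (- r)] * V r x).
    rewrite (laplace_combination p (mV x) (V_growth x)); apply: eq_bigr => k _.
    by rewrite laplace_V// addr0.
  apply: (le_trans (Hp _ B (B * eta) (mV x) (V_growth x) _)).
    move=> r r0 rt; apply: (le_trans (V_lip x (ltW t0) r0)).
    by rewrite ler_wpM2l.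
  by rewrite (_ : _ + _ = 2 * B * eta); last ring.
- move=> x.
  (* [H s] is the approximate identity applied to [Fs x s], so it is close to [Fs x s t]; integrated
     against the tail it gives [W x], since the tail transforms into [f]. *)
  pose H s := \sum_(k < size p) a k * (expR (- k.+2%:R * s) * (laplace k.+2%:R x - u x)).
  have HE s : 0 <= s -> H s = \int[mu]_(r in `[0, +oo[) (expR (- 2 * r) * p.[expR (- r)] * Fs x s r).
    move=> s0; rewrite (@laplace_combination _ p (Fs x s) (2 * B)).
    - by apply: eq_bigr => k _; rewrite laplace_F// ler_nat.
    - exact: measurable_funTS.
    - move=> r r0; apply: (le_trans (FB x s r)); rewrite ler_peMr// -expR0 ler_expR//.
  have mH : measurable_fun setT H.
    apply: measurable_sum => k; apply: measurable_funM => //; apply: measurable_funM => //.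
    by apply: measurableT_comp => //; exact: measurable_funM.
  have IHk k : mu.-integrable `[0, +oo[ (EFin \o (fun s => a k * (k.+2%:R^-1 * (laplace k.+2%:R x - u x)) * (k.+2%:R * expR (- k.+2%:R * s) * nb x s))).
    by have := integrableZl mD (a k * (k.+2%:R^-1 * (laplace k.+2%:R x - u x))) (tailE x k.+2%:R (ltr0Sn R k.+1)).1.
  have WE : W x = \int[mu]_(s in `[0, +oo[) (nb x s * H s).
    transitivity (\int[mu]_(s in `[0, +oo[) (\sum_(k < size p)
       a k * (k.+2%:R^-1 * (laplace k.+2%:R x - u x)) * (k.+2%:R * expR (- k.+2%:R * s) * nb x s))).
      rewrite (Rintegral_sum (size p) mD IHk); apply: eq_bigr => k _.
      have [I1 E1] := tailE x k.+2%:R (ltr0Sn R k.+1).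
      rewrite (RintegralZl (a k * (k.+2%:R^-1 * (laplace k.+2%:R x - u x))) mD I1).
      rewrite -E1 -/(laplace_exponent (nu x) k.+2%:R).
      move: (a k) (k.+2%:R^-1) (laplace_exponent (nu x) _) (laplace _ x) (u x).
      by move=> a1 a2 a3 a4 a5; ring.
    apply: eq_Rintegral => s _; rewrite /H mulr_sumr; apply: eq_bigr => k _.
    have k0 : k.+2%:R != 0 :> R by [].
    move: (a k) (laplace k.+2%:R x - u x) (expR _) (nb x s) => a1 a2 a3 a4.
    by rewrite -{2}[a3](mulVKf k0); ring.
  have decF s : 0 <= s -> `|Fs x s t| <= 2 * B * expR t * expR (- s).
    move=> s0; have [ts|st] := leP t s.
      by rewrite F0// normr0 !mulr_ge0 ?expR_ge0.
    apply: (le_trans (FB x s t)); rewrite -mulrA ler_peMr// -expRD -expR0 ler_expR.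
    by rewrite subr_ge0 ltW.
  (* The decay in s comes from applying [Hp] to [expR s * Fs x s r], which vanishes for [r <= s] and
     so grows at most like [2 B expR r], with a constant free of s. *)
  have HF s : 0 <= s -> `|H s - Fs x s t| <= (om * expR (t + 1) + eta * (2 * B)) * expR (- s).
    move=> s0; rewrite HE//.
    have mG : measurable_fun (`[0, +oo[ : set R) (fun r => expR s * Fs x s r).
      by apply: measurable_funTS; exact: measurable_funM.
    have GB r : 0 <= r -> `|expR s * Fs x s r| <= 2 * B * expR r.
      move=> r0; have [rs|sr] := leP r s.
        by rewrite F0// mulr0 normr0 !mulr_ge0 ?expR_ge0.
      rewrite normrM ger0_norm ?expR_ge0// mulrC ler_pM ?expR_ge0//.
      by rewrite ler_expR ltW.
    have := Hp (fun r => expR s * Fs x s r) (2 * B) (om * expR (t + 1)) mG GB.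
    rewrite (_ : \int[mu]_(r in `[0, +oo[) (expR (- 2 * r) * p.[expR (- r)] * (expR s * Fs x s r)) =
       expR s * \int[mu]_(r in `[0, +oo[) (expR (- 2 * r) * p.[expR (- r)] * Fs x s r)); last first.
      rewrite (laplace_combination p mG GB) -HE// mulr_sumr; apply: eq_bigr => k _.
      have k2 : (2 : R) <= k.+2%:R by rewrite ler_nat.
      have IF : mu.-integrable `[0, +oo[ (EFin \o (fun r => k.+2%:R * expR (- k.+2%:R * r) * Fs x s r)).
        apply: (@laplace_integrable _ _ (2 * B)) => //; first exact: measurable_funTS.
        by move=> r r0; apply: (le_trans (FB x s r)); rewrite ler_peMr// -expR0 ler_expR.
      rewrite mulrCA; congr (_ * _); rewrite -laplace_F// -(RintegralZl (expR s) mD IF).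
      by apply: eq_Rintegral => r _; rewrite mulrCA.
    move=> /(_ _)HH; rewrite -mulrBr normrM ger0_norm ?expR_ge0// in HH.
    rewrite expRN ler_pdivlMr ?expR_gt0// mulrC; apply: HH => r r0 rt.
    (* For [s > t + 1] both values vanish, as [|r - t| <= eta <= 1]. *)
    have [st|ts] := leP s (t + 1); last first.
      have ts' : t <= s by rewrite ltW// (lt_trans _ ts)// ltrDl.
      have rs : r <= s.
        move: rt; rewrite ler_distl => /andP[_ rt]; rewrite ltW//; apply: (le_lt_trans rt).
        by apply: le_lt_trans ts; rewrite lerD2l.
      by rewrite (F0 _ _ _ rs) (F0 _ _ _ ts') subrr normr0 mulr_ge0 ?expR_ge0// ltW.
    rewrite -mulrBr normrM ger0_norm ?expR_ge0// mulrC ler_pM ?expR_ge0 ?ler_expR//.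
    rewrite /Fs opprB addrA subrK; apply: Hd => //.
    apply: (@le_trans _ _ `|r - t|); last exact: le_trans rt etad.
    have := ler_norm (r - t); have := ler_norm (t - r); rewrite [`|t - r|]distrC => h1 h2.
    by rewrite /Num.max; case: ifP => a1; case: ifP => a2; rewrite ler_norml; lra.
  have IF := Ig x _ _ (measurable_funTS (mF' x t)) decF.
  have tE : \int[mu]_(s in `[0, t]) ((Pi s u x - u x) * fine (tail nu (t - s) x)) =
      \int[mu]_(s in `[0, +oo[) (nb x s * Fs x s t).
    pose G s : \bar R := (nb x s * Fs x s t)%:E.
    have mDt : measurable (`[0, t]%classic : set (measurableTypeR R)) by exact: measurable_itv.
    have mG : measurable_fun (`[0, t]%classic : set (measurableTypeR R)) G.
      case/integrableP : IF => m1 _; apply: measurable_funS m1 => //.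
      by apply: subset_itv; rewrite bnd_simp.
    transitivity (\int[mu]_(s in `[0, t]) (nb x s * Fs x s t)); last first.
      rewrite Rintegral_mkcond [RHS]Rintegral_mkcond; apply: eq_Rintegral => s _.
      rewrite !patchE !mem_setE !in_itv/= !andbT.
      by case: (leP 0 s) => //= s0; case: (leP s t) => // ts; rewrite F0 ?mulr0// ltW.
    have mo : measurable_fun (-%R @^-1` `[0, t]%classic : set (measurableTypeR R))
        (-%R : measurableTypeR R -> measurableTypeR R).
      by apply: measurable_funTS; apply: measurable_funN => //; exact: measurable_id.
    have mD' : measurable (-%R @^-1` `[0, t]%classic : set (measurableTypeR R)).
      rewrite opp_preimage_itvbndbnd; exact: measurable_itv.
    have mGo : measurable_fun (-%R @^-1` `[0, t]%classic : set (measurableTypeR R)) (fun s => G (- s)).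
      apply: (measurable_comp mDt _ mG mo) => _ [s /= hs <-]; exact: hs.
    rewrite [RHS]/Rintegral -/G (integral_reflect mDt mG) (integral_shift (- t) mD' mGo).
    rewrite (_ : _ @^-1` _ = `[0, t]%classic); last first.
      by apply/seteqP; split => s /=; rewrite !in_itv/=; lra.
    rewrite /Rintegral; congr fine; apply: eq_integral => s; rewrite inE/= in_itv/= => /andP[s0 st].
    by rewrite opprB /G /nb /Fs subKr max_l// mulrC.
  have decHF : forall s, 0 <= s -> `|H s| <= ((om * expR (t + 1) + eta * (2 * B)) + 2 * B * expR t) * expR (- s).
    move=> s s0; rewrite mulrDl -[H s](subrK (Fs x s t)).
    by apply: (le_trans (ler_normD _ _)); apply: lerD; [exact: HF|exact: decF].
  have IH := Ig x _ _ (measurable_funTS mH) decHF.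
  rewrite tE WE distrC.
  pose K := om * expR (t + 1) + eta * (2 * B).
  have K0 : 0 <= K by rewrite addr_ge0// mulr_ge0 ?expR_ge0 ?(ltW om0) ?(ltW eta0).
  have IK : mu.-integrable `[0, +oo[ (EFin \o (fun s => K * (expR (- s) * nb x s))).
    by have := integrableZl mD K (Inb x).
  apply: (@le_trans _ _ (\int[mu]_(s in `[0, +oo[) (K * (expR (- s) * nb x s)))).
    apply: (Rintegral_dist_le mD IH IF IK) => s /=; rewrite in_itv/= andbT => s0.
    rewrite -mulrBr normrM (ger0_norm (nb0 x s)) mulrA mulrC ler_wpM2r//.
    exact: HF.
  rewrite (RintegralZl K mD (Inb x)); apply: (@le_trans _ _ (K * C1)).
    by rewrite ler_wpM2l.
  rewrite /K mulrDl (splitr e); apply: lerD.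
    apply: le_trans (frac _ _ CE0 (ltW e2)).
    by rewrite -/om [leLHS]mulrC [leLHS]mulrCA [leLHS]mulrC.
  by rewrite [leLHS]mulrC [leLHS]mulrCA [leLHS]mulrC.
Qed.

End mild_solution.

Theorem theorem3p7 (R : realType) (d : nat) (d_gt0 : (0 < d)%N)
    (dO : measure_display) (Omega : measurableType dO)
    (F : R -> set (set Omega)) (M : R -> Omega -> 'rV[R]_d)
    (theta : R -> Omega -> Omega) (P : 'rV[R]_d -> probability Omega R)
    (sigma : R -> Omega -> R)
    (nu : 'rV[R]_d -> {measure set R -> \bar R})
    (q : 'rV[R]_d -> 'rV[R]_d -> R[i]) (l : 'rV[R]_d -> 'rV[R]_d)
    (Q : 'rV[R]_d -> 'M[R]_d) (N : 'rV[R]_d -> {measure set 'rV[R]_d -> \bar R})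
    (chi : R -> R)
    (hM : hunt_process F M theta P)
    (hsigma : markov_additive_process F M theta P sigma)
    (hnu : conditional_levy_structure M P sigma nu)
    (hT : feller_semigroup setT (semigroup M P))
    (hP : feller_semigroup (half_space (V := 'rV[R]_d))
            (joint_semigroup M P sigma))
    (hG : forall u, Cc_infty setT u -> generator_dom setT (semigroup M P) u)
    (hA : forall h, Cc_infty (half_space (V := 'rV[R]_d)) h ->
      generator_dom (half_space (V := 'rV[R]_d)) (joint_semigroup M P sigma) h)
    (hq : has_symbol (generator setT (semigroup M P)) q)
    (hlk : levy_khintchine q l Q N chi)
    (hq0 : forall x, q x 0 = 0)
    (hbdd : bounded_coefficients q l Q N)
    (hf : forall lambda : R, 0 < lambda ->
      continuous (fun x => laplace_exponent (nu x) lambda))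
    (hnu_sup : (ereal_sup [set \int[nu x]_(s in `]0%R, +oo[)
                                 (Num.min s 1)%:E | x in setT] < +oo)%E)
    (hu : exists (d' : measure_display) (Omega' : measurableType d')
            (P' : probability Omega' R) (S : R -> Omega' -> R)
            (mu : {measure set R -> \bar R}),
      [/\ subordinator P' S, levy_measure_of P' S mu,
          mu `]0, +oo[%classic = +oo%E &
          forall s : R, 0 < s ->
            ereal_inf [set tail nu s x | x in setT] = mu `]s, +oo[%classic])
    (hv : forall delta : R, 0 < delta ->
      ereal_sup [set P x [set w | (delta%:E < running_sup M t w)%E] | x in setT]
        @[t --> 0^'+] --> 0%E)
    (hvi : forall lambda : R, 0 < lambda -> exists c C : R,
      [/\ 0 < c, c <= C & forall x,
          c <= laplace_exponent (nu x) lambda <= C]) :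
  forall u, C0 setT u ->
    mild_solution (generator setT (semigroup M P)) nu u
      (fun t => time_changed_semigroup M P sigma t u).
Proof.
move=> u Cu.
have rate_unbounded : forall K : R, exists2 l, 0 < l & forall x, K <= laplace_exponent (nu x) l.
  have [? [? [? [? [m [_ _ moo minf]]]]]] := hu.
  exact: (exponent_unbounded hnu moo minf).
have [B B0 uB] := C0_bounded Cu.
have time0 : time_changed_semigroup M P sigma 0 u = u.
  by apply/funext => x; exact: (time_changed0 hM hsigma x Cu).
have eqn t : 0 <= t -> generator setT (semigroup M P)
    (fun x => \int[@lebesgue_measure R]_(s in `[0, t]) time_changed_semigroup M P sigma s u x)
    (fun x => \int[@lebesgue_measure R]_(s in `[0, t])
      ((time_changed_semigroup M P sigma s u x - u x) * fine (tail nu (t - s) x))).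
  (* The approximate identity needs [0 < t]; at [t = 0] both integrals are over a single point. *)
  rewrite le_eqVlt => /predU1P[<-|t0]; apply/generatorP.
    under eq_fun do rewrite set_itv1 Rintegral_set1.
    under [X in is_gen _ _ X]eq_fun do rewrite set_itv1 Rintegral_set1.
    exact: (is_gen_zero (semigroup_contraction hM hT)).
  exact: (mild_time_changed hM hsigma hnu hT hP hf hvi rate_unbounded Cu B0 uB).
split => //.
- by move=> t t0; exact: (time_changed_C0 hM hsigma hnu hT hP hf hvi rate_unbounded Cu B0 uB).
- move=> t t0; apply/uniform_cvgP => e e0.
  have [dl dl0 h] := time_changed_modulus hM hsigma hnu hT hf hvi rate_unbounded Cu e0.
  apply/nbhs_ballP; exists dl => //= s; rewrite /ball/= => ts s0 x _.
  by apply: h => //; rewrite distrC ltW.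
- by move=> t t0; eexists; exact: (eqn t t0).
Qed.
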